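(* Let $n>m$, $\boldsymbol\lambda=(\lambda_1,\dots,\lambda_m)\in\mathbb{C}^m$, and $f\in L^1(V_{n,m})$. The integral $$(T^{\boldsymbol\lambda}f)(u)=\int_{V_{n,m}} f(v)\,(u'vv'u)^{\boldsymbol\lambda}\,dv$$ converges absolutely for almost all $u\in V_{n,m}$ (for every $f\in L^1(V_{n,m})$) if and only if $\mathrm{Re}\,\lambda_j>j-m-1$ for all $j=1,\dots,m$, and it represents an analytic function of $\boldsymbol\lambda$ in this domain. For such $\boldsymbol\lambda$, the linear operator $T^{\boldsymbol\lambda}$ is bounded on $L^1(V_{n,m})$.
   Context: $V_{n,m}=\{v\in\mathbb{R}^{n\times m}: v'v=I_m\}$ is the Stiefel manifold of orthonormal $m$-frames in $\mathbb{R}^n$ ($v'$ the transpose), with its $O(n)$-invariant measure $dv$. For a positive definite symmetric $m\times m$ matrix $r$ with leading principal minors $\Delta_1(r),\dots,\Delta_m(r)=\det r$ and $\Delta_0(r)=1$, the composite power function is $r^{\boldsymbol\lambda}=\prod_{i=1}^m[\Delta_i(r)/\Delta_{i-1}(r)]^{\lambda_i/2}$ (the matrix $u'vv'u$ is positive definite for almost all $v$). *)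

(* Defs.v *)
From HB Require Import structures.
From mathcomp Require Import all_boot all_order all_algebra.
From mathcomp Require Import all_classical all_reals all_analysis.
From mathcomp Require Import complex.

Set Implicit Arguments.
Unset Strict Implicit.
Unset Printing Implicit Defensive.

Import Order.TTheory GRing.Theory Num.Theory.
Local Open Scope classical_set_scope.
Local Open Scope ring_scope.

(** Real matrices are pointed (by 0); needed for the generated sigma-algebra. *)
Definition rmx (R : realType) (n m : nat) := 'M[R]_(n, m).
HB.instance Definition _ (R : realType) (n m : nat) := Choice.on (rmx R n m).
HB.instance Definition _ (R : realType) (n m : nat) :=
  isPointed.Build (rmx R n m) 0.

Section Defs.
Variable R : realType.

(** Borel sigma-algebra on R^{n x m}: generated by the coordinate maps. *)
Definition mx_entry_gen (n m : nat) : set (set (rmx R n m)) :=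
  [set A | exists (i : 'I_n) (j : 'I_m) (B : set R),
      measurable B /\ A = (fun M : rmx R n m => M i j) @^-1` B].

End Defs.

Notation MX R n m := (g_sigma_algebraType (@mx_entry_gen R n m)).

Section Defs2.
Variable R : realType.
Local Notation MX n m := (MX R n m).

Definition stiefel (n m : nat) : set 'M[R]_(n, m) :=
  [set v | v^T *m v = 1%:M].

Definition orthogonal_mx (n : nat) (Q : 'M[R]_n) : Prop := Q^T *m Q = 1%:M.

(** mu is a (nonzero, finite) O(n)-invariant measure on V_{n,m}
    (unique up to a positive constant factor). *)
Definition stiefel_invariant_measure (n m : nat)
    (mu : {measure set (MX n m) -> \bar R}) : Prop :=
  [/\ (0 < mu setT)%E, (mu setT < +oo)%E,
      mu (~` (@stiefel n m : set (MX n m))) = 0%E &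
      forall Q : 'M[R]_n, orthogonal_mx Q ->
        forall A : set (MX n m), measurable A ->
          mu ((fun v : MX n m => (Q *m v : 'M[R]_(n, m))) @^-1` A) = mu A].

Definition cintegrable d (T : measurableType d) (mu : {measure set T -> \bar R})
    (D : set T) (f : T -> R[i]) : Prop :=
  mu.-integrable D (fun x => (complex.Re (f x))%:E) /\
  mu.-integrable D (fun x => (complex.Im (f x))%:E).

Definition cintegral d (T : measurableType d) (mu : {measure set T -> \bar R})
    (D : set T) (f : T -> R[i]) : R[i] :=
  Complex (Rintegral mu D (fun x => complex.Re (f x))) (Rintegral mu D (fun x => complex.Im (f x))).

(** x^z = exp(z log x) for x > 0 (principal branch); set to 0 for x <= 0
    (only occurs on a null set of v). *)
Definition cpow (x : R) (z : R[i]) : R[i] :=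
  if 0 < x then
    Complex (expR (complex.Re z * ln x) * cos (complex.Im z * ln x))
            (expR (complex.Re z * ln x) * sin (complex.Im z * ln x))
  else 0.

(** Leading principal minor Delta_k(r) of an m x m matrix, for k <= m
    (Delta_0 = det of the empty matrix = 1). *)
Definition lminor (m : nat) (r : 'M[R]_m) (k : nat) (hk : (k <= m)%N) : R :=
  \det (\matrix_(a < k, b < k) r (widen_ord hk a) (widen_ord hk b)).

(** Composite power r^lambda = prod_{i=1}^m (Delta_i(r)/Delta_{i-1}(r))^{lambda_i/2};
    lambda is indexed by 'I_m, so lam j stands for lambda_{j+1}. *)
Definition cmpow (m : nat) (r : 'M[R]_m) (lam : 'I_m -> R[i]) : R[i] :=
  \prod_(j < m)
     cpow (lminor r (ltn_ord j) / lminor r (ltnW (ltn_ord j))) (lam j / 2%:R).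

Definition Tkernel (n m : nat) (u v : 'M[R]_(n, m)) (lam : 'I_m -> R[i]) : R[i] :=
  cmpow ((u^T *m v) *m (v^T *m u)) lam.

Definition Top (n m : nat) (mu : {measure set (MX n m) -> \bar R})
    (lam : 'I_m -> R[i]) (f : MX n m -> R[i]) (u : MX n m) : R[i] :=
  cintegral mu setT (fun v : MX n m => f v * Tkernel u v lam).

(** The domain Re lambda_j > j - m - 1 (j = 1..m); with 0-based j : 'I_m
    this reads Re (lam j) > (j+1) - m - 1 = j - m. *)
Definition Tdomain (m : nat) (lam : 'I_m -> R[i]) : Prop :=
  forall j : 'I_m, (j%:R - m%:R : R) < complex.Re (lam j).

Definition cnorm (z : R[i]) : R := Normc.normc z.

(** Analyticity in several complex variables: near every point a of D,
    F is the sum of an absolutely convergent power series in (z - a)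
    on a polydisc contained in D. Partial sums are taken over boxes
    {k | k_j < N for all j}, which exhaust all multi-indices. *)
Definition analytic_on (m : nat) (D : set ('I_m -> R[i]))
    (F : ('I_m -> R[i]) -> R[i]) : Prop :=
  forall a, D a ->
  exists r : R, 0 < r /\
  exists c : ('I_m -> nat) -> R[i],
  forall z : 'I_m -> R[i], (forall j, cnorm (z j - a j) < r) ->
    [/\ D z,
        (exists B : R, forall N : nat,
           \sum_(k : {ffun 'I_m -> 'I_N})
              cnorm (c (fun j => nat_of_ord (k j))) *
              \prod_(j < m) cnorm (z j - a j) ^+ k j <= B) &
        (forall e : R, 0 < e -> exists N0 : nat, forall N : nat, (N0 <= N)%N ->
           cnorm (\sum_(k : {ffun 'I_m -> 'I_N})
                     c (fun j => nat_of_ord (k j)) *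
                     \prod_(j < m) (z j - a j) ^+ k j - F z) < e)].

End Defs2.

(* Main.v *)
(* The modulus of the kernel is a composite power with real exponents
   s_j = Re lambda_j / 2, so by invariance its integral over v is the same constant
   M(s) for every frame u. Integrating the kernel of (G, v) against mu and an n x m
   standard Gaussian matrix G, in both orders, gives
     M(s) * prod_j E|g_(n-j)|^(2 s_j) = mu(V) * prod_j E|g_(m-j)|^(2 s_j)
   with g_a a standard Gaussian vector of R^a and j counted from 0: a thin QR
   decomposition of G produces the factor M(s) on the left, v'G is an m x m
   Gaussian matrix, and the composite power of a Gaussian Gram matrix is integrated
   by rotating the first column onto an axis and induction on the columns. Since
   E|g_a|^(2s) is finite iff 2s > -a, M(s) is finite iff Re lambda_j > j - m for all
   j. Rotation invariance of the Gaussian measure comes from its characterization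
   by the Cameron-Martin (translation) formula, which avoids changes of variables.
   Tonelli then gives convergence and the L^1 bound; as the ratios of consecutive
   minors are at most 1 on frames, countably many exponents dominate the whole
   domain, and the exponential series of x^(w/2) can be integrated term by term. *)
Require Import Defs.
From HB Require Import structures.
From mathcomp Require Import all_boot all_order all_algebra.
From mathcomp Require Import all_classical all_reals all_analysis.
From mathcomp Require Import measurable_realfun complex ring lra.
Set Implicit Arguments.
Unset Strict Implicit.
Unset Printing Implicit Defensive.
Import Order.TTheory GRing.Theory Num.Theory.
Local Open Scope classical_set_scope.
Local Open Scope ring_scope.

(** * Leading minors and frames *)

(** Complex powers are replaced by their moduli [ppow], which vanish on nonpositive numbers as
    [cpow] does. Identities such as the congruence formula then hold for all matrices, degenerate
    ones included, and the integrals live in the nonnegative extended reals. Infinite values cannot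
    be divided out there, so the identity for M(s) is used by contradiction in both directions. For
    sufficiency, the moments on the left are positive, so M(s) = +oo would make the finite right
    side infinite. For necessity, suppose that Re lambda_j <= j - m for some j. The exponents are
    raised until the j-th moment on the right is exactly critical and all other exponents are
    nonnegative; M can only decrease, since the ratios of minors are at most 1 on frames. The right
    side is now infinite, while n > m keeps the moments on the left finite, so M is infinite. The
    L^1 bound integrates the kernel over u instead of v. The composite power is not symmetric in the
    two frames, but both partial integrals are constant on frames and have the same total over the
    product. *)

Section linear_algebra.
Context {R : realType}.

Definition gram p k (M : 'M[R]_(p, k)) : 'M[R]_k := M^T *m M.

Definition upper p k (T : 'M[R]_(p, k)) :=
  forall (i : 'I_p) (j : 'I_k), (j < i)%N -> T i j = 0.

Lemma gram_orthogonal_mul p q k (Q : 'M[R]_(p, q)) (M : 'M[R]_(q, k)) :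
  Q^T *m Q = 1%:M -> gram (Q *m M) = gram M.
Proof. by move=> Q1; rewrite /gram trmx_mul mulmxA -(mulmxA M^T) Q1 mulmx1. Qed.

Lemma gram_diagE p k (M : 'M[R]_(p, k)) j : gram M j j = \sum_i M i j ^+ 2.
Proof. by rewrite mxE; apply: eq_bigr => i _; rewrite mxE expr2. Qed.

Lemma lminorE j l (r : 'M[R]_(j + l)) (h : (j <= j + l)%N) :
  lminor r h = \det (ulsubmx r).
Proof.
rewrite /lminor; congr (\det _); apply/matrixP => a b; rewrite !mxE.
by congr (r _ _); apply: val_inj.
Qed.

(** The lower left block of an upper triangular [t] vanishes, so the leading block of t'rt is the
    product of the leading blocks of the three factors. *)
Lemma lminor_congr_upper k (t r : 'M[R]_k) j (hj : (j <= k)%N) : upper t ->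
  lminor (t^T *m r *m t) hj =
  lminor r hj * \prod_(i < j) t (widen_ord hj i) (widen_ord hj i) ^+ 2.
Proof.
move=> ut; have [l def_k] : exists l, k = (j + l)%N.
  by exists (k - j)%N; rewrite subnKC.
move: t r hj ut; rewrite def_k => t r hj ut; rewrite !lminorE.
have dl0 : dlsubmx t = 0.
  apply/matrixP => a b; rewrite !mxE ut//=.
  by rewrite (leq_trans (ltn_ord b))// leq_addr.
rewrite -[t in LHS]submxK -[r in LHS]submxK dl0 tr_block_mx !mulmx_block.
rewrite block_mxKul !trmx0 !mul0mx !mulmx0 !addr0 !det_mulmx det_tr.
have -> : \det (ulsubmx t) = \prod_(i < j) t (widen_ord hj i) (widen_ord hj i).
  rewrite -det_tr det_trig.
    apply: eq_bigr => i _; rewrite !mxE.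
    by congr (t _ _); apply: val_inj.
  by apply/is_trig_mxP => a b ab; rewrite !mxE ut.
by rewrite mulrAC -expr2 prodrXl mulrC.
Qed.

Definition mratio k (r : 'M[R]_k) (j : 'I_k) : R :=
  lminor r (ltn_ord j) / lminor r (ltnW (ltn_ord j)).

(** The modulus of [cpow]. Unlike [powR], it is 0 for every x <= 0, whatever the exponent. *)
Definition ppow (x s : R) : R := if 0 < x then x `^ s else 0.

Definition pkernel k (s : 'I_k -> R) (r : 'M[R]_k) : R :=
  \prod_j ppow (mratio r j) (s j).

Lemma ppow_ge0 x s : 0 <= ppow x s.
Proof. by rewrite /ppow; case: ifP => // _; exact: powR_ge0. Qed.

Lemma ppow_le0 x s : x <= 0 -> ppow x s = 0.
Proof. by rewrite /ppow leNgt => /negbTE ->. Qed.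

Lemma ppow1 s : ppow 1 s = 1.
Proof. by rewrite /ppow ltr01 powR1. Qed.

Lemma ppowMr x y s : 0 < y -> ppow (x * y) s = ppow x s * ppow y s.
Proof.
move=> y0; rewrite /ppow y0 pmulr_lgt0//; case: ifP => [x0|]; last by rewrite mul0r.
by rewrite powRM// ltW.
Qed.

Lemma ppow_le_exp x s t : x <= 1 -> t <= s -> ppow x s <= ppow x t.
Proof.
move=> x1 ts; rewrite /ppow; case: ifP => // x0.
by rewrite ger_powR// x0 x1.
Qed.

Lemma pkernel_ge0 k s (r : 'M[R]_k) : 0 <= pkernel s r.
Proof. by apply: prodr_ge0 => j _; exact: ppow_ge0. Qed.

Lemma lminor_ltn_recr k (t : 'M[R]_k) (j : 'I_k) :
  \prod_(i < j.+1) t (widen_ord (ltn_ord j) i) (widen_ord (ltn_ord j) i) ^+ 2 =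
  (\prod_(i < j) t (widen_ord (ltnW (ltn_ord j)) i)
     (widen_ord (ltnW (ltn_ord j)) i) ^+ 2) * t j j ^+ 2.
Proof.
rewrite big_ord_recr /=; congr (_ * _).
  by apply: eq_bigr => i _; congr (t _ _ ^+ 2); apply: val_inj.
by congr (t _ _ ^+ 2); apply: val_inj.
Qed.

(** Minors of consecutive orders gain the same squared diagonal entries of [t] except the last one,
    so the j-th ratio is multiplied by t_jj^2. *)
Lemma pkernel_congr_upper k s (t r : 'M[R]_k) : upper t ->
  pkernel s (t^T *m r *m t) = pkernel s r * \prod_j ppow (t j j ^+ 2) (s j).
Proof.
move=> ut; have [/forallP t0|/forallPn[j]] := boolP [forall j, t j j != 0]; last first.
  (* If t_jj = 0, the minor of order j+1 vanishes after the congruence, and [ppow] makes the j-th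
     factor 0 on both sides. *)
  rewrite negbK => /eqP tj0.
  rewrite /pkernel [LHS](bigD1 j)//= [X in _ = _ * X](bigD1 j)//=.
  rewrite /mratio !lminor_congr_upper// lminor_ltn_recr tj0.
  by rewrite expr0n/= !mulr0 mul0r ppow_le0// !mul0r mulr0.
rewrite /pkernel -big_split/=; apply: eq_bigr => j _.
have tj2 : 0 < t j j ^+ 2 by rewrite exprn_even_gt0//= t0.
rewrite -ppowMr//; congr (ppow _ _).
rewrite /mratio !lminor_congr_upper// lminor_ltn_recr.
set P := \prod_(i < j) _.
have P0 : P != 0 by apply/prodf_neq0 => i _; rewrite expf_neq0.
rewrite invfM; set b := (lminor r _)^-1.
by field.
Qed.

Lemma pkernel1 k s : pkernel s (1%:M : 'M[R]_k) = 1.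
Proof.
rewrite /pkernel big1// => j _.
suff m1 i (h : (i <= k)%N) : lminor (1%:M : 'M[R]_k) h = 1.
  by rewrite /mratio !m1 divr1 ppow1.
rewrite /lminor -[RHS](det1 R i); congr (\det _).
by apply/matrixP => a b; rewrite !mxE.
Qed.

Definition sqnorm p (g : 'cV[R]_p) : R := \sum_i g i 0 ^+ 2.

Lemma sqnorm_ge0 p (g : 'cV[R]_p) : 0 <= sqnorm g.
Proof. by apply: sumr_ge0 => i _; exact: sqr_ge0. Qed.

Lemma sqnormE p (g : 'cV[R]_p) : g^T *m g = (sqnorm g)%:M.
Proof. by rewrite [LHS]mx11_scalar -/(gram g) gram_diagE. Qed.

Lemma sqnorm_eq0 p (g : 'cV[R]_p) : sqnorm g = 0 -> g = 0.
Proof.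
move=> g0; apply/colP => i; rewrite mxE.
have := psumr_eq0P (fun j _ => sqr_ge0 (g j 0)) g0 => /(_ i isT) /eqP.
by rewrite sqrf_eq0 => /eqP.
Qed.

Lemma reflection_orthogonal p (w : 'cV[R]_p) : sqnorm w != 0 ->
  let H := 1%:M - (2 / sqnorm w) *: (w *m w^T) in H^T *m H = 1%:M.
Proof.
set c := 2 / sqnorm w => w0 /=.
have -> : (1%:M - c *: (w *m w^T))^T = 1%:M - c *: (w *m w^T).
  by rewrite [LHS]linearB/= trmx1 linearZ/= trmx_mul trmxK.
rewrite mulmxBr mulmx1 mulmxBl mul1mx -scalemxAl -scalemxAr.
have -> : w *m w^T *m (w *m w^T) = sqnorm w *: (w *m w^T).
  by rewrite mulmxA -(mulmxA w) sqnormE mul_mx_scalar scalemxAl.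
rewrite !scalerA.
have -> : c * c * sqnorm w = c + c by rewrite /c; field.
by rewrite scalerDl opprB addrK subrK.
Qed.

(* Reflection exchanging g and |g| e_1. *)
Lemma householder p (g : 'cV[R]_(1 + p)) :
  exists Q : 'M[R]_(1 + p), Q^T *m Q = 1%:M /\
    Q *m g = col_mx (Num.sqrt (sqnorm g))%:M 0.
Proof.
set h : 'cV[R]_(1 + p) := col_mx _ 0.
have hh : h^T *m h = (sqnorm g)%:M.
  rewrite tr_col_mx mul_row_col trmx0 mul0mx addr0 tr_scalar_mx -scalar_mxM.
  by rewrite -expr2 sqr_sqrtr// sqnorm_ge0.
have [w def_w] : exists w, w = g - h by exists (g - h).
have [/sqnorm_eq0 w0|w0] := eqVneq (sqnorm w) 0.
  exists 1%:M; rewrite trmx1 mulmx1 mul1mx; split => //.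
  by apply/eqP; rewrite -subr_eq0 -def_w w0.
exists (1%:M - (2 / sqnorm w) *: (w *m w^T)); split.
  exact: reflection_orthogonal.
rewrite mulmxBl mul1mx -scalemxAl -mulmxA.
(* As g and h have the same length, |g - h|^2 = 2 (g - h)'g; hence the reflection subtracts exactly
   w from g. *)
have -> : w^T *m g = (sqnorm w / 2)%:M.
  have -> : w^T *m g = 2^-1 *: (w^T *m w).
    rewrite [RHS]mx11_scalar [LHS]mx11_scalar; congr (_%:M).
    have gh : (g^T *m h) 0 0 = (h^T *m g) 0 0.
      by rewrite -[in RHS](trmxK g) -trmx_mul [RHS]mxE.
    rewrite [RHS]mxE def_w [(g - h)^T]linearB/= !mulmxBl !mulmxBr hh sqnormE.
    move: gh; move: (g^T *m h) (h^T *m g) => a b gh.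
    by rewrite !mxE gh eqxx !mulr1n; field.
  by rewrite sqnormE scale_scalar_mx mulrC.
rewrite mul_mx_scalar scalerA (_ : _ * _ = 1) ?scale1r; last by field.
by rewrite def_w opprB addrC subrK.
Qed.

End linear_algebra.

(** * QR decomposition and bounds on the ratios of minors *)

Section qr.
Context {R : realType}.

(** Householder reduction: a reflection sends the first column to the first axis, and the induction
    treats the lower right block. *)
Lemma qr p k (G : 'M[R]_(p, k)) : exists (Q : 'M[R]_p) (T : 'M[R]_(p, k)),
  [/\ Q^T *m Q = 1%:M, upper T & G = Q *m T].
Proof.
elim: k p G => [|k IH] p G.
  by exists 1%:M, G; rewrite trmx1 !mul1mx; split => // i [].
case: p G => [|p] G; first by exists 1%:M, G; rewrite trmx1 !mul1mx; split => // -[].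
change 'M[R]_(1 + p, 1 + k) in G.
change (exists (Q : 'M[R]_(1 + p)) (T : 'M[R]_(1 + p, 1 + k)),
  [/\ Q^T *m Q = 1%:M, upper T & G = Q *m T]).
have [H [HH Hg]] := householder (lsubmx G).
have HH' : H *m H^T = 1%:M by apply: mulmx1C.
have [Q [T [QQ uT NE]]] := IH _ (drsubmx (H *m G)).
exists (H^T *m block_mx 1%:M 0 0 Q).
exists (block_mx (ulsubmx (H *m G)) (ursubmx (H *m G)) 0 T).
split.
- rewrite trmx_mul trmxK mulmxA -(mulmxA _ H) HH' mulmx1 tr_block_mx mulmx_block.
  rewrite !trmx0 !trmx1 !mulmx0 !mul0mx QQ !mul1mx !addr0 !add0r.
  by rewrite -scalar_mx_block.
- move=> i j; case: (split_ordP i) => i' ->; case: (split_ordP j) => j' ->.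
  + by rewrite !ord1.
  + by rewrite /= ord1.
  + by rewrite block_mxEdl mxE.
  + by rewrite block_mxEdr /= ltn_add2l; exact: uT.
- rewrite -mulmxA mulmx_block !mul1mx !mul0mx !addr0 !mulmx0 !add0r -NE.
  have dl0 : dlsubmx (H *m G) = 0.
    rewrite -[in LHS](hsubmxK G) mul_mx_row.
    by rewrite Hg -[H *m rsubmx G]vsubmxK -block_mxEh block_mxKdl.
  rewrite -[X in block_mx _ _ X]dl0 submxK mulmxA.
  by rewrite HH mul1mx.
Qed.

(** The rows of the triangular factor below the k-th are zero. In this form [pid_mx k] serves as a
    base frame, moved by an orthogonal matrix on the left and a triangular one on the right. *)
Lemma thin_qr p k (G : 'M[R]_(p, k)) : (k <= p)%N ->
  exists (Q : 'M[R]_p) (t : 'M[R]_k),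
  [/\ Q^T *m Q = 1%:M, upper t & G = Q *m pid_mx k *m t].
Proof.
move=> kp; have [Q [T [QQ uT ->]]] := qr G.
exists Q, (\matrix_(i, j) T (widen_ord kp i) j); split => //.
  by move=> i j ij; rewrite mxE uT.
rewrite -mulmxA; congr (_ *m _); apply/matrixP => i j; rewrite mxE.
have [ik|ki] := ltnP i k.
  rewrite (bigD1 (Ordinal ik))//= big1 ?addr0.
    rewrite !mxE eqxx/= ik mul1r; congr (T _ _); exact: val_inj.
  move=> l li; rewrite !mxE ik andbT (_ : _ == _ = false) ?mul0r//.
  by apply/negbTE; apply: contra li => /eqP il; apply/eqP/val_inj.
rewrite uT ?(leq_trans (ltn_ord _))// big1// => l _.
by rewrite !mxE ltnNge ki andbF mul0r.
Qed.

Lemma gram_pid_mx p k : (k <= p)%N -> gram (pid_mx k : 'M[R]_(p, k)) = 1%:M.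
Proof.
by move=> kp; rewrite /gram tr_pid_mx mul_pid_mx minnn (minn_idPr kp) pid_mx_1.
Qed.

Lemma gram_mul p k q (M : 'M[R]_(p, k)) (t : 'M[R]_(k, q)) :
  gram (M *m t) = t^T *m gram M *m t.
Proof. by rewrite /gram trmx_mul !mulmxA. Qed.

Lemma lminor1 k j (hj : (j <= k)%N) : lminor (1%:M : 'M[R]_k) hj = 1.
Proof.
rewrite /lminor -[RHS](det1 R j); congr (\det _).
by apply/matrixP => a b; rewrite !mxE.
Qed.

(** For independent columns the ratio is the squared distance t_jj^2 of column j to the span of the
    preceding ones, hence at most the squared length of the column. *)
Lemma mratio_gram_diag p k (M : 'M[R]_(p, k)) (j : 'I_k) : (k <= p)%N ->
  0 <= mratio (gram M) j <= gram M j j.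
Proof.
move=> kp; have [Q [t [QQ ut ->]]] := thin_qr M kp.
rewrite -mulmxA gram_orthogonal_mul// gram_mul gram_pid_mx//.
rewrite /mratio !lminor_congr_upper// !lminor1 !mul1r lminor_ltn_recr.
set P := \prod_(i < j) _; have P0 : 0 <= P by apply: prodr_ge0 => i _; exact: sqr_ge0.
rewrite mulmx1 -/(gram t) gram_diagE (bigD1 j)//=.
have s0 : 0 <= \sum_(i < k | i != j) t i j ^+ 2.
  by apply: sumr_ge0 => i _; exact: sqr_ge0.
(* When the preceding columns are dependent, the ratio is a division by 0, whose value is 0. *)
have [->|P0'] := eqVneq P 0; first by rewrite mul0r mul0r lexx addr_ge0// sqr_ge0.
by rewrite mulrC mulKf// sqr_ge0 lerDl.
Qed.

(** As vv' is an orthogonal projection, I - gram(v'u) is the Gram matrix of u - vv'u; the diagonal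
    of gram(v'u) is therefore at most 1, and it dominates the ratios. *)
Lemma mratio_frames_le1 p k (u v : 'M[R]_(p, k)) (j : 'I_k) :
  gram u = 1%:M -> gram v = 1%:M -> mratio (gram (v^T *m u)) j <= 1.
Proof.
move=> u1 v1; have /andP[_] := mratio_gram_diag (v^T *m u) j (leqnn k).
move=> /le_trans; apply.
have : 0 <= gram (u - v *m (v^T *m u)) j j.
  by rewrite gram_diagE; apply: sumr_ge0 => i _; exact: sqr_ge0.
suff -> : gram (u - v *m (v^T *m u)) = 1%:M - gram (v^T *m u).
  by rewrite !mxE eqxx subr_ge0.
rewrite /gram [(_ - _)^T]linearB/= mulmxBl !mulmxBr -/(gram u) u1 !trmx_mul trmxK.
rewrite !mulmxA -[u^T *m v *m v^T *m v]mulmxA -[v^T *m v]/(gram v) v1 mulmx1.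
by rewrite subrr subr0.
Qed.

(** The block matrix factors as diag(1, N) times an upper triangular matrix with diagonal (a, 1,
    ..., 1). The row y drops out, which lets the Gaussian integral be peeled off one column at a
    time. *)
Lemma pkernel_block p k s (a : R) y (N : 'M[R]_(p, k)) :
  pkernel s (gram (block_mx a%:M y 0 N : 'M[R]_(1 + p, 1 + k))) =
  ppow (a ^+ 2) (s 0) * pkernel (fun j => s (lift 0 j)) (gram N).
Proof.
pose D : 'M[R]_(1 + p, 1 + k) := block_mx 1%:M 0 0 N.
pose t : 'M[R]_(1 + k) := block_mx a%:M y 0 1%:M.
have -> : block_mx a%:M y 0 N = D *m t.
  by rewrite mulmx_block !mul1mx !mul0mx !mulmx0 !mulmx1 !addr0 !add0r.
have ut : upper t.
  move=> i j; case: (split_ordP i) => i' ->; case: (split_ordP j) => j' ->.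
  - by rewrite !ord1.
  - by rewrite /= ord1.
  - by rewrite block_mxEdl mxE.
  - by rewrite block_mxEdr /= ltn_add2l mxE -val_eqE /= => /gtn_eqF ->.
rewrite gram_mul pkernel_congr_upper// mulrC big_ord_recl big1 ?mulr1; last first.
  move=> i _; rewrite (_ : lift _ _ = rshift 1 i) ?block_mxEdr ?mxE ?eqxx ?expr1n ?ppow1//.
  exact: val_inj.
have -> : t ord0 ord0 = a.
  have -> : ord0 = lshift k (0 : 'I_1) :> 'I_(1 + k) by exact: val_inj.
  by rewrite block_mxEul mxE eqxx mulr1n.
congr (_ * _).
have gD : gram D = block_mx 1%:M 0 0 (gram N).
  rewrite /gram tr_block_mx mulmx_block !trmx1 !trmx0.
  by rewrite !mul0mx !mulmx0 !mul1mx !addr0 !add0r.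
have lD j (h : (j.+1 <= 1 + k)%N) (h' : (j <= k)%N) :
    lminor (gram D) h = lminor (gram N) h'.
  rewrite gD /lminor.
  transitivity (\det (block_mx (1%:M : 'M[R]_1) 0 0
      (\matrix_(a < j, b < j) gram N (widen_ord h' a) (widen_ord h' b))));
    last by rewrite det_ublock det1 mul1r.
  congr (\det _); apply/matrixP => i l; rewrite mxE.
  case: (@split_ordP 1 j i) => i' ->; case: (@split_ordP 1 j l) => l' ->.
  - have -> : widen_ord h (lshift j i') = lshift k i' by exact: val_inj.
    have -> : widen_ord h (lshift j l') = lshift k l' by exact: val_inj.
    by rewrite [LHS]block_mxEul [RHS]block_mxEul.
  - have -> : widen_ord h (lshift j i') = lshift k i' by exact: val_inj.
    have -> : widen_ord h (rshift 1 l') = rshift 1 (widen_ord h' l') by exact: val_inj.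
    by rewrite [LHS]block_mxEur [RHS]block_mxEur !mxE.
  - have -> : widen_ord h (rshift 1 i') = rshift 1 (widen_ord h' i') by exact: val_inj.
    have -> : widen_ord h (lshift j l') = lshift k l' by exact: val_inj.
    by rewrite [LHS]block_mxEdl [RHS]block_mxEdl !mxE.
  - have -> : widen_ord h (rshift 1 i') = rshift 1 (widen_ord h' i') by exact: val_inj.
    have -> : widen_ord h (rshift 1 l') = rshift 1 (widen_ord h' l') by exact: val_inj.
    by rewrite [LHS]block_mxEdr [RHS]block_mxEdr mxE.
have l0 r (h : (0 <= r)%N) (X : 'M[R]_r) : lminor X h = 1 by rewrite /lminor det_mx00.
rewrite /pkernel big_ord_recl.
have -> : mratio (gram D) ord0 = 1.
  by rewrite /mratio l0 (lD _ _ (leq0n k)) l0 divr1.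
rewrite ppow1 mul1r; apply: eq_bigr => j _; congr (ppow _ _).
by rewrite /mratio (lD _ _ (ltn_ord j)) (lD _ _ (ltnW (ltn_ord j))).
Qed.

End qr.

(** * Gaussian matrices *)

Section gaussian1.
Context {R : realType}.
Local Notation leb := (@lebesgue_measure R).
Local Notation N01 := (@normal_prob R 0 1).

Lemma lebesgue_measure_shift (y : R) A : measurable A ->
  leb A = leb ((fun x => x + y) @^-1` A).
Proof.
pose t (x : measurableTypeR R) : measurableTypeR R := x + y.
have my : measurable_fun setT t by exact: measurable_funD.
pose nu : {measure set (measurableTypeR R) -> \bar R} :=
  measure_function_pushforward__canonical__measure_function_Measure leb my.
apply: (@lebesgue_measure_unique R nu) => _ [[a b] _ <-]; rewrite /nu/=.
rewrite /pushforward [X in _ = leb X](_ : _ = `]a - y, b - y]%classic); last first.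
  by apply/seteqP; split => x /=; rewrite !in_itv/= /t ltrBlDr lerBrDr.
rewrite !lebesgue_measure_itv/= !lte_fin ltrD2r; case: ifP => // _.
by rewrite -!EFinB; congr EFin; lra.
Qed.

Lemma ge0_integral_shift (y : R) (f : R -> \bar R) :
  measurable_fun setT f -> (forall x, 0 <= f x)%E ->
  (\int[leb]_x f ((x : R) + y)%R = \int[leb]_x f x)%E.
Proof.
move=> mf f0.
pose t (x : measurableTypeR R) : measurableTypeR R := x + y.
have my : measurable_fun setT t by exact: measurable_funD.
pose nu : {measure set (measurableTypeR R) -> \bar R} :=
  measure_function_pushforward__canonical__measure_function_Measure leb my.
transitivity (\int[nu]_x f x)%E; first by rewrite ge0_integral_pushforward.
by apply: eq_measure_integral => A mA _; rewrite [RHS](lebesgue_measure_shift y).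
Qed.

Lemma ge0_integral_normal (f : R -> \bar R) :
  measurable_fun setT f -> (forall x, 0 <= f x)%E ->
  (\int[N01]_x f x = \int[leb]_x (f x * (normal_pdf 0 1 x)%:E))%E.
Proof.
move=> mf f0.
pose P : {finite_measure set _ -> \bar R} := N01.
have Pleb : P `<< leb by exact: normal_prob_dominates.
rewrite -(Radon_Nikodym_SigmaFinite.change_of_variables Pleb)//.
have mpdf : measurable_fun setT (EFin \o @normal_pdf R 0 1).
  by apply/measurable_EFinP; exact: measurable_normal_pdf.
have := Radon_Nikodym_SigmaFinite.f_integrable Pleb.
set g := Radon_Nikodym_SigmaFinite.f _ _ => ig.
have mg := measurable_int _ ig.
apply: ae_eq_integral => //.
- exact: emeasurable_funM.
- exact: emeasurable_funM.
(* The Radon-Nikodym derivative and the explicit density have the same integral over every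
   measurable set. *)
have gpdf : ae_eq leb setT g (EFin \o @normal_pdf R 0 1).
  apply: integral_ae_eq => // E _ mE.
  by rewrite -Radon_Nikodym_SigmaFinite.f_integral.
by apply: filterS gpdf => x /= /[apply] ->.
Qed.

(** Translation invariance of Lebesgue measure moves the shift onto the density, and completing the
    square gives the exponential factor. This is the one-dimensional Cameron-Martin formula. *)
Lemma normal_shift (y : R) (f : R -> \bar R) :
  measurable_fun setT f -> (forall x, 0 <= f x)%E ->
  (\int[N01]_x f ((x : R) + y)%R =
   \int[N01]_x (f x * (expR ((x : R) * y - y * y / 2))%:E))%E.
Proof.
move=> mf f0.
have my : measurable_fun setT (fun x : R => x + y) by exact: measurable_funD.
rewrite !ge0_integral_normal//; last 3 first.
- apply: emeasurable_funM => //; apply/measurable_EFinP.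
  by apply: measurableT_comp => //; apply: measurable_funB => //; exact: measurable_funM.
- by move=> x; rewrite mule_ge0// lee_fin expR_ge0.
- exact: measurableT_comp.
rewrite -[RHS](ge0_integral_shift y); last 2 first.
- apply: emeasurable_funM; last by apply/measurable_EFinP; exact: measurable_normal_pdf.
  apply: emeasurable_funM => //; apply/measurable_EFinP.
  by apply: measurableT_comp => //; apply: measurable_funB => //; exact: measurable_funM.
- by move=> x; rewrite !mule_ge0// lee_fin ?expR_ge0 ?normal_pdf_ge0.
apply: eq_integral => x _; rewrite -muleA -EFinM; congr (_ * _%:E)%E.
rewrite normal_pdfE ?oner_eq0// mulrCA -expRD; congr (_ * expR _).
by rewrite !subr0 expr1n; field.
Qed.

End gaussian1.

(** * Measurability of matrix functions and the Frobenius inner product *)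

Section matrix_measurability.
Context {R : realType}.

Lemma measurable_entry n m (i : 'I_n) (j : 'I_m) :
  measurable_fun setT (fun M : MX R n m => M i j).
Proof.
move=> _ B mB; rewrite setTI; apply: sub_sigma_algebra.
by exists i, j, B.
Qed.

Lemma measurable_mx d (T : measurableType d) n m (f : T -> 'M[R]_(n, m)) :
  (forall i j, measurable_fun setT (fun x => f x i j)) ->
  measurable_fun setT (f : T -> MX R n m).
Proof.
move=> mf; apply: (@measurability _ _ T (MX R n m) setT f (@mx_entry_gen R n m)) => //.
move=> _ [_ [i [j [B [mB ->]]]] <-].
exact: mf.
Qed.

Lemma measurable_mulmx d (T : measurableType d) n m p
    (f : T -> 'M[R]_(n, m)) (g : T -> 'M[R]_(m, p)) :
  (forall i j, measurable_fun setT (fun x => f x i j)) ->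
  (forall i j, measurable_fun setT (fun x => g x i j)) ->
  forall i j, measurable_fun setT (fun x => (f x *m g x) i j).
Proof.
move=> mf mg i j; under eq_fun do rewrite mxE.
by apply: measurable_sum => k; exact: measurable_funM.
Qed.

Lemma measurable_det d (T : measurableType d) n (f : T -> 'M[R]_n) :
  (forall i j, measurable_fun setT (fun x => f x i j)) ->
  measurable_fun setT (fun x => \det (f x)).
Proof.
move=> mf; rewrite /determinant; apply: measurable_sum => s.
by apply: measurable_funM => //; apply: measurable_prod => i _.
Qed.

Lemma measurable_ppow (s : R) : measurable_fun setT (ppow ^~ s).
Proof.
rewrite /ppow; apply: measurable_fun_ifT => //; exact: measurable_fun_ltr.
Qed.

Lemma measurable_inv : measurable_fun setT (fun x : R => x^-1).
Proof.
have -> : (fun x : R => x^-1) =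
    (fun x => if 0 < x then x `^ (-1) else - ((- x) `^ (-1))).
  apply/funext => x; case: ltgtP => [x0|x0|<-].
  - by rewrite powR_inv1 // ltW.
  - by rewrite powR_inv1 ?oppr_ge0 1?ltW// invrN opprK.
  - by rewrite invr0 oppr0 powR0 ?oppr0// oppr_eq0 oner_eq0.
apply: measurable_fun_ifT.
- exact: measurable_fun_ltr.
- exact: measurable_powR.
- apply: (measurableT_comp (@oppr_measurable R setT)).
  by apply: (measurableT_comp (@measurable_powR R (-1))).
Qed.

Lemma measurable_lminor d (T : measurableType d) k (f : T -> 'M[R]_k) j
    (hj : (j <= k)%N) :
  (forall i j, measurable_fun setT (fun x => f x i j)) ->
  measurable_fun setT (fun x => lminor (f x) hj).
Proof.
move=> mf; apply: measurable_det => a b.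
by under eq_fun do rewrite mxE; exact: mf.
Qed.

Definition dot n k (X Y : 'M[R]_(n, k)) := \sum_i \sum_j X i j * Y i j.

Lemma dotC n k (X Y : 'M[R]_(n, k)) : dot X Y = dot Y X.
Proof. by apply: eq_bigr => i _; apply: eq_bigr => j _; rewrite mulrC. Qed.

Lemma dotDl n k (X Y Z : 'M[R]_(n, k)) : dot (X + Y) Z = dot X Z + dot Y Z.
Proof.
rewrite -big_split; apply: eq_bigr => i _; rewrite -big_split.
by apply: eq_bigr => j _; rewrite mxE mulrDl.
Qed.

Lemma dotNl n k (X Z : 'M[R]_(n, k)) : dot (- X) Z = - dot X Z.
Proof.
rewrite -sumrN; apply: eq_bigr => i _; rewrite -sumrN.
by apply: eq_bigr => j _; rewrite mxE mulNr.
Qed.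

Lemma dotDr n k (X Y Z : 'M[R]_(n, k)) : dot X (Y + Z) = dot X Y + dot X Z.
Proof. by rewrite dotC dotDl !(dotC _ X). Qed.

Lemma dotNr n k (X Z : 'M[R]_(n, k)) : dot X (- Z) = - dot X Z.
Proof. by rewrite dotC dotNl dotC. Qed.

Lemma dotE n k (X Y : 'M[R]_(n, k)) : dot X Y = \tr (X^T *m Y).
Proof.
rewrite /dot exchange_big; apply: eq_bigr => j _; rewrite mxE.
by apply: eq_bigr => i _; rewrite mxE.
Qed.

Lemma dot_row n k l (X X' : 'M[R]_(n, k)) (Y Y' : 'M[R]_(n, l)) :
  dot (row_mx X Y) (row_mx X' Y') = dot X X' + dot Y Y'.
Proof.
rewrite -big_split; apply: eq_bigr => i _; rewrite big_split_ord.
by congr (_ + _); apply: eq_bigr => j _; rewrite ?row_mxEl ?row_mxEr.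
Qed.

Lemma dot_col n k l (X X' : 'M[R]_(n, k)) (Y Y' : 'M[R]_(l, k)) :
  dot (col_mx X Y) (col_mx X' Y') = dot X X' + dot Y Y'.
Proof.
rewrite {1}/dot big_split_ord; congr (_ + _); apply: eq_bigr => i _;
by apply: eq_bigr => j _; rewrite ?col_mxEu ?col_mxEd.
Qed.

Lemma measurable_dot d (T : measurableType d) n k (f g : T -> 'M[R]_(n, k)) :
  (forall i j, measurable_fun setT (fun x => f x i j)) ->
  (forall i j, measurable_fun setT (fun x => g x i j)) ->
  measurable_fun setT (fun x => dot (f x) (g x)).
Proof.
move=> mf mg; apply: measurable_sum => i; apply: measurable_sum => j.
exact: measurable_funM.
Qed.

End matrix_measurability.

Lemma integral_probability_cst d (T : measurableType d) (R : realType)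
  (P : probability T R) (c : \bar R) : (\int[P]_x cst c x)%E = c.
Proof.
have PT : P setT = 1%E := probability_setT P.
by rewrite integral_cst// [X in (_ * X)%E]PT mule1.
Qed.

(** * The Gaussian measure through its Cameron-Martin formula *)

Section gauss.
Context {R : realType}.

(* Cameron-Martin formula; it characterizes the standard Gaussian measure. *)
Definition gauss n k (P : probability (MX R n k) R) :=
  forall (Y : 'M[R]_(n, k)) (f : MX R n k -> \bar R),
  measurable_fun setT f -> (forall X, 0 <= f X)%E ->
  (\int[P]_X f ((X : 'M[R]_(n, k)) + Y)%R =
   \int[P]_X (f X * (expR (dot (X : 'M[R]_(n, k)) Y - dot Y Y / 2))%:E))%E.

Lemma measurable_shiftmx n k (Y : 'M[R]_(n, k)) :
  measurable_fun setT (fun X : MX R n k => ((X : 'M[R]_(n, k)) + Y : MX R n k)).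
Proof.
apply: measurable_mx => i j; under eq_fun do rewrite mxE.
by apply: measurable_funD => //; exact: measurable_entry.
Qed.

(** Both sides equal the double integral of g(y - x) exp(<y,x> - |x|^2/2), x under P and y under P'.
    The formula for P', with shift x, reduces the inner integral over y to that of g. The formula
    for P, with shift y, turns the integrand into g(-x) exp(-<y,x> - |x|^2/2), whose exponential
    factor has P'-mass 1. *)
Lemma gauss_opp n k (P P' : probability (MX R n k) R) (g : MX R n k -> \bar R) :
  gauss P -> gauss P' -> measurable_fun setT g -> (forall X, 0 <= g X)%E ->
  (\int[P']_X g X = \int[P]_X g (- (X : 'M[R]_(n, k)))%R)%E.
Proof.
move=> gP gP' mg g0.
have mfst i j : measurable_fun setT (fun z : MX R n k * MX R n k => z.1 i j).
  by apply: (measurableT_comp (measurable_entry i j)); exact: measurable_fst.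
have msnd i j : measurable_fun setT (fun z : MX R n k * MX R n k => z.2 i j).
  by apply: (measurableT_comp (measurable_entry i j)); exact: measurable_snd.
have mid i j : measurable_fun setT (fun z : MX R n k => z i j) by exact: measurable_entry.
pose F (z : MX R n k * MX R n k) : \bar R :=
  (g ((z.2 : 'M[R]_(n, k)) - z.1)%R * (expR (dot z.2 z.1 - dot z.1 z.1 / 2))%:E)%E.
have mF : measurable_fun setT F.
  apply: emeasurable_funM.
    apply: (measurableT_comp mg); apply: measurable_mx => i j.
    by under eq_fun do rewrite !mxE; exact: measurable_funB.
  apply/measurable_EFinP/measurableT_comp => //.
  apply: measurable_funB; first exact: measurable_dot.
  by apply: measurable_funM => //; exact: measurable_dot.
have F0 z : (0 <= F z)%E by rewrite /F mule_ge0// lee_fin expR_ge0.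
transitivity (\int[P]_x \int[P']_y F (x, y))%E.
  rewrite [LHS](_ : _ = \int[P]_x cst (\int[P']_X g X) x)%E; last first.
    by rewrite integral_probability_cst.
  apply: eq_integral => x _.
  rewrite /F /=.
  pose f1 (y : MX R n k) := (g y * (expR (dot x y + dot x x / 2))%:E)%E.
  have mf1 : measurable_fun setT f1.
    apply: emeasurable_funM => //.
    apply/measurable_EFinP/measurableT_comp => //.
    by apply: measurable_funD => //; exact: measurable_dot.
  have f10 X : (0 <= f1 X)%E by rewrite mule_ge0// lee_fin expR_ge0.
  have H := gP' (- x)%R f1 mf1 f10; transitivity (\int[P']_y (g y * (expR (dot x y + dot x x / 2))%:E
      * (expR (dot (y : 'M[R]_(n, k)) (- x) - dot (- x) (- x) / 2))%:E))%E.
    apply: eq_integral => y _; rewrite -muleA -EFinM -expRD.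
    rewrite !dotNl !dotNr opprK (dotC y) [X in expR X](_ : _ = 0).
      by rewrite expR0 mule1.
    by field.
  rewrite -H; apply: eq_integral => y _; rewrite /f1; congr (_ * (expR _)%:E)%E.
  by rewrite !dotDr !dotNr (dotC x y); field.
rewrite (fubini_tonelli F)//.
transitivity (\int[P']_y \int[P]_x (g (- (x : 'M[R]_(n, k)))%R *
   (expR (dot y (- x) - dot (- x) (- x) / 2))%:E))%E.
  apply: eq_integral => y _.
  (* [f1] carries the inverse of the density of the shift by y, so that the formula for P reproduces
     [F]. *)
  pose f1 (x : MX R n k) := (F (x, y) * (expR (- (dot x y - dot y y / 2)))%:E)%E.
  have mf1 : measurable_fun setT f1.
    apply: emeasurable_funM => //.
      by apply: (measurableT_comp mF); exact: pair2_measurable.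
    apply/measurable_EFinP/measurableT_comp => //; apply: measurableT_comp => //.
    by apply: measurable_funB => //; exact: measurable_dot.
  have f10 X : (0 <= f1 X)%E by rewrite mule_ge0// lee_fin expR_ge0.
  have H := gP y f1 mf1 f10; transitivity (\int[P]_x (F (x, y) * (expR (- (dot x y - dot y y / 2)))%:E
      * (expR (dot (x : 'M[R]_(n, k)) y - dot y y / 2))%:E))%E.
    apply: eq_integral => x _; rewrite -muleA -EFinM -expRD.
    by rewrite addNr expR0 mule1.
  rewrite -H; apply: eq_integral => x _; rewrite /f1 /F /= -muleA -EFinM -expRD.
  congr (g _ * (expR _)%:E)%E; first by rewrite opprD addrCA subrr addr0.
  by rewrite !(dotDl, dotDr, dotNl, dotNr) (dotC y x); field.
pose G (z : MX R n k * MX R n k) : \bar R :=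
  (g (- (z.2 : 'M[R]_(n, k)))%R *
   (expR (dot z.1 (- z.2) - dot (- z.2) (- z.2) / 2))%:E)%E.
have mG : measurable_fun setT G.
  have mN i j : measurable_fun setT
      (fun z : MX R n k * MX R n k => (- (z.2 : 'M[R]_(n, k))) i j).
    by under eq_fun do rewrite !mxE; exact: (measurableT_comp (@oppr_measurable R setT)).
  apply: emeasurable_funM.
    by apply: (measurableT_comp mg); exact: measurable_mx.
  apply/measurable_EFinP/measurableT_comp => //.
  apply: measurable_funB; first exact: measurable_dot.
  by apply: measurable_funM => //; exact: measurable_dot.
have G0 z : (0 <= G z)%E by rewrite /G mule_ge0// lee_fin expR_ge0.
rewrite (fubini_tonelli G)//; apply: eq_integral => x _; rewrite /G /=.
have mE : measurable_fun setT (fun y : MX R n k =>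
    (expR (dot (y : 'M[R]_(n, k)) (- x) - dot (- x) (- x) / 2))%:E).
  apply/measurable_EFinP/measurableT_comp => //.
  by apply: measurable_funB => //; exact: measurable_dot.
rewrite ge0_integralZl//.
rewrite -[RHS]mule1; congr (_ * _)%E.
(* The formula applied to the constant 1 shows that the exponential factor has mass 1. *)
have := gP' (- x)%R (cst 1%E).
rewrite integral_probability_cst => -> //.
by apply: eq_integral => y _; rewrite mul1e.
Qed.

End gauss.

(** * Uniqueness, existence and images of Gaussian matrices *)

Section gauss_constructions.
Context {R : realType}.

(** [gauss_opp] is used twice: for the pair P, P', and for P with itself, where it says that P is
    symmetric and removes the sign. *)
Lemma gauss_unique n k (P P' : probability (MX R n k) R) (g : MX R n k -> \bar R) :
  gauss P -> gauss P' -> measurable_fun setT g -> (forall X, 0 <= g X)%E ->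
  (\int[P']_X g X = \int[P]_X g X)%E.
Proof.
by move=> gP gP' mg g0; rewrite (gauss_opp gP gP')// -(gauss_opp gP gP).
Qed.

Definition mfun_of d d' (T : measurableType d) (T' : measurableType d')
    (f : T -> T') (mf : measurable_fun setT f) : {mfun T >-> T'} :=
  HB.pack f (isMeasurableFun.Build _ _ _ _ f mf).

Lemma measurable_expdot n k (Y : 'M[R]_(n, k)) : measurable_fun setT
  (fun X : MX R n k => (expR (dot (X : 'M[R]_(n, k)) Y - dot Y Y / 2))%:E).
Proof.
apply/measurable_EFinP/measurableT_comp => //.
apply: measurable_funB => //; apply: measurable_dot => //.
exact: measurable_entry.
Qed.

Lemma measurable_lmul n q k (A : 'M[R]_(q, n)) :
  measurable_fun setT (fun X : MX R n k => (A *m X : MX R q k)).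
Proof.
apply: measurable_mx; apply: measurable_mulmx => // i j.
exact: measurable_entry.
Qed.

(** Shifting v'X by Y amounts to shifting X by vY, and <X, vY> = <v'X, Y> and |vY| = |Y| for a frame
    v. *)
Lemma gauss_frame n q k (v : 'M[R]_(n, q)) (P : probability (MX R n k) R) :
  v^T *m v = 1%:M -> gauss P ->
  gauss (distribution P (mfun_of (@measurable_lmul n q k v^T))).
Proof.
move=> v1 gP Y f mf f0.
have mfY : measurable_fun setT (fun X : MX R q k => f (X + Y)%R).
  exact: (measurableT_comp mf (measurable_shiftmx Y)).
have mfe : measurable_fun setT (fun X : MX R q k =>
    f X * (expR (dot (X : 'M[R]_(q, k)) Y - dot Y Y / 2))%:E)%E.
  by apply: emeasurable_funM => //; exact: measurable_expdot.
rewrite !ge0_integral_distribution//; last first.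
  by move=> X; rewrite mule_ge0// lee_fin expR_ge0.
have mfv := measurableT_comp mf (@measurable_lmul n q k v^T).
transitivity (\int[P]_X (f \o (fun X : MX R n k => (v^T *m X : MX R q k)))
    ((X : 'M[R]_(n, k)) + v *m Y)%R)%E.
  by apply: eq_integral => X _ /=; rewrite mulmxDr mulmxA v1 mul1mx.
rewrite (gP (v *m Y) _ mfv (fun X => f0 _)); apply: eq_integral => X _ /=.
congr (_ * (expR (_ - _ / 2))%:E)%E.
  by rewrite !dotE trmx_mul trmxK mulmxA.
by rewrite !dotE trmx_mul -mulmxA (mulmxA v^T) v1 mul1mx.
Qed.

Lemma measurable_row_mx n k l : measurable_fun setT
  (fun z : MX R n k * MX R n l => row_mx z.1 z.2 : MX R n (k + l)).
Proof.
apply: measurable_mx => i j; case: (split_ordP j) => j' ->.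
  under eq_fun do rewrite row_mxEl.
  by apply: (measurableT_comp (measurable_entry i j')); exact: measurable_fst.
under eq_fun do rewrite row_mxEr.
by apply: (measurableT_comp (measurable_entry i j')); exact: measurable_snd.
Qed.

Lemma measurable_col_mx n k l : measurable_fun setT
  (fun z : MX R k n * MX R l n => col_mx z.1 z.2 : MX R (k + l) n).
Proof.
apply: measurable_mx => i j; case: (split_ordP i) => i' ->.
  under eq_fun do rewrite col_mxEu.
  by apply: (measurableT_comp (measurable_entry i' j)); exact: measurable_fst.
under eq_fun do rewrite col_mxEd.
by apply: (measurableT_comp (measurable_entry i' j)); exact: measurable_snd.
Qed.

(** [c] stands for [row_mx] or [col_mx]: an additive bijection preserving inner products, so that
    the formula is applied in each factor in turn. *)
Lemma gauss_prod n1 k1 n2 k2 n k (P1 : probability (MX R n1 k1) R)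
    (P2 : probability (MX R n2 k2) R)
    (c : 'M[R]_(n1, k1) -> 'M[R]_(n2, k2) -> 'M[R]_(n, k))
    (mc : measurable_fun setT
      (fun z : MX R n1 k1 * MX R n2 k2 => c z.1 z.2 : MX R n k)) :
  (forall Y, exists Y1 Y2, Y = c Y1 Y2) ->
  (forall X1 X2 Y1 Y2, c X1 X2 + c Y1 Y2 = c (X1 + Y1) (X2 + Y2)) ->
  (forall X1 X2 Y1 Y2, dot (c X1 X2) (c Y1 Y2) = dot X1 Y1 + dot X2 Y2) ->
  gauss P1 -> gauss P2 -> gauss (distribution (P1 \x P2)%E (mfun_of mc)).
Proof.
move=> csurj cD cdot gP1 gP2 Y f mf f0.
have [Y1 [Y2 ->]] := csurj Y.
have mfY : measurable_fun setT (fun X : MX R n k => f (X + c Y1 Y2)%R).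
  exact: (measurableT_comp mf (measurable_shiftmx _)).
have mfe : measurable_fun setT (fun X : MX R n k => f X *
    (expR (dot (X : 'M[R]_(n, k)) (c Y1 Y2) - dot (c Y1 Y2) (c Y1 Y2) / 2))%:E)%E.
  by apply: emeasurable_funM => //; exact: measurable_expdot.
have fe0 X : (0 <= f X *
    (expR (dot (X : 'M[R]_(n, k)) (c Y1 Y2) - dot (c Y1 Y2) (c Y1 Y2) / 2))%:E)%E.
  by rewrite mule_ge0// lee_fin expR_ge0.
rewrite !ge0_integral_distribution//=.
pose F (z : MX R n1 k1 * MX R n2 k2) := f (c z.1 z.2).
have mF : measurable_fun setT F by exact: (measurableT_comp mf mc).
pose G (z : MX R n1 k1 * MX R n2 k2) := (F z *
   (expR (dot (z.2 : 'M[R]_(n2, k2)) Y2 - dot Y2 Y2 / 2))%:E)%E.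
have mG : measurable_fun setT G.
  apply: emeasurable_funM => //.
  by apply: (measurableT_comp (measurable_expdot Y2)); exact: measurable_snd.
have G0 z : (0 <= G z)%E.
  by apply: mule_ge0; [exact: f0|rewrite lee_fin expR_ge0].
rewrite fubini_tonelli1/fubini_F//=; last exact: (measurableT_comp mfY mc).
rewrite fubini_tonelli1/fubini_F//=; last exact: (measurableT_comp mfe mc).
transitivity (\int[P1]_x \int[P2]_y G ((x : 'M[R]_(n1, k1)) + Y1, y)%R)%E.
  apply: eq_integral => x _.
  under eq_integral do rewrite cD.
  rewrite (gP2 Y2 (fun y => F ((x : 'M[R]_(n1, k1)) + Y1, y)%R))//;
    last by move=> y; exact: f0.
  by apply: (measurableT_comp mF); exact: pair1_measurable.
pose H x := (\int[P2]_y G (x, y))%E.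
have mH : measurable_fun setT H by exact: (measurable_fun_fubini_tonelli_F G).
have H0 x : (0 <= H x)%E by apply: integral_ge0.
etransitivity; first exact: (gP1 Y1 H mH H0).
apply: eq_integral => x _.
have mGx : measurable_fun setT (fun y => G (x, y)).
  by apply: (measurableT_comp mG); exact: pair1_measurable.
rewrite -ge0_integralZr//.
apply: eq_integral => y _; rewrite /G /F/= -muleA -EFinM -expRD !cdot.
by congr (_ * (expR _)%:E)%E; field.
Qed.

Lemma measurable_scalar_mx :
  measurable_fun setT (fun x : measurableTypeR R => x%:M : MX R 1 1).
Proof.
apply: measurable_mx => i j; rewrite !ord1.
by under eq_fun do rewrite mxE eqxx mulr1n; exact: measurable_id.
Qed.

Lemma gauss_scalar : gauss (distribution
  (@normal_prob R 0 1 : probability (measurableTypeR R) R)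
  (mfun_of measurable_scalar_mx)).
Proof.
pose N01 : probability (measurableTypeR R) R := @normal_prob R 0 1.
have ms := measurable_scalar_mx.
move=> Y f mf f0.
have mfY : measurable_fun setT (fun X : MX R 1 1 => f (X + Y)%R).
  exact: (measurableT_comp mf (measurable_shiftmx _)).
have mfe : measurable_fun setT (fun X : MX R 1 1 => f X *
    (expR (dot (X : 'M[R]_1) Y - dot Y Y / 2))%:E)%E.
  by apply: emeasurable_funM => //; exact: measurable_expdot.
have fe0 X : (0 <= f X * (expR (dot (X : 'M[R]_1) Y - dot Y Y / 2))%:E)%E.
  by rewrite mule_ge0// lee_fin expR_ge0.
rewrite !ge0_integral_distribution//=.
have mfs := measurableT_comp mf ms.
transitivity (\int[N01]_x (f \o (fun x : R => x%:M : MX R 1 1))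
    ((x : R) + Y 0 0)%R)%E.
  apply: eq_integral => x _ /=; congr f.
  by rewrite [Y in LHS]mx11_scalar -raddfD.
rewrite (normal_shift _ mfs (fun x => f0 _)); apply: eq_integral => x _ /=.
by rewrite /dot !big_ord1 !mxE eqxx mulr1n.
Qed.

(** The law is built from independent standard normal entries, appended to form a row, the rows then
    being stacked. *)
Lemma gauss_exists n k : exists P : probability (MX R n k) R, gauss P.
Proof.
(* On a space of empty matrices the point mass is Gaussian: every shift is trivial and the
   exponential factor is 1. *)
have gauss0 n' k' : (forall X Y : 'M[R]_(n', k'), X = Y) ->
    gauss (\d_(0 : MX R n' k') : probability (MX R n' k') R).
  move=> all_eq Y f mf f0.
  have mfY := measurableT_comp mf (measurable_shiftmx Y).
  have mfe := emeasurable_funM mf (measurable_expdot Y).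
  rewrite (integral_dirac _ _ mfY)// (integral_dirac _ _ mfe)//=.
  have d0 : dot (0 : 'M[R]_(n', k')) 0 = 0.
    by rewrite /dot big1// => i _; rewrite big1// => j _; rewrite mxE mul0r.
  by rewrite !diracT !mul1e (all_eq Y 0) addr0 d0 mul0r subr0 expR0 mule1.
have gauss1 : exists P : probability (MX R 1 1) R, gauss P.
  by eexists; exact: gauss_scalar.
have gauss1k : exists P : probability (MX R 1 k) R, gauss P.
  elim: k => [|k [P gP]].
    by exists (\d_(0 : MX R 1 0)); apply: gauss0 => X Y; apply/matrixP => i [].
  have [P1 gP1] := gauss1.
  exists (distribution (P1 \x P)%E (mfun_of (@measurable_row_mx 1 1 k))).
  apply: gauss_prod => //.
  - by move=> Y; exists (@lsubmx _ 1 1 k Y), (@rsubmx _ 1 1 k Y); rewrite (@hsubmxK _ 1 1 k).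
  - by move=> *; exact: (@add_row_mx _ 1 1 k).
  - by move=> *; exact: (@dot_row _ 1 1 k).
elim: n => [|n [P gP]].
  by exists (\d_(0 : MX R 0 k)); apply: gauss0 => X Y; apply/matrixP => -[].
have [P1 gP1] := gauss1k.
exists (distribution (P1 \x P)%E (mfun_of (@measurable_col_mx k 1 n))).
apply: gauss_prod => //.
- by move=> Y; exists (@usubmx _ 1 n k Y), (@dsubmx _ 1 n k Y); rewrite (@vsubmxK _ 1 n k).
- by move=> *; exact: (@add_col_mx _ 1 n k).
- by move=> *; exact: (@dot_col _ 1 k n).
Qed.

Lemma gauss_row_integral n k l (P : probability (MX R n (k + l)) R)
    (P1 : probability (MX R n k) R) (P2 : probability (MX R n l) R)
    (f : MX R n (k + l) -> \bar R) :
  gauss P -> gauss P1 -> gauss P2 ->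
  measurable_fun setT f -> (forall X, 0 <= f X)%E ->
  (\int[P]_X f X = \int[P1]_x \int[P2]_y f (row_mx x y))%E.
Proof.
move=> gP gP1 gP2 mf f0.
have gP' : gauss (distribution (P1 \x P2)%E (mfun_of (@measurable_row_mx n k l))).
  apply: gauss_prod => //.
  - by move=> Y; exists (lsubmx Y), (rsubmx Y); rewrite hsubmxK.
  - by move=> *; rewrite add_row_mx.
  - by move=> *; rewrite dot_row.
have mfc := measurableT_comp mf (@measurable_row_mx n k l).
rewrite (gauss_unique gP' gP)// ge0_integral_distribution// fubini_tonelli1//.
by move=> z; exact: f0.
Qed.

Lemma gauss_col_integral n k l (P : probability (MX R (k + l) n) R)
    (P1 : probability (MX R k n) R) (P2 : probability (MX R l n) R)
    (f : MX R (k + l) n -> \bar R) :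
  gauss P -> gauss P1 -> gauss P2 ->
  measurable_fun setT f -> (forall X, 0 <= f X)%E ->
  (\int[P]_X f X = \int[P1]_x \int[P2]_y f (col_mx x y))%E.
Proof.
move=> gP gP1 gP2 mf f0.
have gP' : gauss (distribution (P1 \x P2)%E (mfun_of (@measurable_col_mx n k l))).
  apply: gauss_prod => //.
  - by move=> Y; exists (usubmx Y), (dsubmx Y); rewrite vsubmxK.
  - by move=> *; rewrite add_col_mx.
  - by move=> *; rewrite dot_col.
have mfc := measurableT_comp mf (@measurable_col_mx n k l).
rewrite (gauss_unique gP' gP)// ge0_integral_distribution// fubini_tonelli1//.
by move=> z; exact: f0.
Qed.

(** For square v this is rotation invariance; for an n x m frame it replaces v'G by a square
    Gaussian matrix. *)
Lemma gauss_frame_integral n q k (v : 'M[R]_(n, q)) (P : probability (MX R n k) R)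
    (P' : probability (MX R q k) R) (f : MX R q k -> \bar R) :
  v^T *m v = 1%:M -> gauss P -> gauss P' ->
  measurable_fun setT f -> (forall X, 0 <= f X)%E ->
  (\int[P]_X f (v^T *m (X : 'M[R]_(n, k)))%R = \int[P']_X f X)%E.
Proof.
move=> v1 gP gP' mf f0.
by rewrite (gauss_unique (gauss_frame v1 gP) gP')// ge0_integral_distribution.
Qed.

End gauss_constructions.

(** * Gaussian integral of the composite power *)

Section gauss_kernel.
Context {R : realType}.

Lemma measurable_mratio d (T : measurableType d) k (r : T -> 'M[R]_k) j :
  (forall a b, measurable_fun setT (fun x => r x a b)) ->
  measurable_fun setT (fun x => mratio (r x) j).
Proof.
move=> mr; apply: measurable_funM; first exact: measurable_lminor.
by apply: (measurableT_comp (@measurable_inv R)); exact: measurable_lminor.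
Qed.

Lemma measurable_pkernel d (T : measurableType d) k s (r : T -> 'M[R]_k) :
  (forall a b, measurable_fun setT (fun x => r x a b)) ->
  measurable_fun setT (fun x => pkernel s (r x)).
Proof.
move=> mr; apply: measurable_prod => j _.
by apply: (measurableT_comp (measurable_ppow _)); exact: measurable_mratio.
Qed.

Lemma measurable_gram d (T : measurableType d) p k (M : T -> 'M[R]_(p, k)) :
  (forall a b, measurable_fun setT (fun x => M x a b)) ->
  forall a b, measurable_fun setT (fun x => gram (M x) a b).
Proof.
move=> mM; apply: measurable_mulmx => // a b.
by under eq_fun do rewrite mxE; exact: mM.
Qed.

Lemma measurable_sqnorm d (T : measurableType d) p (g : T -> 'cV[R]_p) :
  (forall a b, measurable_fun setT (fun x => g x a b)) ->
  measurable_fun setT (fun x => sqnorm (g x)).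
Proof.
by move=> mg; apply: measurable_sum => i; exact: measurable_funX.
Qed.

Definition stdgauss n k : probability (MX R n k) R := sval (cid (gauss_exists n k)).

Lemma stdgaussP n k : gauss (stdgauss n k).
Proof. exact: (svalP (cid (gauss_exists n k))). Qed.
Arguments stdgaussP : clear implicits.

(** The moment E|g|^(2s) in R^a: the exponent is doubled because [sqnorm] is already a square. *)
Definition radial a s : \bar R := (\int[stdgauss a 1]_g (ppow (sqnorm g) s)%:E)%E.

Lemma radial_ge0 a s : (0 <= radial a s)%E.
Proof. by apply: integral_ge0 => g _; rewrite lee_fin ppow_ge0. Qed.

Lemma measurable_EFin_pkernel p k s : measurable_fun setT
  (fun M : MX R p k => (pkernel s (gram M))%:E).
Proof.
apply/measurable_EFinP; apply: measurable_pkernel; apply: measurable_gram.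
exact: measurable_entry.
Qed.

(** A reflection takes g to the first axis without changing the law of M. Then [pkernel_block]
    applies, and the first row of M, absent from the result, integrates to 1. *)
Lemma pkernel_col p k s (g : 'cV[R]_(1 + p)) :
  (\int[stdgauss (1 + p) k]_M
     (pkernel s (gram (row_mx g (M : 'M[R]_(1 + p, k)))))%:E =
   (ppow (sqnorm g) (s 0))%:E *
   \int[stdgauss p k]_N (pkernel (fun j => s (lift 0 j)) (gram N))%:E)%E.
Proof.
have [Q [QQ Qg]] := householder g.
have QQ' : Q^T^T *m Q^T = 1%:M by rewrite trmxK; exact: mulmx1C.
pose h := col_mx (Num.sqrt (sqnorm g))%:M (0 : 'M[R]_(p, 1)).
pose F (M : MX R (1 + p) k) := (pkernel s (gram (row_mx h (M : 'M[R]_(1 + p, k)))))%:E.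
have mF : measurable_fun setT F.
  apply: (measurableT_comp (measurable_EFin_pkernel s)).
  apply: measurable_mx => i j; case: (split_ordP j) => j' ->.
    by under eq_fun do rewrite row_mxEl; exact: measurable_cst.
  by under eq_fun do rewrite row_mxEr; exact: measurable_entry.
have F0 M : (0 <= F M)%E by rewrite lee_fin pkernel_ge0.
transitivity (\int[stdgauss (1 + p) k]_M F (Q^T^T *m (M : 'M[R]_(1 + p, k)))%R)%E.
  apply: eq_integral => M _; rewrite /F trmxK /h -Qg -mul_mx_row.
  by rewrite gram_orthogonal_mul.
rewrite (gauss_frame_integral QQ' (stdgaussP _ _) (stdgaussP _ _) mF F0).
rewrite (gauss_col_integral (stdgaussP _ _) (stdgaussP 1 k) (stdgaussP p k) mF F0).
rewrite -[RHS](integral_probability_cst (stdgauss 1 k)); apply: eq_integral => y _ /=.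
rewrite -ge0_integralZl//; last 2 first.
- by move=> N _; rewrite lee_fin pkernel_ge0.
- by rewrite lee_fin ppow_ge0.
- apply: eq_integral => N _; rewrite /F /h -block_mxEh pkernel_block -EFinM.
  by rewrite sqr_sqrtr// sqnorm_ge0.
exact: measurable_EFin_pkernel.
Qed.

(** Each column that is split off takes one row with it, whence the dimension p - j in the j-th
    moment. *)
Lemma gauss_pkernel p k s : (k <= p)%N ->
  (\int[stdgauss p k]_M (pkernel s (gram (M : 'M[R]_(p, k))))%:E =
   \prod_(j < k) radial (p - j) (s j))%E.
Proof.
elim: k p s => [|k IH] p s kp.
  rewrite big_ord0 -[RHS](integral_probability_cst (stdgauss p 0)).
  by apply: eq_integral => M _ /=; rewrite /pkernel big_ord0.
case: p kp => // p kp; rewrite big_ord_recl.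
have mF := @measurable_EFin_pkernel (1 + p) (1 + k) s.
have F0 (M : MX R (1 + p) (1 + k)) : (0 <= (pkernel s (gram (M : 'M[R]_(1 + p, 1 + k))))%:E)%E.
  by rewrite lee_fin pkernel_ge0.
rewrite (gauss_row_integral (stdgaussP (1 + p) (1 + k)) (stdgaussP (1 + p) 1)
  (stdgaussP (1 + p) k) mF F0).
under eq_integral do rewrite pkernel_col.
rewrite ge0_integralZr//; last 3 first.
- apply/measurable_EFinP/(measurableT_comp (measurable_ppow _)).
  by apply: measurable_sqnorm; exact: measurable_entry.
- by move=> g _; rewrite lee_fin ppow_ge0.
- by apply: integral_ge0 => N _; rewrite lee_fin pkernel_ge0.
by rewrite IH// subn0.
Qed.

End gauss_kernel.
Arguments stdgaussP {R} n k.

(** * Moments of the Gaussian radius *)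

Section radial_one.
Import numFieldNormedType.Exports.
Context {R : realType}.
Local Notation leb := (@lebesgue_measure R).
Local Notation pdf := (@normal_pdf R 0 1).

Lemma integral_pos_antiderivative (f F : R -> R) (a b : R) : 0 < a -> a < b ->
  (forall x : R, 0 < x -> is_derive x 1 F (f x)) ->
  (forall x : R, 0 < x -> {for x, continuous f}) ->
  (\int[leb]_(x in `[a, b]) (f x)%:E = (F b)%:E - (F a)%:E)%E.
Proof.
move=> a0 ab dF cf.
have Fc x : 0 < x -> {for x, continuous F}.
  move=> x0; apply/differentiable_continuous/derivable1_diffP.
  by apply: ex_derive; exact: dF.
have b0 : 0 < b by exact: lt_trans ab.
apply: continuous_FTC2 => //.
- apply/continuous_in_subspaceT => x; rewrite inE/= in_itv/= => /andP[ax _].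
  by apply: cf; exact: lt_le_trans ax.
- split.
  + move=> x; rewrite in_itv/= => /andP[ax _].
    by apply: ex_derive; apply: dF; exact: lt_trans ax.
  + by apply: cvg_at_right_filter; exact: Fc.
  + by apply: cvg_at_left_filter; exact: Fc.
- move=> x; rewrite in_itv/= => /andP[ax _].
  by rewrite derive1E; apply: derive_val; apply: dF; exact: lt_trans ax.
Qed.

Lemma integral_stdgauss1 (f : MX R 1 1 -> \bar R) :
  measurable_fun setT f -> (forall X, 0 <= f X)%E ->
  (\int[stdgauss 1 1]_X f X = \int[leb]_x (f ((x : R)%:M : 'M[R]_1) * (pdf x)%:E))%E.
Proof.
move=> mf f0; rewrite (gauss_unique gauss_scalar (stdgaussP 1 1))//.
rewrite ge0_integral_distribution//.
have mfs := measurableT_comp mf (@measurable_scalar_mx R).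
by rewrite (ge0_integral_normal mfs (fun x => f0 _)).
Qed.

Lemma normal_pdf_le_peak x : pdf x <= normal_peak 1.
Proof. by apply: normal_pdf_ub; rewrite oner_eq0. Qed.

Lemma normal_pdf1_gt0 : 0 < pdf 1.
Proof.
rewrite normal_pdfE ?oner_eq0// mulr_gt0 ?expR_gt0//.
by apply: normal_peak_gt0; rewrite oner_eq0.
Qed.

Lemma normal_pdf_ge1 x : `|x| <= 1 -> pdf 1 <= pdf x.
Proof.
move=> x1; rewrite !normal_pdfE ?oner_eq0// ler_wpM2l ?normal_peak_ge0//.
rewrite /normal_fun !subr0 !expr1n ler_expR ler_wpM2r ?invr_ge0// lerN2.
by rewrite -real_normK ?num_real// expr_le1.
Qed.

(** The singular part of |x|^(-q) on the positive side; the negative side follows from the symmetry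
    of the Gaussian law. *)
Definition pospow (q x : R) : R := if (0 < x) && (x <= 1) then x `^ (- q) else 0.

Lemma pospow_ge0 q x : 0 <= pospow q x.
Proof. by rewrite /pospow; case: ifP => // _; exact: powR_ge0. Qed.

Lemma measurable_pospow q : measurable_fun setT (pospow q).
Proof.
apply: measurable_fun_ifT.
- by apply: measurable_and; [exact: measurable_fun_ltr|exact: measurable_fun_ler].
- exact: measurable_powR.
- exact: measurable_cst.
Qed.

(** Monotone convergence over [1/(n+2), 1], where the antiderivative x^(1-q)/(1-q) bounds every
    integral by 1/(1-q). *)
Lemma integral_pospow_lty (q : R) : 0 < q -> q < 1 ->
  (\int[leb]_x (pospow q x)%:E < +oo)%E.
Proof.
move=> q0 q1.
(* The index n+2 keeps the left endpoint strictly below 1. *)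
pose A n : set R := `[n.+2%:R^-1, 1]%classic.
pose f n (x : R) := (if x \in A n then x `^ (- q) else 0)%:E : \bar R.
have Ax n x : (x \in A n) = (n.+2%:R^-1 <= x <= 1).
  by apply/idP/idP; rewrite inE /A/= in_itv.
have fE n x : f n x = (((fun x => (x `^ (- q))%:E) \_ (A n)) x)%E.
  by rewrite /f patchE; case: ifP.
have fint n : (\int[leb]_x f n x <= ((1 - q)^-1)%:E)%E.
  under eq_integral do rewrite fE.
  rewrite -integral_mkcond.
  have dF (x : R) : 0 < x ->
      is_derive x 1 (fun x => (1 - q)^-1 * x `^ (1 - q)) (x `^ (- q)).
    move=> x0; have := is_derive1_powR (1 - q) x0 => dp.
    apply: is_derive_eq.
    rewrite /GRing.scale/= mulrA mulVf ?mul1r; last by rewrite subr_eq0 gt_eqF.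
    by rewrite addrAC subrr add0r.
  have cf (x : R) : 0 < x -> {for x, continuous (fun x : R => x `^ (- q))}.
    move=> x0; apply/differentiable_continuous/derivable1_diffP.
    by apply: derivable_powR; rewrite in_itv/= x0.
  have n0 : 0 < n.+2%:R^-1 :> R by rewrite invr_gt0.
  have n1 : n.+2%:R^-1 < 1 :> R by rewrite invf_lt1// ltr1n.
  rewrite (integral_pos_antiderivative n0 n1 dF cf).
  rewrite powR1 mulr1 -EFinB lee_fin lerBlDr lerDl mulr_ge0// ?powR_ge0//.
  by rewrite invr_ge0 subr_ge0 ltW.
have nd : {homo (fun n => A n) : m n / (m <= n)%N >-> m `<=` n}.
  move=> m n mn x; rewrite /A/= !in_itv/= => /andP[mx ->]; rewrite andbT.
  by apply: le_trans mx; rewrite lef_pV2 ?posrE// ler_nat.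
apply: (@le_lt_trans _ _ ((1 - q)^-1)%:E); last by rewrite ltry.
have lim x : (f n x @[n --> \oo] --> (pospow q x)%:E)%E.
  rewrite /pospow; case: ifPn => [/andP[x0 x1]|nx].
    apply: cvg_near_cst; near=> n; rewrite /f Ax x1 andbT ifT//.
    near: n; exists (Num.truncn x^-1) => // n /= xn.
    rewrite -[leRHS]invrK lef_pV2 ?posrE ?invr_gt0//.
    rewrite (le_trans (ltW (truncnS_gt _)))// ler_nat.
    by rewrite ltnS (leq_trans xn).
  apply: cvg_near_cst; near=> n; rewrite /f Ax ifF//; apply/negbTE.
  apply: contra nx => /andP[nx ->]; rewrite andbT.
  by rewrite (lt_le_trans _ nx)// invr_gt0.
have mf n : measurable_fun setT (f n).
  apply/measurable_EFinP; apply: measurable_fun_ifT.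
  - under eq_fun do rewrite Ax.
    by apply: measurable_and; exact: measurable_fun_ler.
  - exact: measurable_powR.
  - exact: measurable_cst.
have f0 n x : (0 <= f n x)%E.
  by rewrite /f lee_fin; case: ifP => // _; exact: powR_ge0.
have fnd x m n : (m <= n)%N -> (f m x <= f n x)%E.
  move=> mn; rewrite /f lee_fin.
  case: ifPn => xm; last by case: ifP => // _; exact: powR_ge0.
  by rewrite ifT//; move: xm; rewrite !inE; exact: nd.
have -> : (\int[leb]_x (pospow q x)%:E = limn (fun n => \int[leb]_x f n x))%E.
  rewrite -monotone_convergence//.
    by apply: eq_integral => x _; apply/esym/cvg_lim => //; exact: lim.
  by move=> x _ m n; exact: fnd.
apply: lime_le; last by near=> n; exact: fint.
apply: ereal_nondecreasing_is_cvgn => m n mn.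
apply: ge0_le_integral => //.
- exact: mf.
- exact: mf.
- by move=> x _; exact: fnd.
Unshelve. all: end_near. Qed.

Lemma radial1E s :
  (radial 1 s = \int[leb]_x ((ppow (x ^+ 2) s)%:E * (pdf x)%:E) :> \bar R)%E.
Proof.
rewrite /radial integral_stdgauss1.
- by apply: eq_integral => x _; rewrite /sqnorm big_ord1 mxE eqxx mulr1n.
- apply/measurable_EFinP/(measurableT_comp (measurable_ppow _)).
  by apply: measurable_sqnorm; exact: measurable_entry.
- by move=> X; rewrite lee_fin ppow_ge0.
Qed.

Lemma powR_le_neg (x y s : R) : 0 < x -> x <= y -> s <= 0 -> y `^ s <= x `^ s.
Proof.
move=> x0 xy s0; have y0 := lt_le_trans x0 xy.
rewrite -[s]opprK (powRN y) (powRN x) lef_pV2 ?posrE ?powR_gt0//.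
have s0' : 0 <= - s by rewrite oppr_ge0.
have xn : x \in Num.nneg by rewrite nnegrE ltW.
have yn : y \in Num.nneg by rewrite nnegrE ltW.
exact: (ge0_ler_powR s0' xn yn xy).
Qed.

Lemma sqr_powR (x s : R) : 0 <= x -> (x ^+ 2) `^ s = x `^ (2 * s).
Proof. by move=> x0; rewrite powRrM powR_mulrn. Qed.

(** The integrand is |x|^(-1) times the density. On [e, 1] the density is at least its value at 1,
    and the integral of 1/x is -ln e. *)
Lemma radial1_pinfty : radial 1 (- 2^-1) = +oo%E :> \bar R.
Proof.
apply/eqyP => A A0; rewrite radial1E.
(* This e makes -ln e times the density at 1 equal to the prescribed bound A. *)
pose e := expR (- (A / pdf 1)).
have e0 : 0 < e by exact: expR_gt0.
have e1 : e < 1 by rewrite expR_lt1 oppr_lt0 divr_gt0// normal_pdf1_gt0.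
have dF (x : R) : 0 < x -> is_derive x 1 (@ln R) x^-1 by exact: is_derive1_ln.
have cf (x : R) : 0 < x -> {for x, continuous (fun x : R => x^-1)}.
  by move=> x0; apply: inv_continuous; rewrite gt_eqF.
have mp : measurable_fun setT (fun x : R => (ppow (x ^+ 2) (- 2^-1))%:E).
  apply/measurable_EFinP; apply: (measurableT_comp (measurable_ppow _)).
  exact: measurable_funX.
have mpdf : measurable_fun setT (fun x : R => (pdf x)%:E).
  by apply/measurable_EFinP; exact: measurable_normal_pdf.
have -> : A = pdf 1 * (A / pdf 1) by rewrite mulrC divfK ?gt_eqF ?normal_pdf1_gt0.
apply: (@le_trans _ _ (\int[leb]_(x in `[e, 1%R]) ((pdf 1)%:E * (x^-1)%:E))%E).
  rewrite ge0_integralZl_EFin//.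
  - rewrite (integral_pos_antiderivative e0 e1 dF cf) ln1 sub0e -EFinN EFinM.
    by rewrite /e expRK opprK.
  - move=> x /=; rewrite in_itv/= lee_fin invr_ge0 => /andP[ex _].
    exact: le_trans (ltW e0) ex.
  - by apply/measurable_EFinP/measurable_funTS; exact: measurable_inv.
  - by rewrite ltW// normal_pdf1_gt0.
apply: (@le_trans _ _ (\int[leb]_(x in `[e, 1%R])
    ((ppow (x ^+ 2) (- 2^-1))%:E * (pdf x)%:E))%E).
  apply: ge0_le_integral => //.
  - move=> x /=; rewrite in_itv/= -EFinM lee_fin => /andP[ex _].
    by rewrite mulr_ge0 ?normal_pdf_ge0// invr_ge0 (le_trans (ltW e0)).
  - apply/measurable_funTS/emeasurable_funM => //.
    by apply/measurable_EFinP; exact: measurable_inv.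
  - by apply/measurable_funTS/emeasurable_funM.
  - move=> x /=; rewrite in_itv/= -!EFinM lee_fin => /andP[ex x1].
    have x0 : 0 < x by exact: lt_le_trans ex.
    rewrite mulrC; apply: ler_pM.
    + by rewrite invr_ge0 ltW.
    + exact: normal_pdf_ge0.
    + rewrite /ppow exprn_gt0// sqr_powR; last exact: ltW.
      by rewrite mulrN divff// powR_inv1 // ltW.
    + by rewrite normal_pdf_ge1// gtr0_norm.
apply: ge0_subset_integral => //; first exact: emeasurable_funM.
by move=> x _; rewrite -EFinM lee_fin mulr_ge0 ?ppow_ge0 ?normal_pdf_ge0.
Qed.

Lemma sqnorm_col a b (x : 'cV[R]_a) (y : 'cV[R]_b) :
  sqnorm (col_mx x y) = sqnorm x + sqnorm y.
Proof.
rewrite /sqnorm big_split_ord.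
by congr (_ + _); apply: eq_bigr => i _; rewrite ?col_mxEu ?col_mxEd.
Qed.

Lemma measurable_sqnorm_MX a : measurable_fun setT (fun g : MX R a 1 => sqnorm g).
Proof. by apply: measurable_sqnorm; exact: measurable_entry. Qed.

Lemma measurable_sqnorm2 a b (h : R -> R -> \bar R) :
  measurable_fun setT (fun z : R * R => h z.1 z.2) ->
  measurable_fun setT (fun z : MX R a 1 * MX R b 1 => h (sqnorm z.1) (sqnorm z.2)).
Proof.
move=> mh.
have mp : measurable_fun setT
    (fun z : MX R a 1 * MX R b 1 => (sqnorm z.1, sqnorm z.2) : R * R).
  apply: measurable_fun_pair.
    by apply: (measurableT_comp (@measurable_sqnorm_MX a)); exact: measurable_fst.
  by apply: (measurableT_comp (@measurable_sqnorm_MX b)); exact: measurable_snd.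
exact: (measurableT_comp mh mp).
Qed.

Lemma integral_sqnorm_col a b (h : R -> \bar R) : measurable_fun setT h ->
  (forall x, 0 <= h x)%E ->
  (\int[stdgauss (a + b) 1]_g h (sqnorm g) =
   \int[stdgauss a 1]_x \int[stdgauss b 1]_y h (sqnorm x + sqnorm y)%R)%E.
Proof.
move=> mh h0.
have mhs := measurableT_comp mh (@measurable_sqnorm_MX (a + b)).
rewrite (gauss_col_integral (stdgaussP (a + b) 1) (stdgaussP a 1) (stdgaussP b 1) mhs)//.
  by apply: eq_integral => x _; apply: eq_integral => y _ /=; rewrite sqnorm_col.
by move=> X; exact: h0.
Qed.

(** One extra coordinate x raises the order of the singularity in Y by 1/2, because x ranges over an
    interval of length sqrt Y on which x^2 + Y is comparable with Y. The term c on the right covers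
    large Y. *)
Lemma radial_pinfty_step (a : nat) (c Y : R) :
  c = 2 `^ (- ((1 + a)%:R / 2)) * pdf 1 -> 0 <= Y ->
  ((c * ppow Y (- (a%:R / 2)))%:E <=
   \int[stdgauss 1 1]_x (ppow (sqnorm x + Y) (- ((1 + a)%:R / 2)))%:E + c%:E)%E.
Proof.
move=> cE Y0; have c0 : 0 < c by rewrite cE mulr_gt0 ?powR_gt0 ?normal_pdf1_gt0.
set I := (\int[_]_x _)%E.
have I0 : (0 <= I)%E by apply: integral_ge0 => x _; rewrite lee_fin ppow_ge0.
have [Y1|Y1] := ltP 1 Y.
  rewrite -[leLHS]add0e; apply: leeD => //; rewrite lee_fin ger_pMr//.
  rewrite /ppow (lt_trans _ Y1)// -[leRHS](powRr0 Y); apply: ler_powR; first exact: ltW.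
  by rewrite oppr_le0 divr_ge0.
move: Y0; rewrite le_eqVlt => /predU1P[<-|Y0].
  by rewrite ppow_le0// mulr0 adde_ge0// lee_fin ltW.
rewrite -[leLHS]adde0; apply: leeD; last by rewrite lee_fin ltW.
have mh : measurable_fun setT (fun x : R => (ppow (x + Y) (- ((1 + a)%:R / 2)))%:E).
  apply/measurable_EFinP/(measurableT_comp (measurable_ppow _)).
  exact: measurable_funD.
rewrite /I integral_stdgauss1; last 2 first.
- exact: (measurableT_comp mh (@measurable_sqnorm_MX 1)).
- by move=> X; rewrite lee_fin ppow_ge0.
have mpdf : measurable_fun setT (fun x : R => (pdf x)%:E).
  by apply/measurable_EFinP; exact: measurable_normal_pdf.
have mhp : measurable_fun setT (fun x : R =>
    (ppow (x ^+ 2 + Y) (- ((1 + a)%:R / 2)))%:E * (pdf x)%:E)%E.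
  apply: emeasurable_funM => //.
  by apply: (measurableT_comp mh); exact: measurable_funX.
under eq_integral do rewrite /sqnorm big_ord1 mxE eqxx mulr1n.
(* On [0, r] one has x^2 + Y <= 2Y and, as r <= 1, a density at least [pdf 1]; this is the origin of
   [c]. *)
pose r := Num.sqrt Y.
have r0 : 0 < r by rewrite sqrtr_gt0.
have r1 : r <= 1 by rewrite -sqrtr1 ler_wsqrtr.
pose k := (2 * Y) `^ (- ((1 + a)%:R / 2)) * pdf 1.
apply: (@le_trans _ _ (\int[leb]_(x in `[0%R, r]) (cst k%:E x))%E).
  have lebr : leb `[0, r]%classic = r%:E.
    by rewrite lebesgue_measure_itv/= lte_fin r0 sube0.
  rewrite integral_cst// [X in (_ * X)%E]lebr -EFinM lee_fin.
  have YE : Y `^ (- ((1 + a)%:R / 2)) * r = Y `^ (- (a%:R / 2)).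
    rewrite /r -powR12_sqrt; last exact: ltW.
    rewrite -powRD; last by rewrite (gt_eqF Y0) implybT.
    by congr (_ `^ _); rewrite natrD; field.
  rewrite /ppow Y0 -YE cE /k powRM//; last exact: ltW.
  by rewrite le_eqVlt; apply/orP; left; apply/eqP; ring.
apply: (@le_trans _ _ (\int[leb]_(x in `[0%R, r])
    ((ppow (x ^+ 2 + Y) (- ((1 + a)%:R / 2)))%:E * (pdf x)%:E))%E).
  apply: ge0_le_integral => //.
  - by move=> x _; rewrite lee_fin mulr_ge0 ?powR_ge0// normal_pdf_ge0.
  - exact: measurable_funTS.
  - move=> x /=; rewrite in_itv/= => /andP[x0 xr].
    rewrite -EFinM lee_fin /k ler_pM ?powR_ge0 ?normal_pdf_ge0//.
      rewrite /ppow ltr_wpDl ?sqr_ge0//; apply: powR_le_neg => //.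
      + by rewrite ltr_wpDl ?sqr_ge0.
      + rewrite mulr_natl mulr2n lerD2r -[leRHS](sqr_sqrtr (ltW Y0)).
        by apply: lerXn2r; rewrite ?nnegrE// ltW.
    by rewrite normal_pdf_ge1// ger0_norm// (le_trans xr).
apply: ge0_subset_integral => //.
by move=> x _; rewrite -EFinM lee_fin mulr_ge0 ?ppow_ge0 ?normal_pdf_ge0.
Qed.

(** Induction on the dimension: integrating [radial_pinfty_step] over the other coordinates bounds
    an infinite quantity by the new moment plus a constant. Exponents below the critical one are
    later reduced to it by monotonicity of the kernel. *)
Lemma radial_pinfty a : (0 < a)%N -> radial a (- (a%:R / 2)) = +oo%E :> \bar R.
Proof.
case: a => // a _; elim: a => [|a IH]; first by rewrite mul1r radial1_pinfty.
change (radial (1 + a.+1) (- ((1 + a.+1)%:R / 2)) = +oo%E :> \bar R).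
pose b := a.+1; rewrite -/b in IH *.
have mh (t : R) : measurable_fun setT (fun x : R => (ppow x t)%:E).
  by apply/measurable_EFinP; exact: measurable_ppow.
rewrite /radial (@integral_sqnorm_col 1 b (fun x => (ppow x (- ((1 + b)%:R / 2)))%:E))//;
  last by move=> x; rewrite lee_fin ppow_ge0.
pose H (z : MX R 1 1 * MX R b 1) : \bar R :=
  (ppow (sqnorm z.1 + sqnorm z.2) (- ((1 + b)%:R / 2)))%:E.
have mH : measurable_fun setT H.
  apply: (@measurable_sqnorm2 1 b (fun x y => (ppow (x + y) _)%:E)).
  by apply: (measurableT_comp (mh _)); exact: measurable_funD.
have H0 z : (0 <= H z)%E by rewrite lee_fin ppow_ge0.
rewrite [LHS](fubini_tonelli H)//.
pose c := 2 `^ (- ((1 + b)%:R / 2)) * pdf 1 : R.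
have c0 : 0 < c by rewrite mulr_gt0 ?powR_gt0 ?normal_pdf1_gt0.
have : (\int[stdgauss b 1]_y (c%:E * (ppow (sqnorm y) (- (b%:R / 2)))%:E) <=
  \int[stdgauss b 1]_y (\int[stdgauss 1 1]_x H (x, y) + c%:E))%E.
  apply: ge0_le_integral => //.
  - by move=> y _; rewrite -EFinM lee_fin mulr_ge0 ?ppow_ge0 ?ltW.
  - apply: emeasurable_funM => //.
    exact: (measurableT_comp (mh _) (@measurable_sqnorm_MX b)).
  - apply: emeasurable_funD => //.
    exact: (measurable_fun_fubini_tonelli_G H).
  - by move=> y _; rewrite -EFinM; apply: radial_pinfty_step => //; exact: sqnorm_ge0.
rewrite ge0_integralZl_EFin//; last 3 first.
- by move=> y _; rewrite lee_fin ppow_ge0.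
- exact: (measurableT_comp (mh _) (@measurable_sqnorm_MX b)).
- exact: ltW.
rewrite -/(radial b (- (b%:R / 2))) IH gt0_muley ?lte_fin//.
pose I y := (\int[stdgauss 1 1]_x H (x, y))%E.
have mI : measurable_fun setT I by exact: (measurable_fun_fubini_tonelli_G H).
have I0 y : (0 <= I y)%E by apply: integral_ge0.
rewrite (@ge0_integralD _ _ _ (stdgauss b 1) setT _ I (cst c%:E))//; last first.
  by move=> y _; rewrite lee_fin ltW.
rewrite (integral_probability_cst (stdgauss b 1) c%:E) leye_eq.
by move=> /eqP; case: (\int[_]_y _)%E.
Qed.

End radial_one.

Lemma ge0_le_iterated_integral d1 d2 (T1 : measurableType d1)
    (T2 : measurableType d2) (R : realType) (m1 : {measure set T1 -> \bar R})
    (m2 : {sigma_finite_measure set T2 -> \bar R}) (h f : T1 * T2 -> \bar R) :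
  measurable_fun setT h -> measurable_fun setT f ->
  (forall z, 0 <= h z)%E -> (forall z, h z <= f z)%E ->
  (\int[m1]_x \int[m2]_y h (x, y) <= \int[m1]_x \int[m2]_y f (x, y))%E.
Proof.
move=> mh mf h0 hf; have f0 z : (0 <= f z)%E by exact: le_trans (hf z).
apply: ge0_le_integral => //.
- by move=> x _; apply: integral_ge0 => y _; exact: h0.
- exact: (measurable_fun_fubini_tonelli_F h).
- exact: (measurable_fun_fubini_tonelli_F f).
- move=> x _; apply: ge0_le_integral => //.
  + exact: measurable_fun_pair2.
  + exact: measurable_fun_pair2.
Qed.

(** * Finite moments for nonnegative exponents *)

Section radial_finite.
Context {R : realType}.
Local Notation leb := (@lebesgue_measure R).
Local Notation pdf := (@normal_pdf R 0 1).

Lemma measurable_EFin_ppow s : measurable_fun setT (fun x : R => (ppow x s)%:E).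
Proof. by apply/measurable_EFinP; exact: measurable_ppow. Qed.

Lemma measurable_radial a s :
  measurable_fun setT (fun g : MX R a 1 => (ppow (sqnorm g) s)%:E).
Proof.
exact: (measurableT_comp (measurable_EFin_ppow s) (@measurable_sqnorm_MX R a)).
Qed.

(** For p > 0, raising u <= p exp(u/p) to the power p gives the constant p^p. *)
Lemma powR_le_expR (p : R) : 0 <= p -> exists2 C : R, 0 <= C &
  forall u, 0 < u -> u `^ p <= C * expR u.
Proof.
rewrite le_eqVlt => /predU1P[<-|p0].
  exists 1 => // u u0; rewrite powRr0 mul1r.
  by rewrite -[leLHS]expR0 ler_expR ltW.
exists (p `^ p); first exact: powR_ge0.
move=> u u0; have pn0 := lt0r_neq0 p0.
have p0' := ltW p0.
have le1 : u <= p * expR (u / p).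
  rewrite -{1}(divfK pn0 u) mulrC; apply: ler_wpM2l => //.
  by apply: le_trans (expR_ge1Dx _); rewrite lerDr.
have un : u \in Num.nneg by rewrite nnegrE ltW.
have en : p * expR (u / p) \in Num.nneg by rewrite nnegrE mulr_ge0// expR_ge0.
have := ge0_ler_powR p0' un en le1.
by rewrite powRM ?expR_ge0// -expRM divfK.
Qed.

(** The power |x|^(2s) is dominated by a multiple of exp(x) + exp(-x), whose Gaussian integral comes
    from the Cameron-Martin formula with shifts 1 and -1 applied to the constant 1. *)
Lemma radial1_lty_ge0 s : 0 <= s -> (radial 1 s < +oo :> \bar R)%E.
Proof.
move=> s0.
have [C C0 HC] : exists2 C : R, 0 <= C & forall u, 0 < u -> u `^ (2 * s) <= C * expR u.
  by apply: powR_le_expR; rewrite mulr_ge0.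
pose e (y : R) (X : MX R 1 1) : \bar R :=
  (expR (dot (X : 'M[R]_1) y%:M - dot y%:M (y%:M : 'M[R]_1) / 2))%:E.
have me y : measurable_fun setT (e y) by exact: measurable_expdot.
have e0 y X : (0 <= e y X)%E by rewrite lee_fin expR_ge0.
have Ie y : (\int[stdgauss 1 1]_X e y X = 1)%E.
  have := stdgaussP 1 1 (y%:M : 'M[R]_1) (cst 1%E).
  rewrite integral_probability_cst => -> //.
  by apply: eq_integral => X _; rewrite mul1e.
have eE y X : y * y = 1 -> e y X = (expR (X 0 0 * y) * expR (- 2^-1))%:E.
  by move=> y1; rewrite /e /dot !big_ord1 !mxE eqxx !mulr1n y1 -expRD mul1r.
(* The division compensates the factor exp(-1/2) in the densities of the shifts by 1 and -1. *)
pose K := C / expR (- 2^-1).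
have K0 : 0 <= K by rewrite divr_ge0// expR_ge0.
apply: (@le_lt_trans _ _ (\int[stdgauss 1 1]_X (K%:E * (e 1%R X + e (- 1)%R X)))%E).
  apply: ge0_le_integral => //.
  - by move=> X _; rewrite lee_fin ppow_ge0.
  - exact: measurable_radial.
  - by apply: emeasurable_funM => //; exact: emeasurable_funD.
  - move=> X _; rewrite !eE ?mulrNN ?mulr1// -EFinD -EFinM lee_fin.
    have -> : sqnorm X = `|X 0 0| ^+ 2 by rewrite /sqnorm big_ord1 real_normK ?num_real.
    rewrite -mulrDl mulrCA /K divfK ?gt_eqF ?expR_gt0// [leRHS]mulrC.
    have [->|X0] := eqVneq (X 0 0) 0.
      by rewrite normr0 expr0n ppow_le0// mulr_ge0// addr_ge0// expR_ge0.
    have nX0 : 0 < `|X 0 0| by rewrite normr_gt0.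
    rewrite /ppow exprn_gt0// sqr_powR// (le_trans (HC _ nX0))// ler_wpM2l//.
    rewrite mulrN1; case: (ger0P (X 0 0)) => _.
      by rewrite lerDl expR_ge0.
    by rewrite lerDr expR_ge0.
rewrite ge0_integralZl_EFin//; last 2 first.
- by move=> X _; rewrite adde_ge0.
- exact: emeasurable_funD.
by rewrite ge0_integralD// !Ie -EFinD -EFinM ltry.
Qed.

Lemma ppowD_le (x y s : R) : 0 <= x -> 0 <= y -> 0 <= s ->
  ppow (x + y) s <= 2 `^ s * (ppow x s + ppow y s).
Proof.
wlog yx : x y / y <= x.
  move=> H x0 y0 s0; case: (leP y x) => [yx|/ltW xy]; first exact: H.
  by rewrite addrC (addrC (ppow x s)); exact: H.
move=> x0 y0 s0; rewrite {1}/ppow; case: ifPn => [xy|_]; last first.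
  by rewrite mulr_ge0 ?powR_ge0// addr_ge0 ?ppow_ge0.
have {}x0 : 0 < x.
  by rewrite lt_neqAle x0 andbT; apply: contraL xy => /eqP x00; rewrite -leNgt; lra.
rewrite mulrDr (le_trans _ (_ : 2 `^ s * ppow x s <= _))//; last first.
  by rewrite lerDl mulr_ge0 ?powR_ge0 ?ppow_ge0.
rewrite /ppow x0 -powRM//; last exact: ltW.
have h1 : x + y \in Num.nneg by rewrite nnegrE ltW.
have h2 : 2 * x \in Num.nneg by rewrite nnegrE mulr_ge0// ltW.
by apply: (ge0_ler_powR s0 h1 h2); lra.
Qed.

Lemma radial_lty_ge0 a s : 0 <= s -> (radial a s < +oo :> \bar R)%E.
Proof.
move=> s0; elim: a => [|a IH].
  apply: (@le_lt_trans _ _ (\int[stdgauss 0 1]_X (cst 0 X))%E).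
    apply: ge0_le_integral => //.
    - by move=> X _; rewrite lee_fin ppow_ge0.
    - exact: measurable_radial.
    - by move=> X _; rewrite lee_fin ppow_le0// /sqnorm big_ord0.
  by rewrite integral_probability_cst.
change (radial (1 + a) s < +oo :> \bar R)%E.
rewrite /radial (@integral_sqnorm_col _ 1 a (fun x => (ppow x s)%:E)); last 2 first.
- exact: measurable_EFin_ppow.
- by move=> x; rewrite lee_fin ppow_ge0.
pose f (z : MX R 1 1 * MX R a 1) : \bar R :=
  ((2 `^ s)%:E * ((ppow (sqnorm z.1) s)%:E + (ppow (sqnorm z.2) s)%:E))%E.
have mf : measurable_fun setT f.
  apply: emeasurable_funM => //; apply: emeasurable_funD.
    by apply: (measurableT_comp (@measurable_radial _ s)); exact: measurable_fst.
  by apply: (measurableT_comp (@measurable_radial _ s)); exact: measurable_snd.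
have f0 z : (0 <= f z)%E.
  by rewrite mule_ge0 ?adde_ge0 ?lee_fin ?powR_ge0 ?ppow_ge0.
pose h (z : MX R 1 1 * MX R a 1) : \bar R := (ppow (sqnorm z.1 + sqnorm z.2) s)%:E.
have mh : measurable_fun setT h.
  apply: (@measurable_sqnorm2 _ 1 a (fun x y => (ppow (x + y) _)%:E)).
  by apply: (measurableT_comp (measurable_EFin_ppow _)); exact: measurable_funD.
have h0 z : (0 <= h z)%E by rewrite lee_fin ppow_ge0.
have hf z : (h z <= f z)%E.
  by rewrite /h /f -EFinD -EFinM lee_fin ppowD_le// sqnorm_ge0.
apply: (@le_lt_trans _ _ (\int[stdgauss 1 1]_x \int[stdgauss a 1]_y f (x, y))%E).
  exact: (@ge0_le_iterated_integral _ _ _ _ _ (stdgauss 1 1) (stdgauss a 1) h f).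
have -> : (\int[stdgauss 1 1]_x \int[stdgauss a 1]_y f (x, y) =
    (2 `^ s)%:E * (radial 1 s + radial a s))%E.
  have p0 : 0 <= 2 `^ s :> R by exact: powR_ge0.
  have r0 b (g : MX R b 1) : (0 <= (ppow (sqnorm g) s)%:E)%E by rewrite lee_fin ppow_ge0.
  have mr b := @measurable_radial b s.
  have inner x : (\int[stdgauss a 1]_y f (x, y) =
      (2 `^ s)%:E * ((ppow (sqnorm x) s)%:E + radial a s))%E.
    pose g (y : MX R a 1) : \bar R := ((ppow (sqnorm x) s)%:E + (ppow (sqnorm y) s)%:E)%E.
    have mg : measurable_fun setT g by apply: emeasurable_funD.
    have g0 y : (0 <= g y)%E by apply: adde_ge0.
    transitivity (\int[stdgauss a 1]_y ((2 `^ s)%:E * g y))%E => //.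
    rewrite ge0_integralZl_EFin// /g ge0_integralD//.
    by rewrite (integral_probability_cst (stdgauss a 1) (ppow (sqnorm x) s)%:E).
  under eq_integral do rewrite inner.
  pose g (x : MX R 1 1) : \bar R := ((ppow (sqnorm x) s)%:E + radial a s)%E.
  have ra0 := radial_ge0 a s.
  have mg : measurable_fun setT g by apply: emeasurable_funD.
  have g0 y : (0 <= g y)%E by apply: adde_ge0.
  transitivity (\int[stdgauss 1 1]_y ((2 `^ s)%:E * g y))%E => //.
  rewrite ge0_integralZl_EFin// /g ge0_integralD//.
  by rewrite (integral_probability_cst (stdgauss 1 1) (radial a s)).
rewrite lte_mul_pinfty ?lee_fin ?powR_ge0//.
by rewrite lte_add_pinfty// radial1_lty_ge0.
Qed.

End radial_finite.

Lemma ae_witness d (T : measurableType d) (R : realType)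
    (mu : {measure set T -> \bar R}) (P : T -> Prop) :
  (0 < mu setT)%E -> (\forall x \ae mu, P x) -> exists x, P x.
Proof.
move=> mu0 aeP; apply: contrapT => /forallNP nP.
suff /(measure_negligible measurableT) m0 : mu.-negligible setT.
  by rewrite m0 ltxx in mu0.
by apply: negligibleS aeP => x _; exact: nP.
Qed.

(** * Finite moments for negative exponents, and positivity *)

Section radial_negative.
Context {R : realType}.
Local Notation leb := (@lebesgue_measure R).
Local Notation pdf := (@normal_pdf R 0 1).

(* The value +oo at 0 makes the estimate epowD_le below valid everywhere. *)
Definition epow (x s : R) : \bar R := if 0 < x then (x `^ s)%:E else +oo%E.

Lemma epow_gt0 x s : (0 < epow x s)%E.
Proof. by rewrite /epow; case: ifP => // x0; rewrite lte_fin powR_gt0. Qed.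

Lemma epow_ge0 x s : (0 <= epow x s)%E.
Proof. exact/ltW/epow_gt0. Qed.

Lemma measurable_epow s : measurable_fun setT (epow ^~ s).
Proof.
rewrite /epow; apply: measurable_fun_ifT.
- exact: measurable_fun_ltr.
- by apply/measurable_EFinP; exact: measurable_powR.
- exact: measurable_cst.
Qed.

(** With nonpositive exponents, x + y may be replaced by x in the first factor and by y in the
    second; the moments then split over coordinates. *)
Lemma epowD_le x y s t : 0 <= x -> 0 <= y -> s <= 0 -> t <= 0 ->
  (epow (x + y) (s + t) <= epow x s * epow y t)%E.
Proof.
move=> x0 y0 s0 t0.
have [->|xn] := eqVneq x 0.
  by rewrite {2}/epow ltxx gt0_mulye ?epow_gt0// leey.
have [->|yn] := eqVneq y 0.
  by rewrite {3}/epow ltxx gt0_muley ?epow_gt0// leey.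
have x1 : 0 < x by rewrite lt_neqAle eq_sym xn.
have y1 : 0 < y by rewrite lt_neqAle eq_sym yn.
rewrite /epow x1 y1 addr_gt0// -EFinM lee_fin.
rewrite powRD; last by rewrite (gt_eqF (addr_gt0 x1 y1)) implybT.
by apply: ler_pM; rewrite ?powR_ge0//; apply: powR_le_neg => //; rewrite ?lerDl ?lerDr.
Qed.

Definition eradial a s : \bar R := (\int[stdgauss a 1]_g epow (sqnorm g) s)%E.

Lemma measurable_eradial a s :
  measurable_fun setT (fun g : MX R a 1 => epow (sqnorm g) s).
Proof. exact: (measurableT_comp (measurable_epow s) (@measurable_sqnorm_MX R a)). Qed.

Lemma radial_le_eradial a s : (radial a s <= eradial a s)%E.
Proof.
apply: ge0_le_integral => //.
- by move=> X _; rewrite lee_fin ppow_ge0.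
- exact: measurable_radial.
- exact: measurable_eradial.
- by move=> X _; rewrite /ppow /epow; case: ifP => // _; rewrite leey.
Qed.

Lemma eradial_step a s t : s <= 0 -> t <= 0 ->
  (eradial (1 + a) (s + t) <= eradial 1 s * eradial a t)%E.
Proof.
move=> s0 t0.
rewrite /eradial (@integral_sqnorm_col _ 1 a (epow ^~ (s + t)));
  [|exact: measurable_epow|by move=> x; exact: epow_ge0].
pose h (z : MX R 1 1 * MX R a 1) := epow (sqnorm z.1 + sqnorm z.2) (s + t).
pose f (z : MX R 1 1 * MX R a 1) := (epow (sqnorm z.1) s * epow (sqnorm z.2) t)%E.
have mh : measurable_fun setT h.
  apply: (@measurable_sqnorm2 _ 1 a (fun x y => epow (x + y) _)).
  by apply: (measurableT_comp (measurable_epow _)); exact: measurable_funD.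
have mf : measurable_fun setT f.
  apply: emeasurable_funM.
    by apply: (measurableT_comp (@measurable_eradial _ s)); exact: measurable_fst.
  by apply: (measurableT_comp (@measurable_eradial _ t)); exact: measurable_snd.
have h0 z : (0 <= h z)%E by exact: epow_ge0.
have hf z : (h z <= f z)%E by apply: epowD_le => //; exact: sqnorm_ge0.
apply: (@le_trans _ _ (\int[stdgauss 1 1]_x \int[stdgauss a 1]_y f (x, y))%E).
  exact: (@ge0_le_iterated_integral _ _ _ _ _ (stdgauss 1 1) (stdgauss a 1) h f).
have e0 b (g : MX R b 1) r : (0 <= epow (sqnorm g) r)%E by exact: epow_ge0.
have E0 : (0 <= eradial a t)%E by apply: integral_ge0 => g _.
have inner x : (\int[stdgauss a 1]_y f (x, y) = epow (sqnorm x) s * eradial a t)%E.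
  by rewrite /f/= ge0_integralZl//; exact: measurable_eradial.
under eq_integral do rewrite inner.
by rewrite ge0_integralZr//; exact: measurable_eradial.
Qed.

Lemma eradial1_lty s : s < 0 -> - 1 < 2 * s -> (eradial 1 s < +oo)%E.
Proof.
move=> s0 s1; pose q := - (2 * s).
have q0 : 0 < q by rewrite /q; lra.
have q1 : q < 1 by rewrite /q; lra.
have mpdf : measurable_fun setT (fun x : R => (pdf x)%:E).
  by apply/measurable_EFinP; exact: measurable_normal_pdf.
(* The two integrands differ only at 0, a Lebesgue null set. *)
have -> : eradial 1 s = radial 1 s.
  rewrite radial1E /eradial integral_stdgauss1; last 2 first.
  - exact: measurable_eradial.
  - by move=> X; exact: epow_ge0.
  under eq_integral do rewrite /sqnorm big_ord1 mxE eqxx mulr1n.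
  have mX : measurable_fun setT (fun x : R => x ^+ 2) by exact: measurable_funX.
  apply: ae_eq_integral => //.
  - by apply: emeasurable_funM => //; exact: (measurableT_comp (measurable_epow s) mX).
  - apply: emeasurable_funM => //.
    exact: (measurableT_comp (@measurable_EFin_ppow R s) mX).
  exists [set 0]; split; [exact: measurable_set1|exact: lebesgue_measure_set1|].
  move=> x /= /not_implyP[_]; apply: contra_notP => /eqP x0.
  by rewrite /epow /ppow exprn_even_gt0//= x0.
pose g (X : MX R 1 1) : \bar R := (pospow q (X 0 0))%:E.
have mg : measurable_fun setT g.
  apply/measurable_EFinP; apply: (measurableT_comp (@measurable_pospow R q)).
  exact: measurable_entry.
have g0 X : (0 <= g X)%E by rewrite lee_fin pospow_ge0.
pose gN (X : MX R 1 1) : \bar R := g (- (X : 'M[R]_1)).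
have mgN : measurable_fun setT gN.
  apply: (measurableT_comp mg); apply: measurable_mx => i j.
  under eq_fun do rewrite mxE.
  by apply: (measurableT_comp (@oppr_measurable R setT)); exact: measurable_entry.
have gN0 X : (0 <= gN X)%E by exact: g0.
have Ig : (\int[stdgauss 1 1]_X g X < +oo)%E.
  rewrite integral_stdgauss1//.
  have pk0 : 0 <= normal_peak 1 :> R by exact: normal_peak_ge0.
  have mpp : measurable_fun setT (fun x : R => (pospow q x)%:E).
    by apply/measurable_EFinP; exact: measurable_pospow.
  apply: (@le_lt_trans _ _ (\int[leb]_x ((normal_peak 1)%:E * (pospow q x)%:E))%E).
    apply: ge0_le_integral => //.
    - by move=> x _; rewrite mule_ge0// lee_fin normal_pdf_ge0.
    - apply: emeasurable_funM => //.
      by under eq_fun do rewrite /g mxE eqxx mulr1n.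
    - exact: emeasurable_funM.
    - move=> x _; rewrite /g mxE eqxx mulr1n muleC -!EFinM lee_fin.
      by rewrite ler_wpM2r ?pospow_ge0// normal_pdf_le_peak.
  rewrite ge0_integralZl_EFin//; last by move=> x _; rewrite lee_fin pospow_ge0.
  by rewrite lte_mul_pinfty// integral_pospow_lty.
have IgN : (\int[stdgauss 1 1]_X gN X = \int[stdgauss 1 1]_X g X)%E.
  by rewrite -(gauss_opp (stdgaussP 1 1) (stdgaussP 1 1)).
have m1 : measurable_fun setT (fun X => cst 1%E X + (g X + gN X))%E.
  by apply: emeasurable_funD => //; exact: emeasurable_funD.
(* Pointwise domination of |x|^(-q): 1 covers |x| > 1, and [g] and [gN] cover the two sides of the
   singularity. *)
apply: (@le_lt_trans _ _ (\int[stdgauss 1 1]_X (cst 1 X + (g X + gN X)))%E).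
  apply: ge0_le_integral => //.
  - by move=> X _; rewrite lee_fin ppow_ge0.
  - exact: measurable_radial.
  - move=> X _; rewrite /sqnorm big_ord1 /gN /g mxE -!EFinD lee_fin.
    have [x0|x0|->] := ltgtP (X 0 0) 0; last first.
    + by rewrite expr0n ppow_le0// !addr_ge0// ?oppr0 pospow_ge0.
    + rewrite /ppow exprn_gt0// sqr_powR; last exact: ltW.
      have [x1|x1] := leP (X 0 0) 1.
        by rewrite {1}/pospow x0 x1/= /q opprK addrCA lerDl addr_ge0// pospow_ge0.
      rewrite -[leLHS]addr0; apply: lerD; last by rewrite addr_ge0// pospow_ge0.
      by rewrite -[leRHS](powRr0 (X 0 0)); apply: ler_powR; [exact: ltW|lra].
    + have nx0 : 0 < - X 0 0 by rewrite oppr_gt0.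
      rewrite -sqrrN /ppow exprn_gt0// sqr_powR; last exact: ltW.
      have [x1|x1] := leP (- X 0 0) 1.
        by rewrite {2}/pospow nx0 x1/= /q opprK addrA lerDr addr_ge0// pospow_ge0.
      rewrite -[leLHS]addr0; apply: lerD; last by rewrite addr_ge0// pospow_ge0.
      by rewrite -[leRHS](powRr0 (- X 0 0)); apply: ler_powR; [exact: ltW|lra].
rewrite ge0_integralD//; last 2 first.
- by move=> X _; rewrite adde_ge0.
- exact: emeasurable_funD.
rewrite integral_probability_cst ge0_integralD// IgN.
by apply: lte_add_pinfty; [rewrite ltry|exact: lte_add_pinfty].
Qed.

(** The exponent is shared equally among the coordinates. Each share exceeds -1/2, so the
    one-dimensional moment is finite; the induction removes one share t and leaves a+1 shares. *)
Lemma eradial_lty a (s : R) : s < 0 -> - a.+1%:R < 2 * s -> (eradial a.+1 s < +oo)%E.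
Proof.
elim: a s => [|a IH] s s0 sa; first exact: eradial1_lty.
pose t := s / a.+2%:R.
have a2 : 0 < a.+2%:R :> R by [].
have ta : t * a.+2%:R = s by rewrite /t divfK// gt_eqF.
have t0 : t < 0 by rewrite -(pmulr_llt0 _ a2) ta.
have t1 : -1 < 2 * t by rewrite -(ltr_pM2r a2) mulN1r -mulrA ta.
have a1 : 0 < a.+1%:R :> R by [].
have ea : a.+2%:R = a.+1%:R + 1 :> R by rewrite -natr1.
have st : s - t = t * a.+1%:R by rewrite -{1}ta ea; ring.
have st0 : s - t < 0 by rewrite st pmulr_llt0.
have E1 : (eradial 1 t < +oo)%E by exact: eradial1_lty.
have E2 : (eradial a.+1 (s - t) < +oo)%E.
  by apply: IH => //; rewrite st mulrA -[ltLHS]mulN1r ltr_pM2r.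
have -> : eradial a.+2 s = eradial (1 + a.+1) (t + (s - t)) by rewrite subrKC.
apply: (@le_lt_trans _ _ (eradial 1 t * eradial a.+1 (s - t))%E).
  by apply: (@eradial_step a.+1) => //; exact: ltW.
have e0 b r : (0 <= eradial b r)%E by apply: integral_ge0 => g _; exact: epow_ge0.
apply: lte_mul_pinfty => //.
by rewrite ge0_fin_numE.
Qed.

Lemma radial_lty a (s : R) : (0 < a)%N -> - a%:R < 2 * s -> (radial a s < +oo)%E.
Proof.
move=> a0 sa; have [s0|s0] := leP 0 s; first exact: radial_lty_ge0.
apply: le_lt_trans (radial_le_eradial _ _) _.
by case: a a0 sa => // a _; exact: eradial_lty.
Qed.

(** If the moment were 0, then g = 0 almost surely, and by the Cameron-Martin formula g + Y = 0
    almost surely too, where Y has all entries 1. A common witness would give Y = 0. *)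
Lemma radial_gt0 a (s : R) : (0 < a)%N -> (0 < radial a s)%E.
Proof.
move=> a0; rewrite lt_neqAle radial_ge0 andbT eq_sym; apply/eqP => rad0.
have mf := @measurable_radial R a s.
have ae0 : ae_eq (stdgauss a 1) setT (fun g => (ppow (sqnorm g) s)%:E) (cst 0%E).
  apply/(ae_eq_integral_abs _ measurableT mf); rewrite -[RHS]rad0.
  by apply: eq_integral => g _; rewrite gee0_abs// lee_fin ppow_ge0.
pose h (g : MX R a 1) : \bar R := if 0 < sqnorm g then 1%E else 0%E.
have mh : measurable_fun setT h.
  apply: measurable_fun_ifT; [|exact: measurable_cst|exact: measurable_cst].
  by apply: measurable_fun_ltr => //; exact: measurable_sqnorm_MX.
have h0 g : (0 <= h g)%E by rewrite /h; case: ifP.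
have aeh : {ae stdgauss a 1, forall g, h g = 0%E}.
  apply: filterS ae0 => g /= /(_ I) [] pp; rewrite /h; case: ifPn => // g0.
  by have := powR_gt0 s g0; move: pp; rewrite /ppow g0 => ->; rewrite ltxx.
pose Y : 'M[R]_(a, 1) := const_mx 1.
have := stdgaussP a 1 Y h mh h0.
rewrite [RHS](_ : _ = 0%E); last first.
  have me := emeasurable_funM mh (measurable_expdot Y).
  transitivity (\int[stdgauss a 1]_g cst (0%E : \bar R) g)%E;
    last exact: integral_probability_cst.
  apply: ae_eq_integral => //.
  by apply: filterS aeh => g hg _; rewrite /= hg mul0e.
have mhY := measurableT_comp mh (measurable_shiftmx Y).
move=> IhY.
have aehY : {ae stdgauss a 1, forall g, h ((g : 'M[R]_(a, 1)) + Y)%R = 0%E}.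
  have /(ae_eq_integral_abs _ measurableT mhY) : 
      (\int[stdgauss a 1]_g `|(h \o (fun g : MX R a 1 => (g : 'M[R]_(a, 1)) + Y)%R) g| = 0)%E.
    by rewrite -[RHS]IhY; apply: eq_integral => g _; rewrite gee0_abs//; exact: h0.
  by apply: filterS => g /= /(_ I).
have [g [/= hg hgY]] : exists g, h g = 0%E /\ h ((g : 'M[R]_(a, 1)) + Y)%R = 0%E.
  apply: (@ae_witness _ _ _ (stdgauss a 1)).
    by rewrite -[X in (0 < X)%E]mul1e -integral_cst// integral_probability_cst lte01.
  by apply: filterS2 aeh aehY => g hg hgY.
have sq0 (x : 'cV[R]_a) : h x = 0%E -> x = 0.
  rewrite /h; case: ifPn => [_ /eqP|]; first by rewrite onee_eq0.
  by rewrite -leNgt => x0 _; apply: sqnorm_eq0; apply/eqP; rewrite eq_le x0 sqnorm_ge0.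
have := sq0 _ hgY; rewrite (sq0 _ hg) add0r => /matrixP/(_ (Ordinal a0) 0)/eqP.
by rewrite !mxE oner_eq0.
Qed.

End radial_negative.

(** * Mass of the kernel on the Stiefel manifold *)

Section stiefel_kernel.
Context {R : realType} {n m : nat}.
Hypothesis mn : (m <= n)%N.
Variable mu : {finite_measure set (MX R n m) -> \bar R}.
Hypothesis mu_stiefel : mu (~` (@stiefel R n m : set (MX R n m))) = 0%E.
Hypothesis mu_invariant : forall Q : 'M[R]_n, orthogonal_mx Q ->
  forall A : set (MX R n m), measurable A ->
  mu ((fun v : MX R n m => (Q *m v : 'M[R]_(n, m))) @^-1` A) = mu A.

Local Notation u0 := (pid_mx m : 'M[R]_(n, m)).

Lemma measurable_stiefel : measurable (@stiefel R n m : set (MX R n m)).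
Proof.
pose F (v : MX R n m) : R := dot (gram v - 1%:M) (gram v - 1%:M).
have -> : (@stiefel R n m : set (MX R n m)) = F @^-1` [set 0].
  apply/seteqP; split => v /=; rewrite /stiefel /F/= /gram.
    move=> ->; rewrite subrr /dot big1// => i _; rewrite big1// => j _.
    by rewrite mxE mul0r.
  move=> d0; apply/eqP; rewrite -subr_eq0; apply/eqP/matrixP => i j.
  have s0 i' j' : 0 <= (v^T *m v - 1%:M) i' j' * (v^T *m v - 1%:M) i' j'.
    by rewrite -expr2 sqr_ge0.
  have := psumr_eq0P (fun i _ => sumr_ge0 _ (fun j _ => s0 i j)) d0 => /(_ i isT).
  move/(psumr_eq0P (fun j _ => s0 i j)) => /(_ j isT)/eqP.
  by rewrite mulf_eq0 orbb => /eqP ->; rewrite [RHS]mxE.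
rewrite -[X in measurable X]setTI.
have mF : measurable_fun setT F.
  have mg i j : measurable_fun setT (fun v : MX R n m => (gram v - 1%:M) i j).
    under eq_fun do rewrite !mxE.
    apply: measurable_funB => //; apply: measurable_sum => k.
    apply: measurable_funM; last exact: measurable_entry.
    by under eq_fun do rewrite mxE; exact: measurable_entry.
  exact: measurable_dot.
by apply: mF => //; exact: measurable_set1.
Qed.

Lemma ae_stiefel : \forall v \ae mu, gram (v : 'M[R]_(n, m)) = 1%:M.
Proof.
exists (~` (@stiefel R n m : set (MX R n m))); split => //.
by apply: measurableC; exact: measurable_stiefel.
Qed.

Lemma integral_lmul_orthogonal (Q : 'M[R]_n) (f : MX R n m -> \bar R) :
  orthogonal_mx Q -> measurable_fun setT f -> (forall v, 0 <= f v)%E ->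
  (\int[mu]_v f (Q *m (v : 'M[R]_(n, m)))%R = \int[mu]_v f v)%E.
Proof.
move=> oQ mf f0.
have mQ := @measurable_lmul R n n m Q.
pose nu : {measure set (MX R n m) -> \bar R} :=
  measure_function_pushforward__canonical__measure_function_Measure mu mQ.
transitivity (\int[nu]_v f v)%E; first by rewrite ge0_integral_pushforward.
by apply: eq_measure_integral => A mA _; exact: mu_invariant.
Qed.

(** The first argument may be any matrix, not only a frame, so that a Gaussian matrix can be
    substituted for it. *)
Definition akernel s (u v : 'M[R]_(n, m)) : \bar R :=
  (pkernel s (gram (v^T *m u)))%:E.

Lemma akernel_ge0 s u v : (0 <= akernel s u v)%E.
Proof. by rewrite lee_fin pkernel_ge0. Qed.

Lemma measurable_akernel s :
  measurable_fun setT (fun z : MX R n m * MX R n m => akernel s z.1 z.2).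
Proof.
apply/measurable_EFinP; apply: measurable_pkernel; apply: measurable_gram.
apply: measurable_mulmx => i j; last first.
  by apply: (measurableT_comp (measurable_entry i j)); exact: measurable_fst.
under eq_fun do rewrite mxE.
by apply: (measurableT_comp (measurable_entry j i)); exact: measurable_snd.
Qed.

Lemma measurable_akernel_r s u : measurable_fun setT (fun v : MX R n m => akernel s u v).
Proof. exact: (measurable_fun_pair2 (u : MX R n m) (measurable_akernel s)). Qed.

Lemma measurable_akernel_l s v : measurable_fun setT (fun u : MX R n m => akernel s u v).
Proof. exact: (measurable_fun_pair1 (v : MX R n m) (measurable_akernel s)). Qed.

Definition kernel_mass s : \bar R := (\int[mu]_v akernel s u0 v)%E.

Lemma kernel_mass_ge0 s : (0 <= kernel_mass s)%E.
Proof. by apply: integral_ge0 => v _; exact: akernel_ge0. Qed.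

(** Write G = Q u0 t. Invariance of [mu] absorbs Q into v, and t acts on the Gram matrix by
    congruence, which produces exactly the composite power of G'G. *)
Lemma integral_akernel s (G : 'M[R]_(n, m)) :
  (\int[mu]_v akernel s G v = kernel_mass s * (pkernel s (gram G))%:E)%E.
Proof.
have [Q [t [QQ ut ->]]] := thin_qr G mn.
have QQ' : orthogonal_mx Q^T by rewrite /orthogonal_mx trmxK; exact: mulmx1C.
rewrite -mulmxA gram_orthogonal_mul// gram_mul gram_pid_mx// pkernel_congr_upper//.
rewrite pkernel1 mul1r.
have c0 : (0 <= (\prod_j ppow (t j j ^+ 2) (s j))%:E)%E.
  by rewrite lee_fin; apply: prodr_ge0 => j _; exact: ppow_ge0.
have mu0 := measurable_akernel_r s u0.
have muQ := measurableT_comp mu0 (@measurable_lmul R n n m Q^T).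
have -> : kernel_mass s =
    (\int[mu]_v akernel s u0 (Q^T *m (v : 'M[R]_(n, m)))%R)%E.
  exact/esym/(integral_lmul_orthogonal QQ' mu0 (fun v => akernel_ge0 s u0 v)).
have H (v : 'M[R]_(n, m)) : pkernel s (gram (v^T *m (Q *m (u0 *m t)))) =
    pkernel s (gram ((Q^T *m v)^T *m u0)) * \prod_j ppow (t j j ^+ 2) (s j).
  rewrite -(pkernel_congr_upper s (gram ((Q^T *m v)^T *m u0)) ut) -gram_mul.
  by rewrite trmx_mul trmxK !mulmxA.
rewrite -ge0_integralZr//.
  by apply: eq_integral => v _; rewrite /akernel -EFinM H.
by move=> v _; exact: akernel_ge0.
Qed.

Lemma integral_akernel_frame s (u : 'M[R]_(n, m)) : gram u = 1%:M ->
  (\int[mu]_v akernel s u v = kernel_mass s)%E.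
Proof. by move=> u1; rewrite integral_akernel u1 pkernel1 mule1. Qed.

(** Write v = Q u0 t. Since v is a frame, t is orthogonal; it multiplies v'u on the left and
    disappears from the Gram matrix, while Q is absorbed into u. *)
Lemma integral_akernel_frame_l s (v : 'M[R]_(n, m)) : gram v = 1%:M ->
  (\int[mu]_u akernel s u v = \int[mu]_u akernel s u u0)%E.
Proof.
have [Q [t [QQ ut ->]]] := thin_qr v mn.
rewrite -mulmxA (gram_orthogonal_mul _ QQ) gram_mul (gram_pid_mx mn) mulmx1 => tt.
have QQ' : orthogonal_mx Q^T by rewrite /orthogonal_mx trmxK; exact: mulmx1C.
have mu0 := measurable_akernel_l s u0.
transitivity (\int[mu]_u akernel s (Q^T *m (u : 'M[R]_(n, m)))%R u0)%E; last first.
  exact: (integral_lmul_orthogonal QQ' mu0 (fun u => akernel_ge0 s u u0)).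
have tt' : t^T^T *m t^T = 1%:M by rewrite trmxK; exact: mulmx1C.
have H (u : 'M[R]_(n, m)) :
    gram ((Q *m (u0 *m t))^T *m u) = gram (u0^T *m (Q^T *m u)).
  by rewrite !trmx_mul -!mulmxA (gram_orthogonal_mul _ tt').
by apply: eq_integral => u _; rewrite /akernel H.
Qed.

Lemma ge0_integral_ae_cst (f : MX R n m -> \bar R) (c : \bar R) :
  measurable_fun setT f -> (forall v, 0 <= f v)%E -> (0 <= c)%E ->
  (forall v, gram (v : 'M[R]_(n, m)) = 1%:M -> f v = c) ->
  (\int[mu]_v f v = c * mu setT)%E.
Proof.
move=> mf f0 c0 fc; rewrite -integral_cst//; apply: ge0_ae_eq_integral => //.
have F := ae_filter_ringOfSetsType mu.
by apply: filterS ae_stiefel => v /fc.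
Qed.

(** Both sides are the integral of the kernel over pairs of frames, one for each order of
    integration. The total mass stays as a factor because the integrals may be infinite. *)
Lemma kernel_mass_l s :
  (\int[mu]_u akernel s u u0 * mu setT = kernel_mass s * mu setT)%E.
Proof.
pose K (z : MX R n m * MX R n m) := akernel s z.1 z.2.
have mK : measurable_fun setT K by exact: measurable_akernel.
have K0 z : (0 <= K z)%E by exact: akernel_ge0.
transitivity (\int[mu]_v \int[mu]_u akernel s u v)%E.
  apply/esym; apply: ge0_integral_ae_cst.
  - exact: (measurable_fun_fubini_tonelli_G K).
  - by move=> v; apply: integral_ge0 => u _; exact: akernel_ge0.
  - by apply: integral_ge0 => u _; exact: akernel_ge0.
  - by move=> v v1; exact: integral_akernel_frame_l.
rewrite -(fubini_tonelli K)//=.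
apply: ge0_integral_ae_cst.
- exact: (measurable_fun_fubini_tonelli_F K).
- by move=> u; apply: integral_ge0 => v _; exact: akernel_ge0.
- exact: kernel_mass_ge0.
- by move=> u u1; exact: integral_akernel_frame.
Qed.

(* Both sides are the double integral of the kernel (G, v) over the product of
   the Gaussian measure and mu. *)
Lemma kernel_mass_radial s :
  (kernel_mass s * \prod_(j < m) radial (n - j) (s j) =
   (\prod_(j < m) radial (m - j) (s j)) * mu setT)%E.
Proof.
pose K (z : MX R n m * MX R n m) := akernel s z.1 z.2.
have mK : measurable_fun setT K by exact: measurable_akernel.
have K0 z : (0 <= K z)%E by exact: akernel_ge0.
have B0 k : (0 <= \prod_(j < m) radial (k - j) (s j) :> \bar R)%E.
  by elim/big_ind: _ => // [x y|j _]; [exact: mule_ge0|exact: radial_ge0].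
transitivity (\int[mu]_v \int[stdgauss n m]_G akernel s G v)%E; last first.
  apply: ge0_integral_ae_cst.
  - exact: (measurable_fun_fubini_tonelli_G K).
  - by move=> v; apply: integral_ge0 => u _; exact: akernel_ge0.
  - exact: B0.
  - move=> v v1; rewrite -(@gauss_pkernel R m m s (leqnn m)).
    have F0 (M : MX R m m) : (0 <= (pkernel s (gram (M : 'M[R]_m)))%:E)%E.
      by rewrite lee_fin pkernel_ge0.
    exact: (gauss_frame_integral v1 (stdgaussP n m) (stdgaussP m m)
      (measurable_EFin_pkernel s) F0).
rewrite -(fubini_tonelli K)//=.
rewrite -(gauss_pkernel s mn).
have mG := @measurable_EFin_pkernel R n m s.
transitivity (\int[stdgauss n m]_G
    (kernel_mass s * (pkernel s (gram (G : 'M[R]_(n, m))))%:E))%E; last first.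
  by apply: eq_integral => G _; rewrite -integral_akernel.
rewrite ge0_integralZl//; first by move=> M _; rewrite lee_fin pkernel_ge0.
exact: kernel_mass_ge0.
Qed.

End stiefel_kernel.

(** * Finiteness criterion for the kernel mass *)

Section kernel_mass_finite.
Context {R : realType} {n m : nat}.
Hypothesis mn : (m < n)%N.
Variable mu : {finite_measure set (MX R n m) -> \bar R}.
Hypothesis mu_stiefel : mu (~` (@stiefel R n m : set (MX R n m))) = 0%E.
Hypothesis mu_invariant : forall Q : 'M[R]_n, orthogonal_mx Q ->
  forall A : set (MX R n m), measurable A ->
  mu ((fun v : MX R n m => (Q *m v : 'M[R]_(n, m))) @^-1` A) = mu A.

Let mu_fin : (mu setT < +oo)%E.
Proof. by rewrite ltey_eq fin_num_measure. Qed.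

Lemma prode_lty (I : finType) (P : pred I) (F : I -> \bar R) :
  (forall i, 0 <= F i)%E -> (forall i, P i -> F i < +oo)%E ->
  (\prod_(i | P i) F i < +oo)%E.
Proof.
move=> F0 Foo.
suff /andP[] : (0 <= \prod_(i | P i) F i < +oo)%E by [].
elim/big_ind: _ => [|x y /andP[x0 xoo] /andP[y0 yoo]|i Pi].
- by rewrite lee01 ltry.
- by rewrite mule_ge0//= lte_mul_pinfty// ge0_fin_numE.
- by rewrite F0 Foo.
Qed.

Lemma prode_gt0 (I : finType) (P : pred I) (F : I -> \bar R) :
  (forall i, P i -> 0 < F i)%E -> (0 < \prod_(i | P i) F i)%E.
Proof. by move=> F0; elim/big_ind: _ => // x y; exact: mule_gt0. Qed.

(** In [kernel_mass_radial] an infinite mass times positive moments would be infinite, while the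
    right side is finite under the assumed bounds. *)
Lemma kernel_mass_lty s : (forall j : 'I_m, - (m - j)%:R < 2 * s j) ->
  (kernel_mass mu s < +oo)%E.
Proof.
move=> sP; rewrite ltNge leye_eq; apply/eqP => mass_oo.
have := kernel_mass_radial (ltnW mn) mu_stiefel mu_invariant s.
rewrite mass_oo gt0_mulye; last first.
  apply: prode_gt0 => j _; apply: radial_gt0.
  by rewrite subn_gt0 (ltn_trans _ mn).
apply/eqP; rewrite eq_sym lt_eqF//; apply: lte_mul_pinfty => //.
- by apply/ltW/prode_gt0 => j _; apply: radial_gt0; rewrite subn_gt0.
- rewrite ge0_fin_numE; last first.
    by apply/ltW/prode_gt0 => j _; apply: radial_gt0; rewrite subn_gt0.
  apply: prode_lty => j; first exact: radial_ge0.
  by move=> _; apply: radial_lty; [rewrite subn_gt0|exact: sP].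
Qed.

Lemma akernel_le_exp s t (u v : MX R n m) :
  gram (u : 'M[R]_(n, m)) = 1%:M -> gram (v : 'M[R]_(n, m)) = 1%:M ->
  (forall j, t j <= s j) -> (akernel s u v <= akernel t u v)%E.
Proof.
move=> u1 v1 ts; rewrite lee_fin; apply: ler_prod => j _.
by rewrite ppow_ge0 ppow_le_exp// mratio_frames_le1.
Qed.

Lemma kernel_mass_le_exp s t : (forall j, t j <= s j) ->
  (kernel_mass mu s <= kernel_mass mu t)%E.
Proof.
move=> ts.
have u0 : gram (pid_mx m : 'M[R]_(n, m)) = 1%:M by exact/gram_pid_mx/ltnW.
apply: ae_ge0_le_integral => //.
- by move=> v _; exact: akernel_ge0.
- exact: measurable_akernel_r.
- by move=> v _; exact: akernel_ge0.
- exact: measurable_akernel_r.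
- have F := ae_filter_ringOfSetsType mu.
  by apply: filterS (ae_stiefel mu_stiefel) => v v1 _; exact: akernel_le_exp.
Qed.

Lemma kernel_mass_lty_inv s : (0 < mu setT)%E -> (kernel_mass mu s < +oo)%E ->
  forall j : 'I_m, - (m - j)%:R < 2 * s j.
Proof.
move=> mu0 soo j; rewrite ltNge; apply/negP => sj.
(* The exponent at j is raised to the critical value, where the moment in R^(m-j) diverges; the
   others become nonnegative, so that their moments are finite. *)
pose t i : R := if i == j then - ((m - j)%:R / 2) else Num.max (s i) 0.
have st i : s i <= t i.
  rewrite /t; case: eqP => [->|_]; last by rewrite le_max lexx.
  by lra.
have too : (kernel_mass mu t < +oo)%E by exact: le_lt_trans (kernel_mass_le_exp st) soo.
have := kernel_mass_radial (ltnW mn) mu_stiefel mu_invariant t.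
have r0 (i : 'I_m) : (0 < radial (m - i) (t i) :> \bar R)%E.
  by apply: radial_gt0; rewrite subn_gt0.
(* The strict inequality m < n makes the exponent critical in R^(m-j) subcritical in R^(n-j). *)
have tn (i : 'I_m) : (radial (n - i) (t i) < +oo :> \bar R)%E.
  have inn := ltn_trans (ltn_ord i) mn.
  apply: radial_lty; first by rewrite subn_gt0.
  have mni : (m - i)%:R < (n - i)%:R :> R by rewrite ltr_nat ltn_sub2r.
  have m0 : 0 <= (m - i)%:R :> R by [].
  rewrite /t; case: eqP => [<-|_]; first by lra.
  by case: (leP (s i) 0) => si; lra.
have tj : t j = - ((m - j)%:R / 2) by rewrite /t eqxx.
have -> : (\prod_(i < m) radial (m - i) (t i) = +oo :> \bar R)%E.
  rewrite (bigD1 j)//= tj radial_pinfty ?subn_gt0// gt0_mulye//.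
  by apply: prode_gt0 => i _.
rewrite gt0_mulye// => /eqP; apply/negP; rewrite lt_eqF//.
have P0 : (0 <= \prod_(i < m) radial (n - i) (t i))%E.
  by elim/big_ind: _ => // [x y|i _]; [exact: mule_ge0|exact: radial_ge0].
apply: lte_mul_pinfty => //; first exact: kernel_mass_ge0.
- by rewrite ge0_fin_numE// kernel_mass_ge0.
- by apply: prode_lty => // i; exact: radial_ge0.
Qed.

End kernel_mass_finite.

(** * Complex-valued integrals *)

Section complex_norm.
Context {R : realType}.
Implicit Types z w : R[i].
Local Notation Re := complex.Re.
Local Notation Im := complex.Im.

Lemma creM z w : Re (z * w) = Re z * Re w - Im z * Im w.
Proof. by case: z => a b; case: w. Qed.

Lemma cimM z w : Im (z * w) = Re z * Im w + Im z * Re w.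
Proof. by case: z => a b; case: w. Qed.

Lemma creD z w : Re (z + w) = Re z + Re w.
Proof. by case: z => a b; case: w. Qed.

Lemma cimD z w : Im (z + w) = Im z + Im w.
Proof. by case: z => a b; case: w. Qed.

Lemma cre_sum (I : finType) (F : I -> R[i]) : Re (\sum_i F i) = \sum_i Re (F i).
Proof. by elim/big_rec2: _ => // i x y _ <-; rewrite creD. Qed.

Lemma cim_sum (I : finType) (F : I -> R[i]) : Im (\sum_i F i) = \sum_i Im (F i).
Proof. by elim/big_rec2: _ => // i x y _ <-; rewrite cimD. Qed.

Lemma cnorm_ge0 z : 0 <= cnorm z.
Proof. by case: z => a b; exact: sqrtr_ge0. Qed.

Lemma cnorm0 : cnorm (0 : R[i]) = 0. Proof. exact: Normc.normc0. Qed.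

Lemma cnorm1 : cnorm (1 : R[i]) = 1. Proof. exact: Normc.normc1. Qed.

Lemma cnormM z w : cnorm (z * w) = cnorm z * cnorm w.
Proof. exact: Normc.normcM. Qed.

Lemma cnormX z k : cnorm (z ^+ k) = cnorm z ^+ k.
Proof. by elim: k => [|k IH]; rewrite ?expr0 ?cnorm1// !exprS cnormM IH. Qed.

Lemma cnormD z w : cnorm (z + w) <= cnorm z + cnorm w.
Proof. exact: le_normcD. Qed.

Lemma cnormN z : cnorm (- z) = cnorm z.
Proof. exact: normcN. Qed.

Lemma cnorm_sum (I : finType) (P : pred I) (F : I -> R[i]) :
  cnorm (\sum_(i | P i) F i) <= \sum_(i | P i) cnorm (F i).
Proof.
elim/big_ind2: _ => // [|x x' y y' xx yy]; first by rewrite cnorm0.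
by rewrite (le_trans (cnormD _ _))// lerD.
Qed.

Lemma cnorm_prod (I : finType) (F : I -> R[i]) :
  cnorm (\prod_i F i) = \prod_i cnorm (F i).
Proof.
by elim/big_rec2: _ => [|i x y _ <-]; [exact: cnorm1|rewrite cnormM].
Qed.

Lemma cnormE z : cnorm z = Num.sqrt (Re z ^+ 2 + Im z ^+ 2).
Proof. by case: z. Qed.

Lemma cnorm_real (x : R) : cnorm (Complex x 0) = `|x|.
Proof. by rewrite cnormE/= expr0n addr0 sqrtr_sqr. Qed.

Lemma Re_le_cnorm z : `|Re z| <= cnorm z.
Proof. by rewrite cnormE -sqrtr_sqr ler_wsqrtr// lerDl sqr_ge0. Qed.

Lemma Im_le_cnorm z : `|Im z| <= cnorm z.
Proof. by rewrite cnormE -sqrtr_sqr ler_wsqrtr// lerDr sqr_ge0. Qed.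

Lemma cnorm_le_ReIm z : cnorm z <= `|Re z| + `|Im z|.
Proof.
case: z => a b; have e : Complex a b = Complex a 0 + Complex 0 1 * Complex b 0.
  by apply/eqP; rewrite eq_complex/=; apply/andP; split; apply/eqP; ring.
rewrite [X in cnorm X]e (le_trans (cnormD _ _))// cnormM !cnorm_real.
by rewrite cnormE/= expr0n expr1n add0r sqrtr1 mul1r.
Qed.

End complex_norm.

(** * Integration of complex-valued functions *)

Section complex_integral.
Context d (T : measurableType d) (R : realType).
Local Notation Re := complex.Re.
Local Notation Im := complex.Im.

Definition cmeasurable (f : T -> R[i]) :=
  measurable_fun setT (fun x => Re (f x)) /\ measurable_fun setT (fun x => Im (f x)).

Lemma cmeasurable_cst z : cmeasurable (fun=> z).
Proof. by split; exact: measurable_cst. Qed.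

Lemma cmeasurableM f g :
  cmeasurable f -> cmeasurable g -> cmeasurable (fun x => f x * g x).
Proof.
move=> [mf1 mf2] [mg1 mg2]; split.
  under eq_fun do rewrite creM.
  by apply: measurable_funB; exact: measurable_funM.
under eq_fun do rewrite cimM.
by apply: measurable_funD; exact: measurable_funM.
Qed.

Lemma cmeasurableD f g :
  cmeasurable f -> cmeasurable g -> cmeasurable (fun x => f x + g x).
Proof.
move=> [mf1 mf2] [mg1 mg2]; split.
  by under eq_fun do rewrite creD; exact: measurable_funD.
by under eq_fun do rewrite cimD; exact: measurable_funD.
Qed.

Lemma cmeasurable_sum (I : Type) (s : seq I) (F : I -> T -> R[i]) :
  (forall i, cmeasurable (F i)) -> cmeasurable (fun x => \sum_(i <- s) F i x).
Proof.
move=> mF; elim: s => [|i s IH].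
  by under eq_fun do rewrite big_nil; exact: cmeasurable_cst.
by under eq_fun do rewrite big_cons; exact: cmeasurableD.
Qed.

Lemma cmeasurable_prod (I : Type) (s : seq I) (F : I -> T -> R[i]) :
  (forall i, cmeasurable (F i)) -> cmeasurable (fun x => \prod_(i <- s) F i x).
Proof.
move=> mF; elim: s => [|i s IH].
  by under eq_fun do rewrite big_nil; exact: cmeasurable_cst.
by under eq_fun do rewrite big_cons; exact: cmeasurableM.
Qed.

Lemma cmeasurableX f k : cmeasurable f -> cmeasurable (fun x => f x ^+ k).
Proof.
move=> mf; elim: k => [|k IH].
  by under eq_fun do rewrite expr0; exact: cmeasurable_cst.
by under eq_fun do rewrite exprS; exact: cmeasurableM.
Qed.

Lemma measurable_cnorm f : cmeasurable f ->
  measurable_fun setT (fun x => (cnorm (f x))%:E).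
Proof.
move=> [m1 m2]; apply/measurable_EFinP.
under eq_fun do rewrite cnormE.
apply: (measurableT_comp (continuous_measurable_fun (@sqrt_continuous R))).
by apply: measurable_funD; exact: measurable_funX.
Qed.

Variable mu : {measure set T -> \bar R}.
Implicit Types f g : T -> R[i].

Lemma cintegrable_cmeasurable f : cintegrable mu setT f -> cmeasurable f.
Proof.
by move=> [i1 i2]; split; apply/measurable_EFinP; [exact: measurable_int i1|
  exact: measurable_int i2].
Qed.

Lemma cintegrable_cnorm f : cintegrable mu setT f ->
  (\int[mu]_x (cnorm (f x))%:E < +oo)%E.
Proof.
move=> fi; have mn := measurable_cnorm (cintegrable_cmeasurable fi).
case: fi => /integrableP[m1 i1] /integrableP[m2 i2].
have ma1 := measurableT_comp (@abse_measurable R setT) m1.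
have ma2 := measurableT_comp (@abse_measurable R setT) m2.
apply: (@le_lt_trans _ _
  (\int[mu]_x (`|(Re (f x))%:E| + `|(Im (f x))%:E|))%E).
  apply: ge0_le_integral => //.
  - by move=> x _; rewrite lee_fin cnorm_ge0.
  - exact: emeasurable_funD.
  - by move=> x _; rewrite -EFinD lee_fin cnorm_le_ReIm.
by rewrite ge0_integralD// lte_add_pinfty.
Qed.

Lemma cintegrableP f : cmeasurable f ->
  (\int[mu]_x (cnorm (f x))%:E < +oo)%E -> cintegrable mu setT f.
Proof.
move=> mf fi; have mn := measurable_cnorm mf; case: mf => m1 m2.
have me1 : measurable_fun setT (fun x => (Re (f x))%:E) by exact/measurable_EFinP.
have me2 : measurable_fun setT (fun x => (Im (f x))%:E) by exact/measurable_EFinP.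
split; apply/integrableP; split => //; apply: le_lt_trans fi.
  apply: ge0_le_integral => //; first exact: measurableT_comp.
  by move=> x _; rewrite lee_fin Re_le_cnorm.
apply: ge0_le_integral => //; first exact: measurableT_comp.
by move=> x _; rewrite lee_fin Im_le_cnorm.
Qed.

Lemma cintegrable_le f (h : T -> \bar R) : cmeasurable f ->
  measurable_fun setT h -> (\forall x \ae mu, (cnorm (f x))%:E <= h x)%E ->
  (forall x, 0 <= h x)%E -> (\int[mu]_x h x < +oo)%E -> cintegrable mu setT f.
Proof.
move=> mf mh fh h0 hoo; apply: cintegrableP => //; apply: le_lt_trans hoo.
apply: ae_ge0_le_integral => //.
- by move=> x _; rewrite lee_fin cnorm_ge0.
- exact: measurable_cnorm.
- have F := ae_filter_ringOfSetsType mu.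
  by apply: filterS fh.
Qed.

(* No integrability is needed: Rintegral takes finite values and fine maps
   infinite integrals to 0. *)
Lemma cnorm_cintegral_le f : cmeasurable f ->
  ((cnorm (cintegral mu setT f))%:E <= 2%:E * \int[mu]_x (cnorm (f x))%:E)%E.
Proof.
move=> mf; have mn := measurable_cnorm mf; case: mf => m1 m2.
have part (g : T -> R) : measurable_fun setT g -> (forall x, `|g x| <= cnorm (f x)) ->
    (`|Rintegral mu setT g|%:E <= \int[mu]_x (cnorm (f x))%:E)%E.
  move=> mg gf; have mge : measurable_fun setT (EFin \o g) by exact/measurable_EFinP.
  apply: (@le_trans _ _ (\int[mu]_x `|(g x)%:E|)%E).
    apply: le_trans (le_abse_integral mu measurableT mge).
    by rewrite /Rintegral; case: (\int[mu]_x _)%E => [r| |] //=; rewrite normr0 leey.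
  apply: ge0_le_integral => //; first exact: measurableT_comp.
  by move=> x _; rewrite lee_fin.
apply: (@le_trans _ _ (`|Rintegral mu setT (fun x => Re (f x))|%:E +
    `|Rintegral mu setT (fun x => Im (f x))|%:E)%E).
  by rewrite -EFinD lee_fin; exact: (cnorm_le_ReIm (cintegral mu setT f)).
have -> : (2%:E = 1%:E + 1%:E :> \bar R)%E by rewrite -EFinD.
rewrite ge0_muleDl// !mul1e.
by apply: leeD; apply: part => // x; [exact: Re_le_cnorm|exact: Im_le_cnorm].
Qed.

Lemma cintegrableZ z f : cintegrable mu setT f -> cintegrable mu setT (fun x => z * f x).
Proof.
move=> fi; have mf := cintegrable_cmeasurable fi.
apply: cintegrableP; first by apply: cmeasurableM => //; exact: cmeasurable_cst.
under eq_integral do rewrite cnormM EFinM.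
rewrite ge0_integralZl_EFin//.
- by apply: lte_mul_pinfty; rewrite ?lee_fin ?cnorm_ge0//; exact: cintegrable_cnorm.
- by move=> x _; rewrite lee_fin cnorm_ge0.
- exact: measurable_cnorm.
- exact: cnorm_ge0.
Qed.

Lemma cintegrableD f g : cintegrable mu setT f -> cintegrable mu setT g ->
  cintegrable mu setT (fun x => f x + g x).
Proof.
move=> [f1 f2] [g1 g2]; split.
  by under eq_fun do rewrite creD EFinD; exact: integrableD.
by under eq_fun do rewrite cimD EFinD; exact: integrableD.
Qed.

Lemma cintegralZ z f : cintegrable mu setT f ->
  cintegral mu setT (fun x => z * f x) = z * cintegral mu setT f.
Proof.
move=> [f1 f2]; apply/eqP; rewrite eq_complex creM cimM /=.
have iZ (r : R) (g : T -> R) : mu.-integrable setT (EFin \o g) ->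
    mu.-integrable setT (EFin \o (fun x => r * g x)).
  by move=> gi; apply: eq_integrable (integrableZl measurableT r gi).
apply/andP; split; apply/eqP.
  under eq_Rintegral do rewrite creM.
  by rewrite RintegralB ?RintegralZl//; exact: iZ.
under eq_Rintegral do rewrite cimM.
by rewrite RintegralD ?RintegralZl//; exact: iZ.
Qed.

Lemma cintegralD f g : cintegrable mu setT f -> cintegrable mu setT g ->
  cintegral mu setT (fun x => f x + g x) = cintegral mu setT f + cintegral mu setT g.
Proof.
move=> [f1 f2] [g1 g2]; apply/eqP; rewrite eq_complex creD cimD /=.
apply/andP; split; apply/eqP.
  by under eq_Rintegral do rewrite creD; rewrite RintegralD.
by under eq_Rintegral do rewrite cimD; rewrite RintegralD.
Qed.

Lemma cintegral_sum (I : finType) (F : I -> T -> R[i]) :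
  (forall i, cintegrable mu setT (F i)) ->
  cintegrable mu setT (fun x => \sum_i F i x) /\
  cintegral mu setT (fun x => \sum_i F i x) = \sum_i cintegral mu setT (F i).
Proof.
move=> iF; rewrite unlock; elim: (index_enum I) => [|i s [IH1 IH2]] /=.
  split; first by split; exact: integrable0.
  by rewrite /cintegral /Rintegral !integral0.
by split; [exact: cintegrableD|rewrite -IH2; exact: cintegralD].
Qed.

End complex_integral.

(** * Power series of complex powers *)

Section exponential_sum.
Import numFieldNormedType.Exports.

Definition expsum (F : fieldType) N (x : F) : F := \sum_(k < N) x ^+ k / k`!%:R.

(** The terms of total degree at least N in the product of two truncated exponential series. *)
Definition exprem (F : fieldType) N (x y : F) : F :=
  \sum_(i < N) \sum_(j < N | (N <= i + j)%N) (x ^+ i / i`!%:R) * (y ^+ j / j`!%:R).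

(** By the binomial formula the terms with i + j < N add up to the truncated series at x + y. The
    identity serves twice, for complex arguments and for their moduli, to bound the remainder. *)
Lemma expsumM (F : numFieldType) N (x y : F) :
  expsum N x * expsum N y = expsum N (x + y) + exprem N x y.
Proof.
pose T i j := (x ^+ i / i`!%:R) * (y ^+ j / j`!%:R).
have fact0 k : k`!%:R != 0 :> F by rewrite pnatr_eq0 -lt0n fact_gt0.
have diag n : (x + y) ^+ n / n`!%:R = \sum_(i < n.+1) T i (n - i)%N.
  rewrite addrC exprDn mulr_suml; apply: eq_bigr => i _.
  have le_in : (i <= n)%N by rewrite -ltnS.
  rewrite /T -[X in X / _]mulr_natr -(bin_fact le_in) !natrM.
  by field; rewrite !fact0 pnatr_eq0 -lt0n bin_gt0 le_in.
have tri n : expsum n (x + y) = \sum_(i < n) \sum_(j < n - i) T i j.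
  elim: n => [|n IH]; first by rewrite /expsum !big_ord0.
  rewrite /expsum big_ord_recr /= -/(expsum n _) IH diag.
  rewrite [in RHS]big_ord_recr /= [X in _ = _ + X](_ : _ = T n 0%N); last first.
    by rewrite subSnn big_ord1.
  rewrite [X in _ + X = _]big_ord_recr /= subnn addrA; congr (_ + _).
  rewrite -big_split /=; apply: eq_bigr => i _.
  by rewrite subSn ?big_ord_recr//= ltnW.
rewrite tri /expsum mulr_suml /exprem -big_split /=; apply: eq_bigr => i _.
rewrite mulr_sumr (bigID (fun j : 'I_N => (N <= i + j)%N)) /= addrC; congr (_ + _).
rewrite (big_ord_widen N (T i)) ?leq_subr//; apply: eq_bigl => j.
by rewrite -ltnNge ltn_subRL.
Qed.

Context {R : realType}.
Local Notation Re := complex.Re.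
Local Notation Im := complex.Im.

Lemma cnorm_nat k : cnorm (k%:R : R[i]) = k%:R.
Proof.
have -> : (k%:R : R[i]) = Complex k%:R 0 by rewrite -(rmorph_nat (real_complex R)).
by rewrite cnorm_real normr_nat.
Qed.

Lemma cnorm_expterm (z : R[i]) k : cnorm (z ^+ k / k`!%:R) = cnorm z ^+ k / k`!%:R.
Proof.
rewrite cnormM cnormX; congr (_ * _).
by rewrite [LHS]Normc.normcV -[Normc.normc _]/(cnorm _) cnorm_nat.
Qed.

Lemma cnorm_exprem N (z w : R[i]) :
  cnorm (exprem N z w) <= exprem N (cnorm z) (cnorm w).
Proof.
rewrite (le_trans (cnorm_sum _ _))//; apply: ler_sum => i _.
rewrite (le_trans (cnorm_sum _ _))//; apply: ler_sum => j _.
by rewrite cnormM !cnorm_expterm.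
Qed.

Lemma expsum_series N (x : R) : expsum N x = series (exp_coeff x) N.
Proof. by rewrite /expsum /series/= big_mkord. Qed.

Lemma cvg_expsum (x : R) : (expsum N x @[N --> \oo] --> expR x).
Proof.
under eq_fun do rewrite expsum_series.
exact: is_cvg_series_exp_coeff.
Qed.

Lemma expsum_le_expR N (x : R) : 0 <= x -> expsum N x <= expR x.
Proof.
move=> x0; rewrite -(cvg_lim _ (@cvg_expsum x))//.
apply: nondecreasing_cvgn_le; last by apply/cvg_ex; exists (expR x); exact: cvg_expsum.
apply/nondecreasing_seqP => n; rewrite /expsum big_ord_recr/= lerDl.
by rewrite divr_ge0// exprn_ge0.
Qed.

Lemma expsum_real N (a : R) : expsum N (Complex a 0) = Complex (expsum N a) 0.
Proof.
rewrite -[Complex a 0]/(real_complex R a) -[RHS]/(real_complex R (expsum N a)).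
rewrite /expsum rmorph_sum; apply: eq_bigr => k _.
by rewrite rmorphM rmorphXn fmorphV rmorph_nat.
Qed.

Lemma expterm_imag (b : R) k :
  Complex 0 b ^+ k / k`!%:R = Complex (cos_coeff b k) (sin_coeff b k).
Proof.
have -> : (k`!%:R : R[i])^-1 = Complex (k`!%:R)^-1 0.
  by rewrite -[RHS]/(real_complex R _) fmorphV rmorph_nat.
have mulib (x y : R) : Complex 0 b * Complex x y = Complex (- (b * y)) (b * x).
  by apply/eqP; rewrite eq_complex/= !mul0r sub0r add0r !eqxx.
have -> : Complex 0 b ^+ k = Complex ((~~ odd k)%:R * (-1) ^+ k./2 * b ^+ k)
    ((odd k)%:R * (-1) ^+ k.-1./2 * b ^+ k).
  elim: k => [|k IH]; first by rewrite /= !expr0 !mulr1 mulr0n mulr1n.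
  rewrite exprS IH; apply: etrans (mulib _ _) _; congr Complex; last first.
    by rewrite exprS/=; ring.
  rewrite /= negbK; case: (boolP (odd k)) => ok; last by rewrite !mul0r mulr0 oppr0.
  rewrite [in RHS]exprS uphalf_half ok exprS !mul1r.
  have -> : k.-1./2 = k./2.
    by case: k {IH} ok => //= k; rewrite uphalf_half => /negbTE ->.
  by ring.
by apply/eqP; rewrite eq_complex/= !mulr0 subr0 add0r /cos_coeff /sin_coeff/= !eqxx.
Qed.

Lemma expsum_imag N (b : R) :
  expsum N (Complex 0 b) = Complex (series (cos_coeff b) N) (series (sin_coeff b) N).
Proof.
rewrite /expsum /series/= !big_mkord; apply/eqP; rewrite eq_complex cre_sum cim_sum/=.
by apply/andP; split; apply/eqP; apply: eq_bigr => k _; rewrite expterm_imag.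
Qed.

Definition cexp (z : R[i]) : R[i] :=
  Complex (expR (Re z) * cos (Im z)) (expR (Re z) * sin (Im z)).

Lemma cexpD z w : cexp (z + w) = cexp z * cexp w.
Proof.
apply/eqP; rewrite eq_complex creM cimM /= creD cimD expRD cosD sinD.
by apply/andP; split; apply/eqP; ring.
Qed.

Definition ccvg (u : nat -> R[i]) (l : R[i]) := cnorm (u N - l) @[N --> \oo] --> (0 : R).

(** For z = a + ib the sum is the product of the real and imaginary series minus a remainder. The
    remainder is dominated by the real one at |a|, |b|, which tends to exp|a| exp|b| - exp(|a| +
    |b|) = 0. *)
Lemma cvg_cexp z : ccvg (fun N => expsum N z) (cexp z).
Proof.
case: z => a b.
pose C N := series (cos_coeff b) N; pose S N := series (sin_coeff b) N.
have cC : C N @[N --> \oo] --> cos b by rewrite unlock; exact: is_cvg_series_cos_coeff.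
have cS : S N @[N --> \oo] --> sin b by rewrite unlock; exact: is_cvg_series_sin_coeff.
pose B N : R := `|expsum N a * C N - expR a * cos b| +
  `|expsum N a * S N - expR a * sin b| +
  (expsum N `|a| * expsum N `|b| - expsum N (`|a| + `|b|)).
have cB : B N @[N --> \oo] --> (0 : R).
  have -> : (0 : R) = `|expR a * cos b - expR a * cos b| +
      `|expR a * sin b - expR a * sin b| +
      (expR `|a| * expR `|b| - expR (`|a| + `|b|)).
    by rewrite expRD !subrr normr0 !addr0.
  apply: cvgD; first apply: cvgD.
  - apply: cvg_norm; apply: cvgB; last exact: cvg_cst.
    by apply: cvgM => //; exact: cvg_expsum.
  - apply: cvg_norm; apply: cvgB; last exact: cvg_cst.
    by apply: cvgM => //; exact: cvg_expsum.
  - by apply: cvgB; [apply: cvgM|]; exact: cvg_expsum.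
apply: (squeeze_cvgr _ (cvg_cst 0) cB); apply: nearW => N.
rewrite cnorm_ge0/=.
have ab : Complex a b = Complex a 0 + Complex 0 b.
  by apply/eqP; rewrite eq_complex/= addr0 add0r !eqxx.
have -> : expsum N (Complex a b) - cexp (Complex a b) =
    (Complex (expsum N a * C N - expR a * cos b) (expsum N a * S N - expR a * sin b))
    - exprem N (Complex a 0) (Complex 0 b).
  have -> : expsum N (Complex a b) = expsum N (Complex a 0) * expsum N (Complex 0 b)
      - exprem N (Complex a 0) (Complex 0 b).
    by rewrite expsumM -ab addrK.
  rewrite expsum_real expsum_imag addrAC; congr (_ - _).
  apply/eqP; rewrite eq_complex creD cimD creM cimM /=.
  by apply/andP; split; apply/eqP; rewrite /C /S; ring.
rewrite (le_trans (cnormD _ _))// cnormN lerD//.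
  by rewrite (le_trans (cnorm_le_ReIm _)).
rewrite (le_trans (cnorm_exprem _ _ _))//.
have nb : cnorm (Complex 0 b) = `|b|.
  by rewrite cnormE/= expr0n add0r sqrtr_sqr.
by rewrite cnorm_real nb expsumM addrAC subrr add0r.
Qed.

Lemma ccvg_cst z : ccvg (fun=> z) z.
Proof. by rewrite /ccvg subrr cnorm0; exact: cvg_cst. Qed.

Lemma ccvgM u w a b : ccvg u a -> ccvg w b -> ccvg (fun N => u N * w N) (a * b).
Proof.
move=> ua wb.
pose B N : R := cnorm (u N - a) * cnorm (w N - b) + cnorm a * cnorm (w N - b) +
  cnorm (u N - a) * cnorm b.
have cB : B N @[N --> \oo] --> (0 : R).
  have -> : (0 : R) = 0 * 0 + cnorm a * 0 + 0 * cnorm b by rewrite !mul0r mulr0 !addr0.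
  by apply: cvgD; [apply: cvgD|]; apply: cvgM => //; exact: cvg_cst.
apply: (squeeze_cvgr _ (cvg_cst 0) cB); apply: nearW => N.
rewrite cnorm_ge0/=.
have -> : u N * w N - a * b =
    (u N - a) * (w N - b) + a * (w N - b) + (u N - a) * b by ring.
rewrite (le_trans (cnormD _ _))// cnormM lerD//.
by rewrite (le_trans (cnormD _ _))// !cnormM.
Qed.

Lemma ccvg_prod (I : Type) (s : seq I) (u : I -> nat -> R[i]) (l : I -> R[i]) :
  (forall i, ccvg (u i) (l i)) ->
  ccvg (fun N => \prod_(i <- s) u i N) (\prod_(i <- s) l i).
Proof.
move=> ul; elim: s => [|i s IH].
  by rewrite big_nil; under eq_fun do rewrite big_nil; exact: ccvg_cst.
by rewrite big_cons; under eq_fun do rewrite big_cons; exact: ccvgM.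
Qed.

End exponential_sum.

(** * Taylor series of x^(z/2) in the exponent *)

Section power_series.
Import numFieldNormedType.Exports.
Context {R : realType}.
Local Notation Re := complex.Re.
Local Notation Im := complex.Im.

(** The k-th Taylor coefficient at a of z |-> x^(z/2), for x > 0. *)
Definition powcoef (a : R[i]) k (x : R) : R[i] :=
  cpow x (a / 2) * (Complex (ln x / 2) 0 ^+ k / k`!%:R).

Lemma Re_half (z : R[i]) : Re (z / 2) = Re z / 2.
Proof.
have -> : (2 : R[i])^-1 = Complex 2^-1 0.
  by rewrite -[RHS]/(real_complex R _) fmorphV rmorph_nat.
by rewrite creM/= mulr0 subr0.
Qed.

Lemma cpow_cexp x (z : R[i]) : 0 < x -> cpow x z = cexp (z * Complex (ln x) 0).
Proof. by move=> x0; rewrite /cpow x0 /cexp creM cimM/= !mulr0 subr0 add0r. Qed.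

Lemma cnorm_cpow x (z : R[i]) : cnorm (cpow x z) = ppow x (Re z).
Proof.
rewrite /cpow /ppow; case: ifPn => x0; last exact: cnorm0.
rewrite cnormE/= !exprMn -mulrDr cos2Dsin2 mulr1 sqrtr_sqr ger0_norm ?expR_ge0//.
by rewrite /powR gt_eqF.
Qed.

(** For 0 < x <= 1, |ln x| = - ln x, so the series of moduli sums to x^(Re a/2) exp(- rho ln x/2): a
    radius rho costs exactly a drop of rho in Re a. *)
Lemma powcoef_bound (a : R[i]) (rho x : R) N : 0 <= rho -> x <= 1 ->
  \sum_(k < N) cnorm (powcoef a k x) * rho ^+ k <= ppow x ((Re a - rho) / 2).
Proof.
move=> rho0 x1; under eq_bigr do rewrite /powcoef cnormM cnorm_expterm cnorm_cpow Re_half.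
have [x0|x0] := leP x 0.
  by rewrite big1 ?ppow_ge0// => k _; rewrite ppow_le0// !mul0r.
have -> : \sum_(k < N) ppow x (Re a / 2) *
    (cnorm (Complex (ln x / 2) 0) ^+ k / k`!%:R) * rho ^+ k =
    ppow x (Re a / 2) * expsum N (- ln x / 2 * rho).
  rewrite /expsum mulr_sumr; apply: eq_bigr => k _.
  rewrite cnorm_real -normrN -mulNr ger0_norm; last first.
    by rewrite divr_ge0// oppr_ge0 ln_le0.
  by rewrite [in RHS]exprMn; ring.
have h0 : 0 <= - ln x / 2 * rho by rewrite mulr_ge0// divr_ge0// oppr_ge0 ln_le0.
rewrite (le_trans (ler_wpM2l (ppow_ge0 _ _) (expsum_le_expR N h0)))//.
rewrite /ppow x0 /powR gt_eqF// -expRD ler_expR le_eqVlt; apply/orP; left.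
by apply/eqP; field.
Qed.

Lemma ccvg_powcoef (a w : R[i]) (x : R) :
  ccvg (fun N => \sum_(k < N) powcoef a k x * w ^+ k) (cpow x ((a + w) / 2)).
Proof.
have [x0|x0] := leP x 0.
  rewrite /cpow ltNge x0/=.
  have -> : (fun N => \sum_(k < N) powcoef a k x * w ^+ k) = (fun=> 0).
    apply/funext => N; rewrite big1// => k _.
    by rewrite /powcoef /cpow ltNge x0/= !mul0r.
  exact: ccvg_cst.
pose L : R[i] := Complex (ln x) 0.
have L2 : Complex (ln x / 2) 0 = L / 2.
  by rewrite -[LHS]/(real_complex R _) rmorphM fmorphV rmorph_nat.
have -> : cpow x ((a + w) / 2) = cpow x (a / 2) * cexp (w * (L / 2)).
  by rewrite !cpow_cexp// -cexpD; congr cexp; rewrite -/L; field.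
have -> : (fun N => \sum_(k < N) powcoef a k x * w ^+ k) =
    (fun N => cpow x (a / 2) * expsum N (w * (L / 2))).
  apply/funext => N; rewrite /expsum mulr_sumr; apply: eq_bigr => k _.
  by rewrite /powcoef L2 [in RHS]exprMn; ring.
by apply: ccvgM; [exact: ccvg_cst|exact: cvg_cexp].
Qed.

End power_series.

Section complex_dominated_convergence.
Import numFieldNormedType.Exports.
Context d (T : measurableType d) (R : realType).
Variable mu : {measure set T -> \bar R}.
Local Notation Re := complex.Re.
Local Notation Im := complex.Im.

Lemma ccvg_reim (u : nat -> R[i]) l :
  Re (u N) @[N --> \oo] --> Re l -> Im (u N) @[N --> \oo] --> Im l -> ccvg u l.
Proof.
move=> uR uI; pose B N : R := `|Re (u N) - Re l| + `|Im (u N) - Im l|.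
have cB : B N @[N --> \oo] --> (0 : R).
  have -> : (0 : R) = `|Re l - Re l| + `|Im l - Im l|.
    by rewrite !subrr normr0 addr0.
  by apply: cvgD; apply: cvg_norm; apply: cvgB => //; exact: cvg_cst.
apply: (squeeze_cvgr _ (cvg_cst 0) cB); apply: nearW => N.
rewrite cnorm_ge0/=; have := cnorm_le_ReIm (u N - l).
by rewrite creD cimD /B; case: (l).
Qed.

Lemma ccvg_Re (u : nat -> R[i]) l : ccvg u l -> Re (u N) @[N --> \oo] --> Re l.
Proof.
move=> ul; apply/subr_cvg0/norm_cvg0P; apply: (squeeze_cvgr _ (cvg_cst 0) ul); apply: nearW => N.
rewrite normr_ge0/=; have := Re_le_cnorm (u N - l).
by rewrite creD; case: (l).
Qed.

Lemma ccvg_Im (u : nat -> R[i]) l : ccvg u l -> Im (u N) @[N --> \oo] --> Im l.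
Proof.
move=> ul; apply/subr_cvg0/norm_cvg0P; apply: (squeeze_cvgr _ (cvg_cst 0) ul); apply: nearW => N.
rewrite normr_ge0/=; have := Im_le_cnorm (u N - l).
by rewrite cimD; case: (l).
Qed.

Lemma ccvg_cintegral (F : nat -> T -> R[i]) (g : T -> R[i]) (h : T -> \bar R) :
  (forall N, cmeasurable (F N)) -> cmeasurable g ->
  (forall x, ccvg (fun N => F N x) (g x)) ->
  mu.-integrable setT h ->
  (\forall x \ae mu, forall N, (cnorm (F N x))%:E <= h x)%E ->
  ccvg (fun N => cintegral mu setT (F N)) (cintegral mu setT g).
Proof.
move=> mF [mg1 mg2] Fg ih Fh.
have AE := ae_filter_ringOfSetsType mu.
have part (p : R[i] -> R) : (forall N, measurable_fun setT (fun x => p (F N x))) ->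
    measurable_fun setT (fun x => p (g x)) ->
    (forall x, p (F N x) @[N --> \oo] --> p (g x)) ->
    (forall z, `|p z| <= cnorm z) ->
    Rintegral mu setT (fun x => p (F N x)) @[N --> \oo] -->
    Rintegral mu setT (fun x => p (g x)).
  move=> mpF mpg pFg pn.
  have meF N : measurable_fun setT (fun x => (p (F N x))%:E).
    exact/measurable_EFinP.
  have meg : measurable_fun setT (fun x => (p (g x))%:E) by exact/measurable_EFinP.
  have cF : \forall x \ae mu, setT x -> (p (F N x))%:E @[N --> \oo] --> (p (g x))%:E.
    by apply: aeW => x _; apply: cvg_EFin; [exact: nearW|exact: pFg].
  have bF : \forall x \ae mu, forall N, setT x -> (`|(p (F N x))%:E| <= h x)%E.
    apply: filterS Fh => x Fx N _; apply: le_trans (Fx N).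
    by rewrite lee_fin.
  have [ig _ c] := dominated_convergence measurableT meF meg cF ih bF.
  apply: fine_cvg; rewrite fineK//.
  exact: integrable_fin_num ig.
apply: ccvg_reim; apply: part => //.
- by move=> N; case: (mF N).
- by move=> x; exact: ccvg_Re.
- exact: Re_le_cnorm.
- by move=> N; case: (mF N).
- by move=> x; exact: ccvg_Im.
- exact: Im_le_cnorm.
Qed.

End complex_dominated_convergence.

(** * The operator *)

Section operator_kernel.
Context {R : realType}.
Local Notation Re := complex.Re.
Local Notation Im := complex.Im.

Lemma cmeasurable_comp d1 d2 (T1 : measurableType d1) (T2 : measurableType d2)
    (f : T2 -> R[i]) (g : T1 -> T2) :
  cmeasurable f -> measurable_fun setT g -> cmeasurable (fun x => f (g x)).
Proof. by move=> [f1 f2] mg; split; [exact: (measurableT_comp f1)|exact: (measurableT_comp f2)]. Qed.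

Lemma cmeasurable_cpow (z : R[i]) : cmeasurable (fun x : R => cpow x z).
Proof.
have mln (c : R) : measurable_fun setT (fun x : R => c * ln x).
  by apply: measurable_funM => //; exact: measurable_ln.
have me := measurableT_comp (@measurable_expR R) (mln (Re z)).
have mc := measurableT_comp (continuous_measurable_fun (@continuous_cos R)) (mln (Im z)).
have ms := measurableT_comp (continuous_measurable_fun (@continuous_sin R)) (mln (Im z)).
have E (p : R[i] -> R) x : p (cpow x z) = if 0 < x then p
    (Complex (expR (Re z * ln x) * cos (Im z * ln x))
             (expR (Re z * ln x) * sin (Im z * ln x))) else p 0.
  by rewrite /cpow; case: ifP.
have mlt : measurable_fun setT (fun x : R => 0 < x) by exact: measurable_fun_ltr.
split; under eq_fun do rewrite E /=; apply: measurable_fun_ifT => //.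
- exact: measurable_funM.
- exact: measurable_funM.
Qed.

Lemma cmeasurable_powcoef (a : R[i]) k : cmeasurable (powcoef a k).
Proof.
apply: cmeasurableM; first exact: cmeasurable_cpow.
apply: cmeasurableM; last exact: cmeasurable_cst.
apply: cmeasurableX; split => //=.
by apply: measurable_funM => //; exact: measurable_ln.
Qed.

Context {n m : nat}.

Lemma measurable_frame_mratio (j : 'I_m) :
  measurable_fun setT (fun z : MX R n m * MX R n m =>
    mratio (gram ((z.2 : 'M[R]_(n, m))^T *m (z.1 : 'M[R]_(n, m)))) j).
Proof.
apply: measurable_mratio; apply: measurable_gram.
apply: measurable_mulmx => a b; last first.
  by apply: (measurableT_comp (measurable_entry a b)); exact: measurable_fst.
under eq_fun do rewrite mxE.
by apply: (measurableT_comp (measurable_entry b a)); exact: measurable_snd.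
Qed.

(** Arbitrary factors [F] cover at once the kernel itself, its Taylor coefficients and its truncated
    series. *)
Definition fkernel (F : 'I_m -> R -> R[i]) (u v : 'M[R]_(n, m)) : R[i] :=
  \prod_j F j (mratio (gram (v^T *m u)) j).

Lemma cmeasurable_fkernel2 F : (forall j, cmeasurable (F j)) ->
  cmeasurable (fun z : MX R n m * MX R n m => fkernel F z.1 z.2).
Proof.
move=> mF; apply: cmeasurable_prod => j.
exact: (cmeasurable_comp (mF j) (measurable_frame_mratio j)).
Qed.

Lemma cmeasurable_fkernel F (u : 'M[R]_(n, m)) : (forall j, cmeasurable (F j)) ->
  cmeasurable (fun v : MX R n m => fkernel F u v).
Proof.
move=> mF; have [m1 m2] := cmeasurable_fkernel2 mF.
by split; [exact: (measurable_fun_pair2 (u : MX R n m) m1)|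
  exact: (measurable_fun_pair2 (u : MX R n m) m2)].
Qed.

Lemma TkernelE (u v : 'M[R]_(n, m)) lam :
  Tkernel u v lam = fkernel (fun j x => cpow x (lam j / 2)) u v.
Proof. by rewrite /Tkernel /cmpow /fkernel /mratio /gram trmx_mul trmxK. Qed.

Lemma cmeasurable_Tkernel2 lam :
  cmeasurable (fun z : MX R n m * MX R n m => Tkernel z.1 z.2 lam).
Proof.
have -> : (fun z : MX R n m * MX R n m => Tkernel z.1 z.2 lam) =
    (fun z => fkernel (fun j x => cpow x (lam j / 2)) z.1 z.2).
  by apply/funext => z; exact: TkernelE.
by apply: cmeasurable_fkernel2 => j; exact: cmeasurable_cpow.
Qed.

Lemma cmeasurable_Tkernel (u : 'M[R]_(n, m)) lam :
  cmeasurable (fun v : MX R n m => Tkernel u v lam).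
Proof.
have -> : (fun v : MX R n m => Tkernel u v lam) =
    (fun v => fkernel (fun j x => cpow x (lam j / 2)) u v).
  by apply/funext => v; exact: TkernelE.
by apply: cmeasurable_fkernel => j; exact: cmeasurable_cpow.
Qed.

Lemma cnorm_Tkernel (u v : 'M[R]_(n, m)) lam :
  (cnorm (Tkernel u v lam))%:E = akernel (fun j => Re (lam j) / 2) u v.
Proof.
rewrite TkernelE /fkernel /akernel /pkernel cnorm_prod; congr EFin.
by apply: eq_bigr => j _; rewrite cnorm_cpow Re_half.
Qed.

Lemma TdomainE (lam : 'I_m -> R[i]) : Tdomain lam <->
  forall j : 'I_m, - (m - j)%:R < 2 * (Re (lam j) / 2).
Proof.
have E (j : 'I_m) : (2 * (Re (lam j) / 2)) = Re (lam j) by lra.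
have F (j : 'I_m) : - (m - j)%:R = j%:R - m%:R :> R.
  by rewrite natrB ?opprB// ltnW.
by split=> H j; move: (H j); rewrite E F.
Qed.

Lemma Tdomain_margin (lam : 'I_m -> R[i]) : Tdomain lam ->
  exists N, forall j : 'I_m, j%:R - m%:R + N.+1%:R^-1 < Re (lam j).
Proof.
move=> lamD; have /choice[K Kj] (j : 'I_m) := ltr_add_invr (lamD j).
exists (\max_j K j)%N => j; apply: le_lt_trans (Kj j).
by rewrite lerD2l lef_pV2 ?posrE// ler_nat ltnS leq_bigmax.
Qed.

End operator_kernel.

(** * Almost everywhere convergence and the bound on L^1 *)

Section stiefel_operator.
Context {R : realType} {n m : nat}.
Hypothesis mn : (m < n)%N.
Variable mu : {finite_measure set (MX R n m) -> \bar R}.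
Hypothesis mu_gt0 : (0 < mu setT)%E.
Hypothesis mu_stiefel : mu (~` (@stiefel R n m : set (MX R n m))) = 0%E.
Hypothesis mu_invariant : forall Q : 'M[R]_n, orthogonal_mx Q ->
  forall A : set (MX R n m), measurable A ->
  mu ((fun v : MX R n m => (Q *m v : 'M[R]_(n, m))) @^-1` A) = mu A.

Local Notation Re := complex.Re.
Local Notation Im := complex.Im.
Implicit Types (f : MX R n m -> R[i]) (lam : 'I_m -> R[i]).

Definition potential s f (u : 'M[R]_(n, m)) : \bar R :=
  (\int[mu]_v ((cnorm (f v))%:E * akernel s u v))%E.

(** Integration over u for a fixed frame v; by Tonelli this is the factor relating the integral of
    [potential] to the L^1 norm of f. *)
Definition operator_mass s : \bar R :=
  (\int[mu]_u akernel s u (pid_mx m : 'M[R]_(n, m)))%E.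

Lemma operator_mass_ge0 s : (0 <= operator_mass s)%E.
Proof. by apply: integral_ge0 => u _; exact: akernel_ge0. Qed.

Lemma operator_mass_lty s : (forall j : 'I_m, - (m - j)%:R < 2 * s j) ->
  (operator_mass s < +oo)%E.
Proof.
move=> /(kernel_mass_lty mn mu_stiefel mu_invariant) soo.
have e := kernel_mass_l (ltnW mn) mu_stiefel mu_invariant s.
rewrite ltNge leye_eq; apply/eqP => oo; move: e.
rewrite -/(operator_mass s) oo gt0_mulye// => /eqP; apply/negP.
rewrite eq_sym lt_eqF//; apply: lte_mul_pinfty => //.
- exact: kernel_mass_ge0.
- by rewrite ge0_fin_numE// kernel_mass_ge0.
- by rewrite ltey_eq fin_num_measure.
Qed.

Lemma measurable_cnorm_akernel s f : cmeasurable f ->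
  measurable_fun setT (fun z : MX R n m * MX R n m =>
    (cnorm (f z.2))%:E * akernel s z.1 z.2)%E.
Proof.
move=> /measurable_cnorm mf; apply: emeasurable_funM; last exact: measurable_akernel.
exact: (measurableT_comp mf measurable_snd).
Qed.

Lemma cnorm_akernel_ge0 s f (u v : MX R n m) :
  (0 <= (cnorm (f v))%:E * akernel s u v)%E.
Proof. by apply: mule_ge0; [rewrite lee_fin cnorm_ge0|exact: akernel_ge0]. Qed.

Lemma measurable_potential s f : cmeasurable f ->
  measurable_fun setT (fun u : MX R n m => potential s f u).
Proof.
move=> /(measurable_cnorm_akernel s) mf.
exact: (measurable_fun_fubini_tonelli_F _ mf (fun z => cnorm_akernel_ge0 s f z.1 z.2)).
Qed.

Lemma integral_potential s f : cmeasurable f ->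
  (\int[mu]_u potential s f u = operator_mass s * \int[mu]_v (cnorm (f v))%:E)%E.
Proof.
move=> mf; have mfa := measurable_cnorm_akernel s mf; have mc := measurable_cnorm mf.
rewrite /potential.
pose K (z : MX R n m * MX R n m) := ((cnorm (f z.2))%:E * akernel s z.1 z.2)%E.
have K0 z : (0 <= K z)%E by exact: cnorm_akernel_ge0.
rewrite (fubini_tonelli K)//=.
have c0 v : (0 <= (cnorm (f v))%:E)%E by rewrite lee_fin cnorm_ge0.
rewrite -ge0_integralZl//; last exact: operator_mass_ge0.
apply: ge0_ae_eq_integral => //.
- exact: (measurable_fun_fubini_tonelli_G K).
- exact: emeasurable_funM.
- by move=> v _; apply: integral_ge0 => u _; exact: cnorm_akernel_ge0.
- by move=> v _; rewrite mule_ge0// operator_mass_ge0.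
have AE := ae_filter_ringOfSetsType mu.
apply: filterS (ae_stiefel mu_stiefel) => v v1 _.
transitivity ((cnorm (f v))%:E * \int[mu]_u akernel s u v)%E.
  rewrite -ge0_integralZl//; first exact: measurable_akernel_l.
  by move=> u _; exact: akernel_ge0.
by rewrite (integral_akernel_frame_l (ltnW mn) mu_invariant)// muleC.
Qed.

Lemma potential_ge0 s f u : (0 <= potential s f u)%E.
Proof. by apply: integral_ge0 => v _; exact: cnorm_akernel_ge0. Qed.

Lemma integral_potential_lty s f : cintegrable mu setT f ->
  (forall j : 'I_m, - (m - j)%:R < 2 * s j) ->
  (\int[mu]_u potential s f u < +oo)%E.
Proof.
move=> fi sP; have mf := cintegrable_cmeasurable fi.
rewrite integral_potential//; apply: lte_mul_pinfty.
- exact: operator_mass_ge0.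
- by rewrite ge0_fin_numE ?operator_mass_ge0// operator_mass_lty.
- exact: cintegrable_cnorm.
Qed.

Lemma ae_potential_lty s f : cintegrable mu setT f ->
  (forall j : 'I_m, - (m - j)%:R < 2 * s j) ->
  \forall u \ae mu, (potential s f u < +oo)%E.
Proof.
move=> fi sP; have mf := cintegrable_cmeasurable fi.
have ip : mu.-integrable setT (potential s f : MX R n m -> \bar R).
  apply/integrableP; split; first exact: measurable_potential.
  under eq_integral do rewrite gee0_abs ?potential_ge0//.
  exact: integral_potential_lty.
have AE := ae_filter_ringOfSetsType mu.
apply: filterS (integrable_ae measurableT ip) => u /(_ I).
by rewrite ge0_fin_numE// potential_ge0.
Qed.

(** Half of the boundary value raised by 1/(N+1): these countably many exponents approach the
    boundary of the domain from inside. *)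
Definition margin N (j : 'I_m) : R := (j%:R - m%:R + N.+1%:R^-1) / 2.

Lemma marginP N (j : 'I_m) : - (m - j)%:R < 2 * margin N j.
Proof.
have N0 : 0 < N.+1%:R^-1 :> R by rewrite invr_gt0.
rewrite /margin natrB; last exact/ltnW.
by rewrite mulrC divfK ?pnatr_eq0// opprB ltrDl.
Qed.

(** A set of u independent of lambda, of full measure for integrable f, on which all exponents of
    the domain are controlled at once. *)
Definition tame f (u : 'M[R]_(n, m)) :=
  gram u = 1%:M /\ forall N, (potential (margin N) f u < +oo)%E.

Lemma ae_tame f : cintegrable mu setT f -> \forall u \ae mu, tame f u.
Proof.
move=> fi; have AE := ae_filter_ringOfSetsType mu.
apply: filterS2 (ae_stiefel mu_stiefel) _; last first.
  by apply: ae_foralln => N; apply: (ae_potential_lty fi (@marginP N)).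
by move=> u u1 uN; split.
Qed.

Lemma tame_cintegrable f u N (g : MX R n m -> R[i]) :
  cmeasurable f -> cmeasurable g -> tame f u ->
  (forall v : MX R n m, gram (v : 'M[R]_(n, m)) = 1%:M ->
     ((cnorm (g v))%:E <= akernel (margin N) u v)%E) ->
  cintegrable mu setT (fun v => f v * g v).
Proof.
move=> mf mg [u1 uN] gN; have mc := measurable_cnorm mf.
apply: (@cintegrable_le _ _ _ _ _
  (fun v => (cnorm (f v))%:E * akernel (margin N) u v)%E).
- exact: cmeasurableM.
- by apply: emeasurable_funM => //; exact: measurable_akernel_r.
- have AE := ae_filter_ringOfSetsType mu.
  apply: filterS (ae_stiefel mu_stiefel) => v v1.
  by rewrite cnormM EFinM lee_pmul// ?lee_fin ?cnorm_ge0// -lee_fin gN.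
- by move=> v; exact: cnorm_akernel_ge0.
- exact: uN.
Qed.

Lemma tame_Tkernel f u lam : cmeasurable f -> tame f u -> Tdomain lam ->
  cintegrable mu setT (fun v => f v * Tkernel u v lam).
Proof.
move=> mf uf /Tdomain_margin[N lamN].
apply: (@tame_cintegrable _ u N) => //; first exact: cmeasurable_Tkernel.
move=> v v1; rewrite cnorm_Tkernel; apply: akernel_le_exp => //; first by case: uf.
by move=> j; rewrite ler_pM2r ?invr_gt0// ltW.
Qed.

(** The constant function 1 suffices as a test: a single frame u at which its integral converges
    absolutely makes the kernel mass finite. *)
Lemma convergence_Tdomain lam :
  (forall f, cintegrable mu setT f -> \forall u \ae mu,
     cintegrable mu setT (fun v : MX R n m => f v * Tkernel u v lam)) ->
  Tdomain lam.
Proof.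
move=> H; apply/TdomainE.
have i1 : cintegrable mu setT (fun _ : MX R n m => 1 : R[i]).
  apply: cintegrableP; first exact: cmeasurable_cst.
  under eq_integral do rewrite cnorm1.
  by rewrite integral_cst// mul1e ltey_eq fin_num_measure.
have AE := ae_filter_ringOfSetsType mu.
have [u [u1 iu]] : exists u : MX R n m, gram (u : 'M[R]_(n, m)) = 1%:M /\
    cintegrable mu setT (fun v : MX R n m => 1 * Tkernel u v lam).
  apply: (ae_witness mu_gt0); apply: filterS2 (ae_stiefel mu_stiefel) (H _ i1).
  by move=> u.
apply: (kernel_mass_lty_inv mn mu_stiefel mu_invariant) => //.
rewrite -(integral_akernel_frame (ltnW mn) mu_invariant _ u1).
have := cintegrable_cnorm iu; congr (_ < _)%E; apply: eq_integral => v _.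
by rewrite mul1r cnorm_Tkernel.
Qed.

(** The inner integral may diverge for some u, so measurability is obtained from Tonelli on positive
    and negative parts, followed by [fine], as in the definition of [Rintegral]. *)
Lemma cmeasurable_Top f lam : cmeasurable f -> cmeasurable (Top mu lam f).
Proof.
move=> mf; have /cmeasurableM/(_ (@cmeasurable_Tkernel2 R n m lam))[k1 k2] :=
  cmeasurable_comp mf (@measurable_snd _ _ (MX R n m) (MX R n m)).
have part (h : MX R n m * MX R n m -> R) : measurable_fun setT h ->
    measurable_fun setT (fun u => Rintegral mu setT (fun v => h (u, v))).
  move=> /measurable_EFinP mh.
  have Fp := @measurable_fun_fubini_tonelli_F _ _ _ _ _ mu _ (measurable_funepos mh)
    (funepos_ge0 _).
  have Fn := @measurable_fun_fubini_tonelli_F _ _ _ _ _ mu _ (measurable_funeneg mh)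
    (funeneg_ge0 _).
  have -> : (fun u => Rintegral mu setT (fun v => h (u, v))) =
      fine \o (fubini_F mu (EFin \o h)^\+ \- fubini_F mu (EFin \o h)^\-)%E.
    apply/funext => u; rewrite /Rintegral integralE /fubini_F.
    by congr (fine (_ - _)); apply: eq_integral => v _; rewrite ?funeposE ?funenegE.
  exact: (measurableT_comp (fine_measurable measurableT) (emeasurable_funB Fp Fn)).
by split; [exact (part _ k1)|exact (part _ k2)].
Qed.

Lemma Top_bounded lam : Tdomain lam -> exists C : R, forall f,
  cintegrable mu setT f -> cintegrable mu setT (Top mu lam f) /\
  Rintegral mu setT (fun u => cnorm (Top mu lam f u)) <=
    C * Rintegral mu setT (fun v => cnorm (f v)).
Proof.
move=> /TdomainE lamD; pose s (j : 'I_m) := Re (lam j) / 2.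
(* The factor 2 comes from estimating the real and imaginary parts separately; the mass is finite on
   the domain. *)
exists (fine (2%:E * operator_mass s)%E) => f fi.
have mf := cintegrable_cmeasurable fi; have mT := cmeasurable_Top lam mf.
have mp := measurable_potential s mf; have mc := measurable_cnorm mT.
have poo := integral_potential_lty fi lamD.
have cT : (\int[mu]_u (cnorm (Top mu lam f u))%:E <=
    2%:E * \int[mu]_u potential s f u)%E.
  rewrite -ge0_integralZl//; last by move=> u _; exact: potential_ge0.
  apply: ge0_le_integral => //.
  - by move=> u _; rewrite lee_fin cnorm_ge0.
  - exact: emeasurable_funM.
  move=> u _; have mk := cmeasurable_Tkernel u lam.
  apply: le_trans (cnorm_cintegral_le _ (cmeasurableM mf mk)) _.
  apply: lee_wpmul2l => //; rewrite le_eqVlt; apply/orP; left; apply/eqP.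
  by apply: eq_integral => v _; rewrite cnormM EFinM cnorm_Tkernel.
have Too : (2%:E * \int[mu]_u potential s f u < +oo)%E.
  by apply: lte_mul_pinfty.
split; first by apply: cintegrableP => //; exact: le_lt_trans cT Too.
have fo : (\int[mu]_v (cnorm (f v))%:E)%E \is a fin_num.
  rewrite ge0_fin_numE ?cintegrable_cnorm//.
  by apply: integral_ge0 => v _; rewrite lee_fin cnorm_ge0.
have oo : operator_mass s \is a fin_num.
  by rewrite ge0_fin_numE ?operator_mass_ge0// operator_mass_lty.
rewrite /Rintegral -fineM ?fin_numM// -muleA -integral_potential//.
rewrite fine_le//.
- rewrite ge0_fin_numE ?(le_lt_trans cT)//.
  by apply: integral_ge0 => u _; rewrite lee_fin cnorm_ge0.
- by rewrite fin_numM// integral_potential// fin_numM.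
Qed.

End stiefel_operator.

(** * Term-by-term integration of the power series *)

Section stiefel_operator_analytic.
Import numFieldNormedType.Exports.
Context {R : realType} {n m : nat}.
Variable mu : {finite_measure set (MX R n m) -> \bar R}.
Hypothesis mu_stiefel : mu (~` (@stiefel R n m : set (MX R n m))) = 0%E.

Local Notation Re := complex.Re.
Variables (f : MX R n m -> R[i]) (u : 'M[R]_(n, m)) (a : 'I_m -> R[i]) (N : nat).
Hypothesis mf : cmeasurable f.
Hypothesis uf : tame mu f u.
Hypothesis aN : forall j : 'I_m, j%:R - m%:R + N.+1%:R^-1 < Re (a j).

(** Re(a_j) exceeds the boundary by more than 1/(N+1); lowering it by less than r still leaves more
    than 1/(N+2), the level of [margin N.+1]. *)
Local Notation r := (N.+1%:R^-1 - N.+2%:R^-1 : R).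

Let r_gt0 : 0 < r.
Proof. by rewrite subr_gt0 ltf_pV2 ?posrE// ltr_nat. Qed.

Local Notation G k v := (fkernel (fun j => powcoef (a j) ((k : 'I_m -> nat) j)) u v).

Let mG k : cmeasurable (fun v : MX R n m => G k v).
Proof. by apply: cmeasurable_fkernel => j; exact: cmeasurable_powcoef. Qed.

Let margin_le (rho : R) (j : 'I_m) : rho < r -> margin N.+1 j <= (Re (a j) - rho) / 2.
Proof.
move=> rr; rewrite /margin ler_pM2r ?invr_gt0// lerBrDr ltW//.
apply: le_lt_trans (aN j); rewrite -addrA lerD2l -lerBrDl ltW//.
Qed.

Let ppow_margin (v : 'M[R]_(n, m)) (rho : R) (j : 'I_m) :
  gram v = 1%:M -> rho < r ->
  ppow (mratio (gram (v^T *m u)) j) ((Re (a j) - rho) / 2) <=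
  ppow (mratio (gram (v^T *m u)) j) (margin N.+1 j).
Proof.
move=> v1 rr; apply: ppow_le_exp; last exact: margin_le.
by apply: mratio_frames_le1 => //; case: uf.
Qed.

Let box_bound K (rho : 'I_m -> R) (v : 'M[R]_(n, m)) : gram v = 1%:M ->
  (forall j, 0 <= rho j < r) ->
  \prod_(j < m) \sum_(k < K)
     cnorm (powcoef (a j) k (mratio (gram (v^T *m u)) j)) * rho j ^+ k <=
  pkernel (margin N.+1) (gram (v^T *m u)).
Proof.
move=> v1 rhor; apply: ler_prod => j _; have /andP[rho0 rhoj] := rhor j.
rewrite sumr_ge0/= => [|k _]; last by rewrite mulr_ge0 ?cnorm_ge0 ?exprn_ge0.
apply: le_trans (ppow_margin _ v1 rhoj); apply: powcoef_bound => //.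
by apply: mratio_frames_le1 => //; case: uf.
Qed.

(** After multiplication by the monomial rho^k with 0 < rho < r, a single coefficient is at most the
    whole series of moduli, hence at most the dominating kernel. Dividing by that nonzero constant
    preserves integrability. *)
Let cintegrable_coef k : cintegrable mu setT (fun v => f v * G k v).
Proof.
pose rho : R := r / 2.
have rho0 : 0 < rho by rewrite divr_gt0.
have rhor : rho < r by rewrite ltr_pdivrMr// mulr_natr mulr2n ltrDl.
pose C : R[i] := \prod_j Complex rho 0 ^+ k j.
have rhoC : Complex rho 0 != 0 by rewrite eq_complex/= gt_eqF.
have C0 : C != 0 by apply/prodf_neq0 => j _; rewrite expf_neq0.
have -> : (fun v => f v * G k v) = (fun v => C^-1 * (f v * (C * G k v))).
  by apply/funext => v; rewrite (mulrCA _ C) mulKf.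
apply: cintegrableZ; apply: (@tame_cintegrable _ _ _ _ mu_stiefel _ u N.+1) => //.
  by apply: cmeasurableM => //; exact: cmeasurable_cst.
move=> v v1; rewrite lee_fin cnormM /C /fkernel !cnorm_prod -big_split/=.
apply: ler_prod => j _; rewrite cnormX cnorm_real ger0_norm ?(ltW rho0)//.
rewrite mulr_ge0 ?cnorm_ge0 ?exprn_ge0 ?(ltW rho0)//=.
apply: le_trans (ppow_margin _ v1 rhor); rewrite mulrC.
have x1 : mratio (gram (v^T *m u)) j <= 1.
  by apply: mratio_frames_le1 => //; case: uf.
apply: le_trans (powcoef_bound (a j) (k j).+1 (ltW rho0) x1).
rewrite big_ord_recr/= lerDr sumr_ge0// => i _.
by rewrite mulr_ge0 ?cnorm_ge0 ?exprn_ge0 ?(ltW rho0).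
Qed.

Let dom (v : MX R n m) : \bar R := ((cnorm (f v))%:E * akernel (margin N.+1) u v)%E.

Let mdom : measurable_fun setT dom.
Proof.
by apply: emeasurable_funM; [exact: measurable_cnorm|exact: measurable_akernel_r].
Qed.

Variable z : 'I_m -> R[i].
Hypothesis za : forall j, cnorm (z j - a j) < r.

Let rho_bounds j : 0 <= cnorm (z j - a j) < r.
Proof. by rewrite cnorm_ge0 za. Qed.

Lemma coef_sum_le K :
  ((\sum_(k : {ffun 'I_m -> 'I_K})
     cnorm (cintegral mu setT (fun v => f v * G (fun j => nat_of_ord (k j)) v)) *
     \prod_(j < m) cnorm (z j - a j) ^+ k j)%:E <=
   2%:E * potential mu (margin N.+1) f u)%E.
Proof.
pose P (k : {ffun 'I_m -> 'I_K}) := \prod_(j < m) cnorm (z j - a j) ^+ k j.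
have P0 k : 0 <= P k by apply: prodr_ge0 => j _; rewrite exprn_ge0 ?cnorm_ge0.
pose g (k : {ffun 'I_m -> 'I_K}) (v : MX R n m) : \bar R :=
  ((cnorm (f v * G (fun j => nat_of_ord (k j)) v))%:E * (P k)%:E)%E.
have mg k : measurable_fun setT (g k).
  by apply: emeasurable_funM => //; apply: measurable_cnorm; exact: cmeasurableM.
have g0 k v : (0 <= g k v)%E.
  by apply: mule_ge0; rewrite lee_fin ?cnorm_ge0.
apply: (@le_trans _ _ (\sum_k (2%:E * \int[mu]_v g k v))%E).
  rewrite -sumEFin; apply: lee_sum => k _; rewrite /g ge0_integralZr//.
  - rewrite muleA EFinM; apply: lee_wpmul2r; first by rewrite lee_fin; exact: P0.
    exact: (cnorm_cintegral_le mu (cmeasurableM mf (mG _))).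
  - by apply: measurable_cnorm; exact: cmeasurableM.
  - by move=> v _; rewrite lee_fin cnorm_ge0.
  - by rewrite lee_fin.
rewrite -ge0_sume_distrr; last by move=> k _; exact: integral_ge0.
apply: lee_wpmul2l => //; rewrite -ge0_integral_sum//.
apply: ae_ge0_le_integral => //.
- by move=> v _; apply: sume_ge0 => k _.
- exact: emeasurable_sum.
- by move=> v _; exact: cnorm_akernel_ge0.
have AE := ae_filter_ringOfSetsType mu.
apply: filterS (ae_stiefel mu_stiefel) => v v1 _.
rewrite /g; under eq_bigr do rewrite cnormM -EFinM -mulrA.
rewrite sumEFin -mulr_sumr EFinM lee_pmul ?lee_fin ?cnorm_ge0//.
  by apply: sumr_ge0 => k _; rewrite mulr_ge0 ?cnorm_ge0.
(* A sum over a box of multi-indices is a product of one-variable sums, to which the bound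
   applies. *)
apply: le_trans (box_bound K v1 rho_bounds).
rewrite bigA_distr_bigA/= le_eqVlt; apply/orP; left; apply/eqP.
by apply: eq_bigr => k _; rewrite /fkernel cnorm_prod -big_split.
Qed.

(** By distributivity, each box sum is the integral of f times a product of truncated one-variable
    series. These products converge pointwise to the kernel and are dominated by [dom] uniformly in
    K. *)
Lemma ccvg_coef_sum :
  ccvg (fun K => \sum_(k : {ffun 'I_m -> 'I_K})
     cintegral mu setT (fun v => f v * G (fun j => nat_of_ord (k j)) v) *
     \prod_(j < m) (z j - a j) ^+ k j) (Top mu z f u).
Proof.
pose F K (v : MX R n m) := f v *
  fkernel (fun j x => \sum_(k < K) powcoef (a j) k x * (z j - a j) ^+ k) u v.
have FE K : (fun v => F K v) = (fun v => \sum_(k : {ffun 'I_m -> 'I_K})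
    \prod_(j < m) (z j - a j) ^+ k j * (f v * G (fun j => nat_of_ord (k j)) v)).
  apply/funext => v; rewrite /F /fkernel bigA_distr_bigA/= mulr_sumr.
  by apply: eq_bigr => k _; rewrite big_split/= [RHS]mulrC -mulrA.
have -> : (fun K => \sum_(k : {ffun 'I_m -> 'I_K})
     cintegral mu setT (fun v => f v * G (fun j => nat_of_ord (k j)) v) *
     \prod_(j < m) (z j - a j) ^+ k j) = (fun K => cintegral mu setT (F K)).
  apply/funext => K; rewrite -[F K]/(fun v => F K v) FE.
  rewrite (cintegral_sum _).2; last by move=> k; exact: cintegrableZ.
  by apply: eq_bigr => k _; rewrite cintegralZ// mulrC.
have idom : mu.-integrable setT dom.
  apply/integrableP; split; first exact: mdom.
  under eq_integral do rewrite gee0_abs ?cnorm_akernel_ge0//.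
  by case: uf => _; exact.
apply: (ccvg_cintegral _ _ _ idom).
- move=> K; apply: cmeasurableM => //; apply: cmeasurable_fkernel => j.
  apply: cmeasurable_sum => k; apply: cmeasurableM; first exact: cmeasurable_powcoef.
  exact: cmeasurable_cst.
- by apply: cmeasurableM => //; exact: cmeasurable_Tkernel.
- move=> v; apply: ccvgM; first exact: ccvg_cst.
  rewrite TkernelE; apply: ccvg_prod => j.
  by rewrite -[X in cpow _ (X / _)](subrKC (a j)); exact: ccvg_powcoef.
have AE := ae_filter_ringOfSetsType mu.
apply: filterS (ae_stiefel mu_stiefel) => v v1 K.
rewrite cnormM EFinM lee_pmul ?lee_fin ?cnorm_ge0//.
apply: le_trans (box_bound K v1 rho_bounds); rewrite /fkernel cnorm_prod.
apply: ler_prod => j _; rewrite cnorm_ge0/= (le_trans (cnorm_sum _ _))//.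
by apply: ler_sum => k _; rewrite cnormM cnormX.
Qed.

End stiefel_operator_analytic.

Section stiefel_theorem.
Import numFieldNormedType.Exports.
Context {R : realType} {n m : nat}.

Lemma tame_analytic (mu : {finite_measure set (MX R n m) -> \bar R})
    (mu_stiefel : mu (~` (@stiefel R n m : set (MX R n m))) = 0%E)
    (f : MX R n m -> R[i]) (u : 'M[R]_(n, m)) :
  cmeasurable f -> tame mu f u ->
  analytic_on (@Tdomain R m) (fun lam => Top mu lam f u).
Proof.
move=> mf uf a /Tdomain_margin[N aN].
exists (N.+1%:R^-1 - N.+2%:R^-1); split.
  by rewrite subr_gt0 ltf_pV2 ?posrE// ltr_nat.
exists (fun k => cintegral mu setT
  (fun v => f v * fkernel (fun j => powcoef (a j) (k j)) u v)) => z za.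
split.
(* The polydisc stays in the domain: a real part drops by less than 1/(N+1) - 1/(N+2), less than its
   distance to the boundary. *)
- move=> j; have N0 : 0 < N.+2%:R^-1 :> R by rewrite invr_gt0.
  have := Re_le_cnorm (z j - a j); have := za j; have := aN j.
  have -> : complex.Re (z j - a j) = complex.Re (z j) - complex.Re (a j).
    by rewrite creD; case: (a j).
  rewrite ler_norml => aj zj /andP[zaj _]; rewrite -subr_gt0.
  move: aj zj zaj N0; move: (N.+1%:R^-1) (N.+2%:R^-1) => e e'; lra.
- exists (fine (2%:E * potential mu (margin N.+1) f u)%E) => K.
  rewrite -lee_fin fineK; first exact: coef_sum_le.
  rewrite fin_numM// ge0_fin_numE ?potential_ge0//.
  by case: uf.
move=> e e0; have := ccvg_coef_sum mu_stiefel mf uf aN za.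
move=> /cvgr0Pnorm_lt/(_ e e0)[K _ KP].
exists K => K' KK'; have := KP K' KK'; apply: le_lt_trans.
exact: ler_norm.
Qed.

End stiefel_theorem.

Theorem theorem4p1 (R : realType) (n m : nat) (hnm : (m < n)%N)
    (mu : {measure set (MX R n m) -> \bar R})
    (hmu : stiefel_invariant_measure mu) :
  (* absolute a.e. convergence for every f in L^1  <->  Re lambda_j > j - m - 1 *)
  (forall lam : 'I_m -> R[i],
     (forall f : MX R n m -> R[i], cintegrable mu setT f ->
        \forall u \ae mu,
          cintegrable mu setT (fun v : MX R n m => f v * Tkernel u v lam))
     <-> Tdomain lam)
  (* for f in L^1 and a.e. u: convergence on the whole domain, and analyticity
     of lambda |-> (T^lambda f)(u) there *)
  /\ (forall f : MX R n m -> R[i], cintegrable mu setT f ->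
        \forall u \ae mu,
          (forall lam, Tdomain lam ->
             cintegrable mu setT (fun v : MX R n m => f v * Tkernel u v lam))
          /\ analytic_on (@Tdomain R m) (fun lam => Top mu lam f u))
  (* boundedness of T^lambda on L^1 in the domain *)
  /\ (forall lam : 'I_m -> R[i], Tdomain lam ->
        exists C : R, forall f : MX R n m -> R[i], cintegrable mu setT f ->
          cintegrable mu setT (Top mu lam f) /\
          Rintegral mu setT (fun u => cnorm (Top mu lam f u))
            <= C * Rintegral mu setT (fun v => cnorm (f v))).
Proof.
case: hmu => mu_gt0 mu_fin mu_stiefel mu_invariant.
(* The total mass being finite, [mu] is repackaged as a finite measure, the type over which the
   preceding results are stated. *)
have [nu muE] : exists nu : {finite_measure set (MX R n m) -> \bar R},
    mu = nu :> {measure set (MX R n m) -> \bar R}.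
  exists (mfrestr measurableT mu_fin); apply: eq_measure.
  by apply/funext => A; rewrite -[RHS]/(mu (A `&` setT)) setIT.
subst mu; have AE := ae_filter_ringOfSetsType nu.
split; last split.
- move=> lam; split; first exact: convergence_Tdomain.
  move=> lamD f fi; have mf := cintegrable_cmeasurable fi.
  by apply: filterS (ae_tame hnm mu_gt0 mu_stiefel mu_invariant fi) => u uf; exact: tame_Tkernel.
- move=> f fi; have mf := cintegrable_cmeasurable fi.
  apply: filterS (ae_tame hnm mu_gt0 mu_stiefel mu_invariant fi) => u uf.
  by split; [move=> lam; exact: tame_Tkernel|exact: tame_analytic].
- exact: Top_bounded.
Qed.
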